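(* A family of functions $\{f_n\}_{n\in\mathbb{Z}}$ on $\mathbb{R}$ is of the form $f_n=T_nF$ for some $F\in H^1(\mathbb{R}^2)$ if and only if each $f_n\in\tilde H^{1/2}(\mathbb{R})$, each $f_n-f_{n+1}\in L^2(\mathbb{R})$, and $$\sum_n\|f_n\|_{\tilde H^{1/2}(\mathbb{R})}^2+\sum_n\|f_n-f_{n+1}\|_{L^2(\mathbb{R})}^2<\infty;$$ moreover the corresponding norm equivalence holds: this quantity for $f_n=T_nF$ is bounded by a constant times $\|F\|_{H^1(\mathbb{R}^2)}^2$, and conversely for such a family one can choose $F$ with $\|F\|_{H^1(\mathbb{R}^2)}^2$ bounded by a constant times this quantity (constants independent of the functions).
   Context: $H^1(\mathbb{R}^2)$ is the homogeneous Sobolev space of functions with distributional gradient in $L^2(\mathbb{R}^2)$ (modulo constants), with $\|F\|_{H^1(\mathbb{R}^2)}^2=\int_{\mathbb{R}^2}|\nabla F|^2$. For $F\in H^1(\mathbb{R}^2)$, $T_nF(x)=F(x,\pi n)$ is the trace of $F$ on the horizontal line $y=\pi n$. $\tilde H^{1/2}(\mathbb{R})$ is the space of locally $L^2$ functions $f$ (modulo constants) with $\|f\|_{\tilde H^{1/2}(\mathbb{R})}^2=\iint_{|x-y|\le1}\frac{|f(x)-f(y)|^2}{|x-y|^2}\,dx\,dy<\infty$. *)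

(* Defs.v *)
From HB Require Import structures.
From mathcomp Require Import all_boot all_order all_algebra.
From mathcomp Require Import all_classical all_reals all_analysis.
Set Implicit Arguments. Unset Strict Implicit. Unset Printing Implicit Defensive.
Import Order.TTheory GRing.Theory Num.Theory.
Import numFieldNormedType.Exports.
Local Open Scope classical_set_scope.
Local Open Scope ring_scope.

Definition leb (R : realType) := @lebesgue_measure R.
Definition leb2 (R : realType) := ((@lebesgue_measure R) \x (@lebesgue_measure R))%E.
Arguments leb R : clear implicits.
Arguments leb2 R : clear implicits.

Definition L2 (R : realType) (f : R -> R) : Prop :=
  measurable_fun [set: R] f /\
  (leb R).-integrable [set: R] (fun x => ((f x) ^+ 2)%R%:E).

Definition L2_norm2 (R : realType) (f : R -> R) : \bar R :=
  (\int[leb R]_x ((f x) ^+ 2)%R%:E)%E.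

Definition L2loc (R : realType) (f : R -> R) : Prop :=
  measurable_fun [set: R] f /\
  forall a b : R, (leb R).-integrable `[a, b] (fun x => ((f x) ^+ 2)%R%:E).

Definition Hhalf_norm2 (R : realType) (f : R -> R) : \bar R :=
  (\int[leb2 R]_(p in [set p : R * R | (`|p.1 - p.2| <= 1)%R])
      (((f p.1 - f p.2) ^+ 2) / ((p.1 - p.2) ^+ 2))%R%:E)%E.

Definition Hhalf (R : realType) (f : R -> R) : Prop :=
  L2loc f /\ (Hhalf_norm2 f < +oo)%E.

Definition d1 (R : realType) (phi : R * R -> R) : R * R -> R :=
  fun p => derive1 (fun s => phi (s, p.2)) p.1.
Definition d2 (R : realType) (phi : R * R -> R) : R * R -> R :=
  fun p => derive1 (fun t => phi (p.1, t)) p.2.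

Definition test_fun (R : realType) (phi : R * R -> R) : Prop :=
  (forall p : R * R, derivable (fun s => phi (s, p.2)) p.1 1 /\
                     derivable (fun t => phi (p.1, t)) p.2 1) /\
  continuous phi /\ continuous (d1 phi) /\ continuous (d2 phi) /\
  exists M : R, forall p : R * R, M < `|p.1| \/ M < `|p.2| -> phi p = 0.

Definition L2_R2 (R : realType) (G : R * R -> R) : Prop :=
  measurable_fun [set: R * R] G /\
  (leb2 R).-integrable [set: R * R] (fun p => ((G p) ^+ 2)%R%:E).

(* F is locally integrable on R^2 and (G1, G2) is its weak gradient,
   lying in L^2(R^2): this is F in (homogeneous) H^1(R^2). *)
Definition H1_grad (R : realType) (F G1 G2 : R * R -> R) : Prop :=
  measurable_fun [set: R * R] F /\
  (forall M : R, (leb2 R).-integrable (`[-M, M] `*` `[-M, M])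
                   (fun p => (F p)%:E)) /\
  L2_R2 G1 /\ L2_R2 G2 /\
  forall phi, test_fun phi ->
    (\int[leb2 R]_p (F p * d1 phi p)%R%:E = - \int[leb2 R]_p (G1 p * phi p)%R%:E)%E /\
    (\int[leb2 R]_p (F p * d2 phi p)%R%:E = - \int[leb2 R]_p (G2 p * phi p)%R%:E)%E.

Definition H1_norm2 (R : realType) (G1 G2 : R * R -> R) : \bar R :=
  (\int[leb2 R]_p ((G1 p) ^+ 2 + (G2 p) ^+ 2)%R%:E)%E.

(* f is the trace of F on the line y = c: f is locally L^2 and
   F(., c + t) -> f in L^2_loc in the averaged sense
   (1/e) \int_0^e \int_a^b |F(x, c+t) - f(x)|^2 dx dt -> 0 as e -> 0+. *)
Definition is_trace (R : realType) (F : R * R -> R) (c : R) (f : R -> R) : Prop :=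
  L2loc f /\
  forall a b : R,
    (fun e : R => (e^-1)%R%:E *
       \int[leb2 R]_(p in `[a, b] `*` `[c, (c + e)%R]) (((F p - f p.1) ^+ 2)%R%:E))%E
      @ 0^'+ --> 0%E.

Definition line_height (R : realType) (n : int) : R := pi * n%:~R.

Definition family_norm2 (R : realType) (f : int -> R -> R) : \bar R :=
  (esum [set: int] (fun n => Hhalf_norm2 (f n)) +
   esum [set: int] (fun n => L2_norm2 (fun x => (f n x - f (n + 1)%R x)%R)))%E.

(* Main.v *)
(** Restriction.  For a one-sided mollification U of F at scale e near the line
    y = c, the increment of the trace is split as U(x + t, c) - U(x, c) =
    [U(x + t, c) - U(x + t, c + t)] + [U(x + t, c + t) - U(x, c + t)] + [U(x, c + t) - U(x, c)].
    The vertical pieces are integrals of the weak derivative G2 over a segment of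
    length about t, the horizontal one is an integral of G1; dividing by t and
    integrating in (x, t), Hardy's inequality (a Schur test with the weight
    sqrt(|y - c| + e)) bounds both by the energy in a strip above the line,
    uniformly in e.  Fatou's lemma along a sequence e -> 0 for which U(., c) -> f
    almost everywhere gives the bound for f.  The difference of two consecutive
    traces is handled by Cauchy-Schwarz on vertical segments, and the strips
    overlap boundedly.

    Extension.  Put V_f(x, t) = (1 - t / pi) * \int f(x + s) b_(t/pi)(s) ds for
    0 < t < pi, with b_s a bump of mass 1 on [0, s], and let F be the sum over n
    of V_(f_n)(x, |y - pi n|); on each strip only two terms are nonzero.  The
    kernel of the x-derivative of V_f has mass 0 and that of its t-derivative has
    mass -1 / pi, so both derivatives are averages of f(x + s) - f(x) with kernels
    of size (t / pi)^-2, controlled by the Gagliardo seminorm, up to the term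
    - f(x) / pi; between two consecutive lines these terms add up to
    (f_(n+1) - f_n) / pi, which is in L^2. *)

Require Import Defs.
From HB Require Import structures.
From mathcomp Require Import all_boot all_order all_algebra.
From mathcomp Require Import all_classical all_reals all_analysis.
From mathcomp Require Import measurable_realfun ring lra zify.
Set Implicit Arguments. Unset Strict Implicit. Unset Printing Implicit Defensive.
Import Order.TTheory GRing.Theory Num.Theory.
Import numFieldNormedType.Exports.
Local Open Scope classical_set_scope.
Local Open Scope ring_scope.

(** * Measurability, Tonelli and Schur tests *)

(** Since F has no pointwise values to work with, traces are estimated through differences of
    mollifications. Such a difference is F tested against a product in which one factor is the
    derivative of a smoothed indicator, namely a difference of two bells; because the bells have
    equal mass the smoothed indicator has compact support, and the weak gradient yields an exact
    formula at every scale e. The densities carry (t + 2e)^-2 in place of t^-2, which keeps the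
    constants independent of e.

    For the extension the obstacle is the kernel of the t-derivative: it has size t^-2 on an
    interval of length t, so the triple integral in (x, t, s) against a bounded function need not
    converge absolutely, and each side of a line alone would leave a boundary term there. Folding
    the two sides together cures both: the test function then enters only through phi(x, c + t) -
    phi(x, c - t), which is of size t. The factor 1 - t / pi removes the boundary term at t = pi,
    and the factors of two adjacent lines add up to 1, so the glued function still has the
    prescribed traces. *)

Section measurability.
Context d (T : measurableType d) (R : realType).

Lemma measurable_fun_bool_real (P : T -> bool) :
  measurable_fun setT P -> measurable_fun setT (fun t => (P t)%:R : R).
Proof.
move=> mP; rewrite (_ : (fun _ => _) = (fun t => if P t then 1 else 0 : R)).
  exact: measurable_fun_ifT.
by apply/funext => t; case: (P t).
Qed.

(** Inversion is the sign times a power of the absolute value; at 0 both sides are 0, since the sign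
    of 0 and the inverse of 0 are 0 by convention. *)
Lemma measurable_invr : measurable_fun [set: R] (@GRing.inv R).
Proof.
rewrite (_ : GRing.inv = fun x : R => Num.sg x * powR `|x| (-1)).
  apply: measurable_funM.
    rewrite (_ : Num.sg = fun x : R =>
        if x < 0 then -1 else if x <= 0 then 0 else 1); last first.
      apply/funext => x; have [x0|x0|->] := ltgtP x 0.
      - by rewrite ltr0_sg.
      - by rewrite gtr0_sg.
      - by rewrite sgr0.
    apply: measurable_fun_ifT => //; first exact: measurable_fun_ltr.
    by apply: measurable_fun_ifT => //; exact: measurable_fun_ler.
  have h := @measurable_powR R (-1).
  exact: (measurableT_comp h).
apply/funext => x; rewrite powR_inv1//; have [x0|x0|->] := ltgtP x 0.
- by rewrite ltr0_sg// ltr0_norm// invrN mulN1r opprK.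
- by rewrite gtr0_sg// gtr0_norm// mul1r.
- by rewrite sgr0 invr0 mul0r.
Qed.

Lemma measurable_funV (f : T -> R) :
  measurable_fun setT f -> measurable_fun setT (fun x => (f x)^-1).
Proof. exact: measurableT_comp measurable_invr. Qed.

End measurability.

Ltac mfun := repeat match goal with
  | H : measurable_fun setT ?f |- measurable_fun setT ?f => exact: H
  | |- measurable_fun _ (fun x => ?c) => exact: measurable_cst
  | |- measurable_fun _ (fun x => x) => exact: measurable_id
  | |- measurable_fun ?D (Order.le ?a) => change (measurable_fun D (fun x => (a <= x)%R))
  | |- measurable_fun ?D (Order.lt ?a) => change (measurable_fun D (fun x => (a < x)%R))
  | |- measurable_fun ?D ( *%R ?a) => change (measurable_fun D (fun x => (a * x)%R))
  | |- measurable_fun ?D (+%R ?a) => change (measurable_fun D (fun x => (a + x)%R))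
  | |- measurable_fun _ (fun x => EFin _) => apply/measurable_EFinP
  | |- measurable_fun _ (EFin \o _) => apply/measurable_EFinP
  | |- measurable_fun _ (fun x => (nat_of_bool _)%:R) => apply: measurable_fun_bool_real
  | |- measurable_fun _ (fun x => andb _ _) => apply: measurable_and
  | |- measurable_fun _ (fun x => (_ <= _)%R) => apply: measurable_fun_ler
  | |- measurable_fun _ (fun x => (_ < _)%R) => apply: measurable_fun_ltr
  | |- measurable_fun _ (fun x => (_ - _)%R) => apply: measurable_funB
  | |- measurable_fun _ (fun x => (_ + _)%R) => apply: measurable_funD
  | |- measurable_fun _ (fun x => (- _)%R) => apply: measurable_funN
  | |- measurable_fun _ (fun x => (_ * _)%R) => apply: measurable_funM
  | |- measurable_fun _ (fun x => (_ ^-1)%R) => apply: measurable_funV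
  | |- measurable_fun _ (fun x => (_ ^+ _)%R) => apply: measurable_funX
  | |- measurable_fun _ (fun x => `| _ |%R) =>
      apply: (measurableT_comp (@normr_measurable _ setT))
  | |- measurable_fun _ (fun x => Num.max _ _) => apply: measurable_maxr
  | |- measurable_fun _ (fun x => Num.min _ _) => apply: measurable_minr
  | |- measurable_fun _ (fun x => fst x) => exact: measurable_fst
  | |- measurable_fun _ (fun x => snd x) => exact: measurable_snd
  | |- measurable_fun _ (fun x => fst _) => apply: (measurableT_comp measurable_fst)
  | |- measurable_fun _ (fun x => snd _) => apply: (measurableT_comp measurable_snd)
  | |- measurable_fun _ (fun x => (_, _)) => apply: measurable_fun_pair
  | H : measurable_fun setT ?f |- measurable_fun _ (fun x => ?f _) =>
      apply: (measurableT_comp H)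
  end.

Ltac nneg := repeat first
  [ done | exact: ltW
  | match goal with
    | H : forall x, is_true (0 < ?f x)%R |- is_true (0 <= ?f _)%R => exact/ltW/H
    | |- is_true (0 <= _ * _)%R => apply: mulr_ge0
    | |- is_true (0 <= _ + _)%R => apply: addr_ge0
    | |- is_true (0 <= _^-1)%R => rewrite invr_ge0
    | |- is_true (0 <= _ ^+ 2)%R => exact: sqr_ge0
    | |- is_true (0 <= _ ^+ _)%R => apply: exprn_ge0
    end ].

Section nonneg_integral.
Local Open Scope ereal_scope.
Context d (T : measurableType d) (R : realType) (mu : {measure set T -> \bar R}).

(** The integral of a nonnegative function is a supremum over the simple functions below it, and a
    larger function has more of them. *)
Lemma nn_le_integral (D : set T) (f g : T -> \bar R) :
  (forall x, D x -> 0 <= f x) -> (forall x, D x -> f x <= g x) ->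
  \int[mu]_(x in D) f x <= \int[mu]_(x in D) g x.
Proof.
move=> f0 fg.
have g0 x : D x -> 0 <= g x by move=> Dx; apply: le_trans (f0 _ Dx) (fg _ Dx).
rewrite !ge0_integralE//.
apply: le_ereal_sup => _ [h hf <-]; exists h => // x.
apply: le_trans (hf x) _; rewrite /patch; case: ifP => //.
by rewrite inE => /fg.
Qed.

Lemma nn_integral_setT_le (D : set T) (f g : T -> \bar R) :
  (forall x, D x -> 0 <= f x) -> (forall x, 0 <= g x) ->
  (forall x, D x -> f x <= g x) ->
  \int[mu]_(x in D) f x <= \int[mu]_x g x.
Proof.
move=> f0 g0 fg; rewrite integral_mkcond; apply: nn_le_integral => x _.
  by rewrite patchE; case: ifP => // /[!inE] /f0.
by rewrite patchE; case: ifP => // /[!inE] /fg.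
Qed.

(** Cauchy-Schwarz for the measure with density k and the weight w. It comes from 2 |g| <= a g^2 w +
    1 / (a w), integrated and then optimised in a, so that no square root of a possibly infinite
    integral occurs. *)
Lemma weighted_cauchy_schwarz (g w k : T -> R) (v Y : R) :
  measurable_fun setT g -> measurable_fun setT w -> measurable_fun setT k ->
  (forall x, (0 < w x)%R) -> (forall x, (0 <= k x)%R) -> (0 < Y)%R ->
  `|v|%:E <= \int[mu]_x (`|g x| * k x)%:E ->
  \int[mu]_x (k x / w x)%:E <= Y%:E ->
  (v ^+ 2)%:E <= Y%:E * \int[mu]_x (g x ^+ 2 * w x * k x)%:E.
Proof.
move=> mg mw mk w0 k0 Ypos vg kY.
set X := \int[mu]_x (g x ^+ 2 * w x * k x)%:E.
have X0 : 0 <= X.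
  apply: integral_ge0 => x _; rewrite lee_fin mulr_ge0// mulr_ge0 ?sqr_ge0//.
  exact: ltW.
have mkw : measurable_fun setT (fun x => k x / w x)%R.
  apply: measurable_funM => //.
  exact: measurable_funV.
have key (a : R) : (0 < a)%R -> (2 * `|v|)%:E <= a%:E * X + (Y / a)%:E.
  move=> a0.
  have : (2 * `|v|)%:E <= 2%:E * \int[mu]_x (`|g x| * k x)%:E.
    by rewrite EFinM lee_pmul2l// lte_fin.
  move=> /le_trans; apply.
  rewrite -ge0_integralZl_EFin//; last 2 first.
  - by move=> x _; rewrite lee_fin mulr_ge0.
  - by apply/measurable_EFinP/measurable_funM => //; exact: measurableT_comp.
  apply: (@le_trans _ _ (\int[mu]_x ((a%:E * (g x ^+ 2 * w x * k x)%:E)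
    + ((a^-1)%:E * (k x / w x)%:E)))).
    apply: nn_le_integral => x _.
      by rewrite -EFinM lee_fin !mulr_ge0.
    rewrite -!EFinM -EFinD lee_fin.
    have -> : (a * (g x ^+ 2 * w x * k x) + a^-1 * (k x / w x) =
       2 * (`|g x| * k x) + (`|g x| * (a * w x) - 1) ^+ 2 / (a * w x) * k x)%R.
      have -> : (g x ^+ 2 = `|g x| ^+ 2)%R by rewrite real_normK ?num_real.
      field; by rewrite !gt_eqF.
    by rewrite lerDl mulr_ge0// divr_ge0 ?sqr_ge0// mulr_ge0 ?ltW.
  rewrite ge0_integralD//; last 4 first.
  - move=> x _; rewrite -EFinM lee_fin.
    by rewrite mulr_ge0 ?(ltW a0)// mulr_ge0// mulr_ge0 ?sqr_ge0// ltW.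
  - apply/measurable_EFinP/measurable_funM => //.
    apply: measurable_funM => //; apply: measurable_funM => //.
    exact: measurable_funX.
  - by move=> x _; rewrite -EFinM lee_fin; nneg.
  - by apply/measurable_EFinP/measurable_funM.
  rewrite ge0_integralZl_EFin//; last 3 first.
  - by move=> x _; rewrite lee_fin mulr_ge0// mulr_ge0 ?sqr_ge0// ltW.
  - apply/measurable_EFinP.
    apply: measurable_funM => //; apply: measurable_funM => //.
    exact: measurable_funX.
  - exact: ltW.
  rewrite ge0_integralZl_EFin//; last 3 first.
  - by move=> x _; rewrite lee_fin divr_ge0// ltW.
  - exact/measurable_EFinP.
  - by rewrite invr_ge0 ltW.
  rewrite leeD2l// mulrC EFinM lee_pmul2l//; last by rewrite lte_fin invr_gt0.
have [v0|v0] := eqVneq v 0%R.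
  by rewrite v0 expr0n/= mule_ge0// lee_fin ltW.
have nv0 : (0 < `|v|)%R by rewrite normr_gt0.
move: X0 key; case: (X) => [x||]//; last first.
  by move=> _ _; rewrite gt0_muley ?lte_fin// leey.
rewrite lee_fin => x0 key.
have {}key (a : R) : (0 < a)%R -> (2 * `|v| <= a * x + Y / a)%R.
  by move=> /key; rewrite -EFinM -EFinD lee_fin.
rewrite -EFinM lee_fin -[(v ^+ 2)%R]real_normK ?num_real//.
(* This choice of a makes Y / a equal to |v|, half of the left-hand side; it is the reason for
   treating v = 0 apart. *)
have := key (Y / `|v|)%R (divr_gt0 Ypos nv0).
have -> : (Y / (Y / `|v|) = `|v|)%R by field; rewrite !gt_eqF.
have -> : (Y / `|v| * x = (Y * x) / `|v|)%R by rewrite mulrAC.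
move=> h; have : (`|v| <= Y * x / `|v|)%R by lra.
by rewrite ler_pdivlMr// expr2.
Qed.

End nonneg_integral.

Section lebesgue_invariance.
Local Open Scope ereal_scope.
Context (R : realType).

Lemma ge0_integral_shift (c : R) (g : R -> \bar R) :
  measurable_fun setT g -> (forall x, 0 <= g x) ->
  \int[leb R]_x g (x + c)%R = \int[leb R]_x g x.
Proof.
move=> mg g0.
have mphi : measurable_fun setT (fun x : measurableTypeR R => (x + c)%R : measurableTypeR R).
  by mfun.
have := @ge0_integral_pushforward _ _ _ _ _ _ mphi (leb R) setT g measurableT mg.
rewrite preimage_setT => <-//.
apply: eq_measure_integral => //= A mA _.
apply/esym/lebesgue_measure_unique => //= _ [[a b]] _ <-.
rewrite /pushforward.
rewrite (_ : _ @^-1` _ = `](a - c)%R, (b - c)%R]%classic); last first.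
  by apply/seteqP; split => x /=; rewrite !in_itv/= ltrBlDr lerBrDr.
by rewrite /leb !lebesgue_measure_itv/= !lte_fin ltrD2r -!EFinB; case: ifP => // _; congr EFin; ring.
Qed.

Lemma ge0_integral_opp (g : R -> \bar R) :
  measurable_fun setT g -> (forall x, 0 <= g x) ->
  \int[leb R]_x g (- x)%R = \int[leb R]_x g x.
Proof.
move=> mg g0.
have mphi : measurable_fun setT (fun x : measurableTypeR R => (- x)%R : measurableTypeR R).
  by mfun.
have := @ge0_integral_pushforward _ _ _ _ _ _ mphi (leb R) setT g measurableT mg.
rewrite preimage_setT => <-//.
apply: eq_measure_integral => //= A mA _.
exact: lebesgue_measureN.
Qed.

Lemma integral_indic_itv (a b : R) : (a <= b)%R ->
  \int[leb R]_x ((a <= x <= b)%R%:R)%:E = (b - a)%:E.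
Proof.
move=> ab.
transitivity (\int[leb R]_x (\1_(`[a, b]%classic) x)%:E).
  by apply: eq_integral => x _; rewrite indicE mem_setE in_itv/=.
rewrite integral_indic//= setIT /leb.
rewrite lebesgue_measure_itv/= lte_fin.
by move: ab; rewrite le_eqVlt => /orP[/eqP->|->//]; rewrite ltxx subrr.
Qed.

End lebesgue_invariance.

Section tonelli.
Local Open Scope ereal_scope.
Context (R : realType).

Let leb2_sigma_finite : sigma_finite setT (leb2 R).
Proof.
exists (fun n : nat => `[(- n%:R)%R, n%:R%R]%classic `*` `[(- n%:R)%R, n%:R%R]%classic).
  apply/esym; rewrite -subTset => -[x y] _.
  have [n hn] : exists n : nat, (`|x| + `|y| <= n%:R)%R.
    by exists (Num.truncn (`|x| + `|y|)).+1; rewrite ltW// truncnS_gt.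
  exists n => //; split => /=; rewrite in_itv/= -ler_norml;
    by apply: le_trans hn; rewrite ?lerDl ?lerDr.
move=> n; split; first by apply: measurableX; exact: measurable_itv.
rewrite /leb2 product_measure1E; [|exact: measurable_itv|exact: measurable_itv].
rewrite /= !lebesgue_measure_itv/=; case: ifP => _; last by rewrite mul0e.
by rewrite -EFinD -EFinM ltry.
Qed.

(** The same measure as [leb2], carrying its sigma-finiteness in the structure: the Schur tests and
    [swap_parts] apply Tonelli and Fubini to products in which the plane is one factor. *)
Definition leb2_sf : {sigma_finite_measure set (measurableTypeR R * measurableTypeR R)%type -> \bar R} :=
  HB.pack (leb2 R) (Measure.on (leb2 R)) (@Measure_isSigmaFinite.Build _ _ _ (leb2 R) leb2_sigma_finite).

Lemma leb2_tonelli1 (f : R * R -> \bar R) : measurable_fun setT f ->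
  (forall p, 0 <= f p) ->
  \int[leb2 R]_p f p = \int[leb R]_x \int[leb R]_y f (x, y).
Proof. by move=> mf f0; exact: fubini_tonelli1. Qed.

Lemma leb2_tonelli2 (f : R * R -> \bar R) : measurable_fun setT f ->
  (forall p, 0 <= f p) ->
  \int[leb2 R]_p f p = \int[leb R]_y \int[leb R]_x f (x, y).
Proof. by move=> mf f0; exact: fubini_tonelli2. Qed.

End tonelli.

Section parametric_integral.
Local Open Scope ereal_scope.
Context d1 d2 (T1 : measurableType d1) (T2 : measurableType d2) (R : realType).
Variable mu : {sigma_finite_measure set T2 -> \bar R}.

Lemma measurable_parametric_integral (f : T1 * T2 -> R) :
  measurable_fun setT f ->
  measurable_fun setT (fun x => \int[mu]_y (f (x, y))%:E).
Proof.
move=> mf.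
under eq_fun do rewrite integralE.
apply: emeasurable_funB.
  have h : measurable_fun setT (fubini_F mu (fun p => (EFin \o f)^\+ p)).
    apply: measurable_fun_fubini_tonelli_F => //.
    by apply: measurable_funepos; exact/measurable_EFinP.
  apply: eq_measurable_fun h => x _; rewrite /fubini_F.
  by apply: eq_integral => y _; rewrite !funeposE.
have h : measurable_fun setT (fubini_F mu (fun p => (EFin \o f)^\- p)).
  apply: measurable_fun_fubini_tonelli_F => //.
  by apply: measurable_funeneg; exact/measurable_EFinP.
apply: eq_measurable_fun h => x _; rewrite /fubini_F.
by apply: eq_integral => y _; rewrite !funenegE.
Qed.

Lemma measurable_parametric_Rintegral (f : T1 * T2 -> R) :
  measurable_fun setT f ->
  measurable_fun setT (fun x => (\int[mu]_y f (x, y))%R).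
Proof.
move=> mf; rewrite /Rintegral.
exact: measurableT_comp (measurable_parametric_integral mf).
Qed.

End parametric_integral.

Section schur.
Local Open Scope ereal_scope.
Context d1 d2 (T1 : measurableType d1) (T2 : measurableType d2) (R : realType).
Variable mu : {sigma_finite_measure set T1 -> \bar R}.
Variable nu : {sigma_finite_measure set T2 -> \bar R}.

Lemma kernel_integral_le (g : T2 -> R) (K : T1 * T2 -> R) (M : T2 -> R) :
  measurable_fun setT g -> measurable_fun setT K ->
  (forall z, (0 <= g z)%R) -> (forall p, (0 <= K p)%R) ->
  (forall z, g z != 0%R -> \int[mu]_x (K (x, z))%:E <= (M z)%:E) ->
  \int[mu]_x \int[nu]_z (g z * K (x, z))%:E <= \int[nu]_z (g z * M z)%:E.
Proof.
move=> mg mK g0 K0 KM.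
rewrite (fubini_tonelli (fun p => (g p.2 * K p)%:E))//=; last 2 first.
- by mfun.
- by move=> p; rewrite lee_fin; nneg.
apply: nn_le_integral => z _.
  by apply: integral_ge0 => x _; rewrite lee_fin; nneg.
under eq_integral do rewrite EFinM.
rewrite ge0_integralZl_EFin//; last 2 first.
- by move=> x _; rewrite lee_fin.
- apply/measurable_EFinP.
  exact: (measurableT_comp mK (@pair2_measurable _ _ _ _ z)).
rewrite EFinM; have [->|gz] := eqVneq (g z) 0%R; first by rewrite !mul0e.
by apply: lee_wpmul2l; [rewrite lee_fin|exact: KM].
Qed.

End schur.

(** * Bump functions and mollification *)

Section calculus.
Context (R : realType).
Implicit Types (f g F : R -> R) (a b x : R).

Lemma integral_derive f F a b : a <= b ->
  (forall x, a <= x <= b -> is_derive x 1 F (f x)) ->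
  {within `[a, b], continuous f} ->
  (\int[leb R]_(x in `[a, b]) (f x)%:E = (F b - F a)%:E)%E.
Proof.
rewrite le_eqVlt => /orP[/eqP->|ab] Ff cf.
  by rewrite set_itv1 integral_set1 subrr.
have dF x : a <= x <= b -> derivable F x 1 by move=> /Ff[].
have cF x : a <= x <= b -> {for x, continuous F}.
  by move=> /dF/derivable1_diffP/differentiable_continuous.
rewrite (@continuous_FTC2 R f F a b ab cf); last 2 first.
- split.
  + by move=> x /[!in_itv]/= /andP[ax xb]; apply: dF; rewrite !ltW.
  + by apply: cvg_at_right_filter; apply: cF; rewrite lexx ltW.
  + by apply: cvg_at_left_filter; apply: cF; rewrite lexx ltW.
- move=> x /[!in_itv]/= /andP[ax xb]; rewrite derive1E.
  by have [] := Ff x; rewrite ?ltW.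
by rewrite EFinB.
Qed.

(* Composing polynomials with clip makes them constant outside [0, 1]; the result
   is C^1 when the derivative vanishes at 0 and 1. *)
Definition clip x := Num.max 0 (Num.min 1 x).

Lemma clip_ge0 x : 0 <= clip x. Proof. by rewrite /clip le_max lexx. Qed.

Lemma clip_le1 x : clip x <= 1.
Proof. by rewrite /clip ge_max ler01 ge_min lexx. Qed.

Lemma clip_id x : 0 <= x <= 1 -> clip x = x.
Proof.
by move=> /andP[x0 x1]; rewrite /clip (min_idPr x1) (max_idPr x0).
Qed.

Lemma clip_le0 x : x <= 0 -> clip x = 0.
Proof.
move=> x0; rewrite /clip; apply/max_idPl.
by rewrite ge_min x0 orbT.
Qed.

Lemma clip_ge1 x : 1 <= x -> clip x = 1.
Proof. by move=> x1; rewrite /clip (min_idPl x1) (max_idPr ler01). Qed.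

Lemma continuous_clip : continuous clip.
Proof.
move=> x; rewrite /clip.
apply: (@continuous_max _ _ (cst 0) (fun x => Num.min 1 x)); first exact: cvg_cst.
by apply: (@continuous_min _ _ (cst 1) id); [exact: cvg_cst|exact: cvg_id].
Qed.

Lemma is_derive_comp_clip (p p' : R -> R) :
  (forall x, is_derive x 1 p (p' x)) -> p' 0 = 0 -> p' 1 = 0 ->
  forall x, is_derive x 1 (fun x => p (clip x)) (p' (clip x)).
Proof.
move=> dp p'0 p'1.
(* At 0 and 1 the increments of p \o clip are either 0 or those of p. *)
have edge z : clip z = z -> p' z = 0 ->
    (forall h, p (clip (h + z)) - p z = 0 \/ clip (h + z) = h + z \/ 1 <= `|h|) ->
    is_derive z 1 (fun x => p (clip x)) (p' (clip z)).
  move=> cz pz0 hz; rewrite cz pz0.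
  suff h0 : (fun h => h^-1 *: (p (clip (h *: 1 + z)) - p (clip z))) @ 0^' --> (0:R).
    apply: DeriveDef; first by apply/cvg_ex; exists 0.
    exact/cvg_lim.
  have [dpz pz] := dp z; rewrite pz0 in pz.
  have hp : (fun h => h^-1 *: (p (h *: 1 + z) - p z)) @ 0^' --> (0:R).
    have : (fun h => h^-1 *: (p (h *: 1 + z) - p z)) @ 0^' --> 'D_1 p z.
      exact: dpz.
    by rewrite pz.
  apply/cvgr0Pnorm_lt => e e0.
  move/cvgr0Pnorm_lt: hp => /(_ _ e0) hp.
  have h1 : \forall h \near (0:R)^', `|h| < 1.
    apply: dnbhs0_lt; exact: ltr01.
  near=> h.
  have hh1 : `|h| < 1 by near: h.
  rewrite cz; case: (hz (h *: 1)) => [->|[->|]].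
  - by rewrite scaler0 normr0.
  - by near: h.
  - by rewrite [h *: 1]mulr1 leNgt hh1.
move=> x; have [x0|x0|x0] := ltgtP x 0.
- rewrite clip_le0 ?ltW// p'0.
  apply: (@near_eq_is_derive _ _ _ (cst (p 0))).
  near=> y; rewrite clip_le0//; apply: ltW; near: y; exact: lt_nbhsl.
- have [x1|x1|x1] := ltgtP x 1.
  + rewrite clip_id ?(ltW x0) ?(ltW x1)//.
    apply: near_eq_is_derive (dp x); near=> y; rewrite clip_id//.
    by apply/andP; split; apply: ltW; near: y; [exact: lt_nbhsr|exact: lt_nbhsl].
  + rewrite clip_ge1 ?ltW// p'1.
    apply: (@near_eq_is_derive _ _ _ (cst (p 1))).
    near=> y; rewrite clip_ge1//; apply: ltW; near: y; exact: lt_nbhsr.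
  + rewrite x1; apply: edge => // [|h]; first by rewrite clip_ge1.
    have [h0|h0] := leP 0 h.
      by left; rewrite clip_ge1 ?subrr// lerDr.
    have [h1|h1] := leP (-1) h; last first.
      by right; right; rewrite ltr0_norm// lerNr ltW.
    by right; left; rewrite clip_id//; apply/andP; split; lra.
- rewrite x0; apply: edge => // [|h]; first by rewrite clip_le0.
  have [h0|h0] := leP h 0; first by left; rewrite addr0 clip_le0// subrr.
  have [h1|h1] := leP h 1; last by right; right; rewrite gtr0_norm// ltW.
  by right; left; rewrite addr0 clip_id// ltW.
Unshelve. all: by end_near. Qed.

(** The quintic Hermite step on [0, 1]; [bell] and [bell'] are its first two derivatives. The double
    zeros of [bell] at 0 and 1 make it C^1 on the line, and its mass is the total increment 1 of
    [smoothstep]. *)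
Definition smoothstep x :=
  10 * clip x ^+ 3 - 15 * clip x ^+ 4 + 6 * clip x ^+ 5.
Definition bell x := 30 * clip x ^+ 2 * (1 - clip x) ^+ 2.
Definition bell' x := 60 * (clip x * (1 - clip x)) * (1 - 2 * clip x).

Lemma is_derive_smoothstep x : is_derive x 1 smoothstep (bell x).
Proof.
apply: (@is_derive_comp_clip (fun x => 10 * x ^+ 3 - 15 * x ^+ 4 + 6 * x ^+ 5)
  (fun x => 30 * x ^+ 2 * (1 - x) ^+ 2)) => [y||].
- apply: is_derive_eq; rewrite /GRing.scale/=; ring.
- by ring.
- by ring.
Qed.

Lemma is_derive_bell x : is_derive x 1 bell (bell' x).
Proof.
apply: (@is_derive_comp_clip (fun x => 30 * x ^+ 2 * (1 - x) ^+ 2)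
  (fun x => 60 * (x * (1 - x)) * (1 - 2 * x))) => [y||].
- apply: is_derive_eq; rewrite /GRing.scale/=; ring.
- by ring.
- by ring.
Qed.

Lemma continuous_bell : continuous bell.
Proof. by move=> x; apply/differentiable_continuous/derivable1_diffP; case: (is_derive_bell x). Qed.

Lemma continuous_smoothstep : continuous smoothstep.
Proof. by move=> x; apply/differentiable_continuous/derivable1_diffP; case: (is_derive_smoothstep x). Qed.

Lemma continuous_bell' : continuous bell'.
Proof.
move=> x; rewrite /bell'.
have c := @continuous_clip x.
apply: cvgM; first apply: cvgM; first exact: cvg_cst.
  by apply: cvgM => //; apply: cvgB => //; exact: cvg_cst.
by apply: cvgB; [exact: cvg_cst|apply: cvgM => //; exact: cvg_cst].
Qed.

Lemma smoothstep_le0 x : x <= 0 -> smoothstep x = 0.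
Proof. by move=> x0; rewrite /smoothstep clip_le0//; ring. Qed.

Lemma smoothstep_ge1 x : 1 <= x -> smoothstep x = 1.
Proof. by move=> x0; rewrite /smoothstep clip_ge1//; ring. Qed.

Lemma bell_out x : ~~ (0 < x < 1) -> bell x = 0.
Proof.
rewrite negb_and -!leNgt /bell => /orP[x0|x1].
  by rewrite clip_le0//; ring.
by rewrite clip_ge1//; ring.
Qed.

Lemma bell'_out x : ~~ (0 < x < 1) -> bell' x = 0.
Proof.
rewrite negb_and -!leNgt /bell' => /orP[x0|x1].
  by rewrite clip_le0//; ring.
by rewrite clip_ge1//; ring.
Qed.

Lemma bell_ge0 x : 0 <= bell x.
Proof. by rewrite /bell mulr_ge0 ?sqr_ge0// mulr_ge0// sqr_ge0. Qed.

Lemma bell_le2 x : bell x <= 2.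
Proof.
rewrite /bell; have := clip_ge0 x; have := clip_le1 x; move: (clip x) => c c1 c0.
have -> : 30 * c ^+ 2 * (1 - c) ^+ 2 = 30 * (c * (1 - c)) ^+ 2 by ring.
have h : c * (1 - c) <= 4^-1 by have := sqr_ge0 (2 * c - 1); nra.
have h0 : 0 <= c * (1 - c) by rewrite mulr_ge0// subr_ge0.
have : (c * (1 - c)) ^+ 2 <= 4^-1 ^+ 2 by rewrite lerXn2r// nnegrE.
lra.
Qed.

Lemma bell'_norm_le x : `|bell' x| <= 15.
Proof.
rewrite /bell'; have := clip_ge0 x; have := clip_le1 x; move: (clip x) => c c1 c0.
have h : c * (1 - c) <= 4^-1 by have := sqr_ge0 (2 * c - 1); nra.
have h0 : 0 <= c * (1 - c) by rewrite mulr_ge0// subr_ge0.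
by rewrite ler_norml; apply/andP; split; nra.
Qed.

Lemma smoothstep_nondecreasing x y : x <= y -> smoothstep x <= smoothstep y.
Proof.
move=> xy; rewrite -subr_ge0 -lee_fin.
have <- := @integral_derive bell _ _ _ xy (fun z _ => is_derive_smoothstep z).
  by apply: integral_ge0 => z _; rewrite lee_fin bell_ge0.
by apply: continuous_subspaceT; exact: continuous_bell.
Qed.

Lemma smoothstep_ge0 x : 0 <= smoothstep x.
Proof.
have [x0|/ltW x0] := leP x 0; first by rewrite smoothstep_le0.
by rewrite -(smoothstep_le0 (lexx 0)) smoothstep_nondecreasing.
Qed.

Lemma smoothstep_le1 x : smoothstep x <= 1.
Proof.
have [x0|/ltW x0] := leP 1 x; first by rewrite smoothstep_ge1.
by rewrite -(smoothstep_ge1 (lexx 1)) smoothstep_nondecreasing.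
Qed.

End calculus.

Section mollification.
Context (R : realType).
Implicit Types (a b : R -> R) (F G : R * R -> R).

Lemma is_derive_continuous (f : R -> R) (df x : R) :
  is_derive x 1 f df -> {for x, continuous f}.
Proof. by move=> [df1 _]; apply/differentiable_continuous/derivable1_diffP. Qed.

Lemma is_derive_mulr_cst (f : R -> R) (z d c : R) :
  is_derive z 1 f d -> is_derive z 1 (fun s => f s * c) (d * c).
Proof.
move=> df; apply: is_derive_eq; rewrite /GRing.scale/=; ring.
Qed.

Lemma is_derive_mull_cst (f : R -> R) (z d c : R) :
  is_derive z 1 f d -> is_derive z 1 (fun s => c * f s) (c * d).
Proof.
move=> df; apply: is_derive_eq; rewrite /GRing.scale/=; ring.
Qed.

Lemma test_fun_product a a' b b' (M : R) :
  (forall z : R, is_derive z 1 a (a' z)) -> continuous a' ->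
  (forall z : R, is_derive z 1 b (b' z)) -> continuous b' ->
  (forall z, M < `|z| -> a z = 0) -> (forall z, M < `|z| -> b z = 0) ->
  [/\ test_fun (fun p => a p.1 * b p.2),
      d1 (fun p => a p.1 * b p.2) = (fun p => a' p.1 * b p.2) &
      d2 (fun p => a p.1 * b p.2) = (fun p => a p.1 * b' p.2)].
Proof.
move=> da ca' db cb' a0 b0.
have D1 (p : R * R) : is_derive p.1 1 (fun s => a s * b p.2) (a' p.1 * b p.2).
  exact: is_derive_mulr_cst.
have D2 (p : R * R) : is_derive p.2 1 (fun t => a p.1 * b t) (a p.1 * b' p.2).
  exact: is_derive_mull_cst.
have d1E : d1 (fun p => a p.1 * b p.2) = (fun p => a' p.1 * b p.2).
  by apply/funext => p; rewrite /d1 derive1E; have [_ ->] := D1 p.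
have d2E : d2 (fun p => a p.1 * b p.2) = (fun p => a p.1 * b' p.2).
  by apply/funext => p; rewrite /d2 derive1E; have [_ ->] := D2 p.
have ca z : {for z, continuous a} := is_derive_continuous (da z).
have cb z : {for z, continuous b} := is_derive_continuous (db z).
have cprod (f g : R -> R) : continuous f -> continuous g ->
    continuous (fun p : R * R => f p.1 * g p.2).
  move=> cf cg p; apply: cvgM.
    apply: (cvg_comp fst f); [exact: cvg_fst|exact: cf].
  apply: (cvg_comp snd g); [exact: cvg_snd|exact: cg].
split=> //; split.
  by move=> p; split; [have [] := D1 p|have [] := D2 p].
split; first by apply: cprod => z; [exact: ca|exact: cb].
rewrite d1E d2E; split; first by apply: cprod => // z; exact: cb.
split; first by apply: cprod => // z; exact: ca.
exists M => p [/a0 ->|/b0 ->]; first by rewrite mul0r.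
by rewrite mulr0.
Qed.

Lemma H1_grad_product F G1 G2 a a' b b' (M : R) : H1_grad F G1 G2 ->
  (forall z : R, is_derive z 1 a (a' z)) -> continuous a' ->
  (forall z : R, is_derive z 1 b (b' z)) -> continuous b' ->
  (forall z, M < `|z| -> a z = 0) -> (forall z, M < `|z| -> b z = 0) ->
  ((\int[leb2 R]_p (F p * (a' p.1 * b p.2))%:E =
      - \int[leb2 R]_p (G1 p * (a p.1 * b p.2))%:E) /\
   (\int[leb2 R]_p (F p * (a p.1 * b' p.2))%:E =
      - \int[leb2 R]_p (G2 p * (a p.1 * b p.2))%:E))%E.
Proof.
move=> [_ [_ [_ [_ H]]]] da ca db cb a0 b0.
have [tf e1 e2] := test_fun_product da ca db cb a0 b0.
by have := H _ tf; rewrite e1 e2.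
Qed.

Definition rect (x1 x2 y1 y2 : R) (p : R * R) : R :=
  ((x1 <= p.1 <= x2) && (y1 <= p.2 <= y2))%:R.

Lemma rect_ge0 x1 x2 y1 y2 p : 0 <= rect x1 x2 y1 y2 p.
Proof. exact: ler0n. Qed.

Lemma measurable_rect x1 x2 y1 y2 : measurable_fun setT (rect x1 x2 y1 y2).
Proof. by rewrite /rect; mfun. Qed.

Lemma integrable_mul_bounded F (k : R * R -> R) (C M : R) :
  measurable_fun setT F ->
  (leb2 R).-integrable (`[-M, M] `*` `[-M, M]) (fun p => (F p)%:E) ->
  measurable_fun setT k -> 0 <= C ->
  (forall p, `|k p| <= C * rect (-M) M (-M) M p) ->
  (leb2 R).-integrable setT (fun p => (F p * k p)%:E).
Proof.
move=> mF iF mk C0 kC.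
have mS : measurable (`[-M, M] `*` `[-M, M] : set (measurableTypeR R * measurableTypeR R)).
  by apply: measurableX; exact: measurable_itv.
have h : (leb2 R).-integrable setT
    ((fun p => (C%:E * (F p)%:E)%E) \_ (`[-M, M] `*` `[-M, M])).
  apply/(integrable_mkcond _ _).1 => //.
  exact: integrableZl.
apply: le_integrable h => //; first by mfun.
move=> p _; rewrite patchE /= ; case: ifPn => [_|].
  rewrite -EFinM !abse_EFin lee_fin !normrM mulrC (ger0_norm C0).
  apply: ler_wpM2r => //; apply: le_trans (kC p) _.
  rewrite -[leRHS]mulr1 ler_wpM2l// /rect.
  by case: (_ && _).
move=> pS; have -> : k p = 0.
  apply/eqP; rewrite -normr_le0.
  apply: le_trans (kC p) _; rewrite /rect.
  case: (boolP ((- M <= p.1 <= M) && (- M <= p.2 <= M))) => [/andP[h1 h2]|_]; last by rewrite mulr0.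
  by move: pS; rewrite notin_setE /= !in_itv/= h1 h2 => /(_ (conj isT isT)).
by rewrite mulr0 normr0; exact: abse_ge0.
Qed.

(* The mollifier lives on [0, e]: only values of F above and to the right of the
   point enter, which suits traces taken from above. *)
Definition bells (e z : R) := bell (z / e) / e.

Definition moll F (e : R) (x y : R) : R :=
  \int[leb2 R]_p (F p * (bells e (p.1 - x) * bells e (p.2 - y))).

Lemma bells_ge0 e z : 0 < e -> 0 <= bells e z.
Proof. by move=> e0; rewrite /bells divr_ge0 ?bell_ge0// ltW. Qed.

Lemma bells_le e z : 0 < e -> bells e z <= 2 / e * (0 <= z <= e)%R%:R.
Proof.
move=> e0; rewrite /bells; case: (boolP (0 <= z <= e)) => [_|h].
  by rewrite mulr1 ler_pM2r ?invr_gt0// bell_le2.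
rewrite bell_out ?mul0r ?mulr0//; apply: contra h => /andP[h1 h2].
rewrite (pmulr_lgt0 _ _) ?invr_gt0// in h1.
by rewrite (ltW h1)/= -[e]mul1r -ler_pdivrMr// ltW.
Qed.

Lemma continuous_bells e : continuous (bells e).
Proof.
move=> z; rewrite /bells; apply: cvgM; last exact: cvg_cst.
apply: (cvg_comp (fun z => z / e) (@bell R)).
  by apply: cvgM; [exact: cvg_id|exact: cvg_cst].
exact: continuous_bell.
Qed.

Lemma measurable_bells e : measurable_fun setT (bells e).
Proof. by apply: continuous_measurable_fun; exact: continuous_bells. Qed.

Lemma is_derive_affine_comp (f f' : R -> R) (e x z : R) :
  (forall z : R, is_derive z 1 f (f' z)) ->
  is_derive z 1 (fun z => f ((z - x) / e)) (f' ((z - x) / e) / e).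
Proof.
move=> df.
have h : is_derive z 1 (fun z : R => (z - x) / e) (e^-1).
  by apply: is_derive_eq; rewrite /GRing.scale/=; ring.
by have := @is_derive1_comp _ f _ _ _ _ (df _) h; rewrite /comp mulrC.
Qed.

Definition locally_integrable2 F := measurable_fun setT F /\
  forall M : R, (leb2 R).-integrable (`[-M, M] `*` `[-M, M]) (fun p => (F p)%:E).

Lemma integrable_moll F e x y : locally_integrable2 F -> 0 < e ->
  (leb2 R).-integrable setT
  (fun p => (F p * (bells e (p.1 - x) * bells e (p.2 - y)))%:E).
Proof.
move=> [mF iF] e0.
pose M := `|x| + `|y| + e.
apply: (@integrable_mul_bounded _ _ ((2 / e) * (2 / e)) M) => //.
- have mb := measurable_bells e; by mfun.
- by rewrite mulr_ge0// divr_ge0// ltW.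
- move=> p; rewrite normrM !ger0_norm ?bells_ge0//.
  apply: le_trans (ler_pM _ _ (bells_le _ e0) (bells_le _ e0)) _; rewrite ?bells_ge0//.
  rewrite mulrACA ler_wpM2l//; first by rewrite mulr_ge0// divr_ge0// ltW.
  rewrite -natrM mulnb ler_nat /rect; case: (boolP (_ && _)) => //=.
  move=> /andP[/andP[h1 h2] /andP[h3 h4]].
  suff -> : (-M <= p.1 <= M) && (-M <= p.2 <= M) by [].
  rewrite -!ler_norml /M.
  have := ler_normB (p.1 - x) (- x); have := ler_normB (p.2 - y) (- y).
  rewrite !opprK !normrN !subrK (ger0_norm h1) (ger0_norm h3) => k1 k2.
  have := normr_ge0 x; have := normr_ge0 y => *.
  by apply/andP; split; lra.
Qed.

Lemma le_abse_integralM (g k k' : R * R -> R) :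
  measurable_fun setT g -> measurable_fun setT k ->
  (forall p, `|k p| <= k' p) ->
  (`| \int[leb2 R]_p (g p * k p)%:E | <= \int[leb2 R]_p (`|g p| * k' p)%:E)%E.
Proof.
move=> mg mk kk'; apply: le_trans (le_abse_integral _ _ _) _ => //; first by mfun.
apply: nn_le_integral => p _; first exact: abse_ge0.
by rewrite abse_EFin lee_fin normrM ler_wpM2l.
Qed.

Lemma bells_rect e x (p : R * R) (k : R) (P : bool) :
  0 < e -> `|k| <= 1 -> (~~ P -> k = 0) ->
  `|bells e (p.1 - x) * k| <= 2 / e * ((x <= p.1 <= x + e)%R && P)%:R.
Proof.
move=> e0 k1 Pk; rewrite normrM ger0_norm ?bells_ge0//.
case: (boolP P) => [_|/Pk ->]; last first.
  by rewrite normr0 mulr0 mulr_ge0// divr_ge0// ltW.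
rewrite andbT -[leRHS]mulr1; apply: ler_pM => //; first exact: bells_ge0.
apply: le_trans (bells_le _ e0) _.
by rewrite subr_ge0 lerBlDl.
Qed.

Lemma smoothstep_diff_le1 (x y : R) : x <= y -> `|smoothstep y - smoothstep x| <= 1.
Proof.
move=> xy; have := smoothstep_nondecreasing xy; have := smoothstep_ge0 x.
have := smoothstep_le1 y => *.
by rewrite ger0_norm; lra.
Qed.

Lemma smoothstep_diff_out (e x y t z : R) : 0 < e -> x <= y ->
  ~~ (x <= z <= y + e) -> smoothstep ((z - x) / e) - smoothstep ((z - y) / e) = 0.
Proof.
move=> e0 xy; rewrite negb_and -!ltNge => /orP[zx|yz].
  by rewrite !smoothstep_le0 ?subrr// pmulr_lle0 ?invr_gt0//; lra.
by rewrite !smoothstep_ge1 ?subrr// ler_pdivlMr//; lra.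
Qed.

Lemma is_derive_bells e x (z : R) :
  is_derive z 1 (fun z => bells e (z - x)) (bell' ((z - x) / e) / e / e).
Proof.
apply: is_derive_mulr_cst.
exact: (@is_derive_affine_comp _ _ _ _ _ (@is_derive_bell R)).
Qed.

Lemma continuous_bells' (e x : R) : continuous (fun z : R => bell' ((z - x) / e) / e / e).
Proof.
move=> z; apply: cvgM; last exact: cvg_cst.
apply: cvgM; last exact: cvg_cst.
apply: (cvg_comp (fun z => (z - x) / e) (@bell' R)); last exact: continuous_bell'.
by apply: cvgM; [apply: cvgB; [exact: cvg_id|exact: cvg_cst]|exact: cvg_cst].
Qed.

Lemma continuous_bells_diff (e x y : R) :
  continuous (fun z : R => bells e (z - x) - bells e (z - y)).
Proof.
move=> z; apply: cvgB.
  apply: (cvg_comp (fun z => z - x) (bells e)); last exact: continuous_bells.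
  by apply: cvgB; [exact: cvg_id|exact: cvg_cst].
apply: (cvg_comp (fun z => z - y) (bells e)); last exact: continuous_bells.
by apply: cvgB; [exact: cvg_id|exact: cvg_cst].
Qed.

Lemma bells_out e z : 0 < e -> ~~ (0 <= z <= e) -> bells e z = 0.
Proof.
move=> e0 /negbTE h; apply/le_anti; rewrite bells_ge0// andbT.
by apply: le_trans (bells_le _ e0) _; rewrite h mulr0.
Qed.

Variables (F G1 G2 : R * R -> R).
Hypothesis FG : H1_grad F G1 G2.

Let locF : locally_integrable2 F.
Proof. by have [mF [iF _]] := FG; split. Qed.

(** The difference of two mollifications is F tested against a(x) b'(y), where b is a difference of
    two shifted steps. The steps agree outside [y, y + t + e], so a b is a test function and the
    derivative passes to G2. The bound follows from 0 <= a <= 2 / e and |b| <= 1. *)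
Lemma moll_vertical e x y t : 0 < e -> 0 <= t ->
  (`|moll F e x (y + t) - moll F e x y|%:E <=
   \int[leb2 R]_p (`|G2 p| * (2 / e * rect x (x + e) y (y + t + e) p))%:E)%E.
Proof.
move=> e0 t0.
pose a z := bells e (z - x).
pose b z := smoothstep ((z - y) / e) - smoothstep ((z - (y + t)) / e).
have [_ [_ [_ [[mG2 _] _]]]] := FG.
pose M := `|x| + `|y| + t + e.
have nx := ler_norm x; have ny := ler_norm y; have := ler_norm (- x); have := ler_norm (- y).
rewrite !normrN => nx' ny'.
have nx0 := normr_ge0 x; have ny0 := normr_ge0 y.
have [||||||_ wk] := @H1_grad_product F G1 G2 a
    (fun z : R => bell' ((z - x) / e) / e / e) b
    (fun z => bells e (z - y) - bells e (z - (y + t))) M FG.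
- exact: is_derive_bells.
- exact: continuous_bells'.
- move=> z; apply: is_deriveB.
    exact: (@is_derive_affine_comp _ _ _ _ _ (@is_derive_smoothstep R)).
  exact: (@is_derive_affine_comp _ _ _ _ _ (@is_derive_smoothstep R)).
- exact: continuous_bells_diff.
- move=> z Mz; apply: bells_out => //; apply/negP => /andP[h1 h2].
  by move: Mz; rewrite /M ltNge ler_norml; move=> /negP[]; apply/andP; split; lra.
- move=> z Mz; apply: smoothstep_diff_out; rewrite // ?lerDl//.
  apply/negP => /andP[h1 h2]; move: Mz; rewrite /M ltNge ler_norml => /negP[].
  by apply/andP; split; lra.
have ma : measurable_fun setT a.
  have mb := measurable_bells e; by rewrite /a; mfun.
have mb : measurable_fun setT b.
  have ms : measurable_fun setT (@smoothstep R).
    by apply: continuous_measurable_fun; exact: continuous_smoothstep.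
  by rewrite /b; mfun.
have -> : (`|moll F e x (y + t) - moll F e x y|%:E = `| \int[leb2 R]_p (G2 p * (a p.1 * b p.2))%:E |)%E.
  rewrite -[in RHS]abseN -wk distrC -abse_EFin; congr abse.
  have iy := integrable_moll x y locF e0; have iyt := integrable_moll x (y + t) locF e0.
  rewrite EFinB /moll /Rintegral !fineK; try exact: integrable_fin_num.
  rewrite -integralB//; apply: eq_integral => p _ /=.
  by rewrite -EFinB /a; congr EFin; ring.
apply: le_abse_integralM => //; first by mfun.
move=> p; rewrite /rect; apply: bells_rect => //.
  rewrite /b; apply: smoothstep_diff_le1.
  by rewrite ler_pM2r ?invr_gt0// lerB// lerDl.
by move=> h; apply: smoothstep_diff_out; rewrite // ?lerDl.
Qed.

Lemma moll_horizontal e x y t : 0 < e -> 0 <= t ->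
  (`|moll F e (x + t) y - moll F e x y|%:E <=
   \int[leb2 R]_p (`|G1 p| * (2 / e * rect x (x + t + e) y (y + e) p))%:E)%E.
Proof.
move=> e0 t0.
pose a z := smoothstep ((z - x) / e) - smoothstep ((z - (x + t)) / e).
pose b z := bells e (z - y).
have [_ [_ [[mG1 _] _]]] := FG.
pose M := `|x| + `|y| + t + e.
have nx := ler_norm x; have ny := ler_norm y; have := ler_norm (- x); have := ler_norm (- y).
rewrite !normrN => nx' ny'.
have nx0 := normr_ge0 x; have ny0 := normr_ge0 y.
have [||||||wk _] := @H1_grad_product F G1 G2 a
    (fun z => bells e (z - x) - bells e (z - (x + t))) b
    (fun z => bell' ((z - y) / e) / e / e) M FG.
- move=> z; apply: is_deriveB.
    exact: (@is_derive_affine_comp _ _ _ _ _ (@is_derive_smoothstep R)).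
  exact: (@is_derive_affine_comp _ _ _ _ _ (@is_derive_smoothstep R)).
- exact: continuous_bells_diff.
- exact: is_derive_bells.
- exact: continuous_bells'.
- move=> z Mz; apply: smoothstep_diff_out; rewrite // ?lerDl//.
  apply/negP => /andP[h1 h2]; move: Mz; rewrite /M ltNge ler_norml => /negP[].
  by apply/andP; split; lra.
- move=> z Mz; apply: bells_out => //; apply/negP => /andP[h1 h2].
  by move: Mz; rewrite /M ltNge ler_norml; move=> /negP[]; apply/andP; split; lra.
have ma : measurable_fun setT b.
  have mb := measurable_bells e; by rewrite /b; mfun.
have mb : measurable_fun setT a.
  have ms : measurable_fun setT (@smoothstep R).
    by apply: continuous_measurable_fun; exact: continuous_smoothstep.
  by rewrite /a; mfun.
have -> : (`|moll F e (x + t) y - moll F e x y|%:E = `| \int[leb2 R]_p (G1 p * (b p.2 * a p.1))%:E |)%E.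
  under [in RHS]eq_integral do rewrite (mulrC (b _)).
  rewrite -[in RHS]abseN -wk distrC -abse_EFin; congr abse.
  have iy := integrable_moll x y locF e0; have iyt := integrable_moll (x + t) y locF e0.
  rewrite EFinB /moll /Rintegral !fineK; try exact: integrable_fin_num.
  rewrite -integralB//; apply: eq_integral => p _ /=.
  by rewrite -EFinB /b; congr EFin; ring.
apply: le_abse_integralM => //; first by mfun.
move=> p; rewrite /rect andbC.
apply: (@bells_rect e y (p.2, p.1)) => //.
  rewrite /a; apply: smoothstep_diff_le1.
  by rewrite ler_pM2r ?invr_gt0// lerB// lerDl.
by move=> h; apply: smoothstep_diff_out; rewrite // ?lerDl.
Qed.

End mollification.

(** * The weighted Schur test *)

Section weighted_schur.
Local Open Scope ereal_scope.
Context d1 d2 (T1 : measurableType d1) (T2 : measurableType d2) (R : realType).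
Variable mu : {sigma_finite_measure set T1 -> \bar R}.
Variable nu : {sigma_finite_measure set T2 -> \bar R}.

(** Cauchy-Schwarz with the weight w bounds v^2 by the row integral Y times a weighted integral of
    g^2; multiplying by the density D and exchanging the integrals leaves the column integrals,
    which must reproduce 1 / w up to N. The result is a measurable majorant B of D v^2 because the
    increments v of mollifications come with no measurability statement; Fatou is later applied to
    such majorants. *)
Lemma weighted_schur (g w N : T2 -> R) (k : T1 * T2 -> R) (Y D v : T1 -> R) :
  measurable_fun setT g -> measurable_fun setT w -> measurable_fun setT k ->
  measurable_fun setT Y -> measurable_fun setT D ->
  (forall z, (0 < w z)%R) -> (forall p, (0 <= k p)%R) ->
  (forall p, (0 <= Y p)%R) -> (forall p, (0 <= D p)%R) ->
  (forall p, D p != 0%R -> (0 < Y p)%R) ->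
  (forall p, D p != 0%R -> `|v p|%:E <= \int[nu]_z (`|g z| * k (p, z))%:E) ->
  (forall p, D p != 0%R -> \int[nu]_z (k (p, z) / w z)%:E <= (Y p)%:E) ->
  (forall z, \int[mu]_p (D p * Y p * k (p, z))%:E <= (N z / w z)%:E) ->
  exists B : T1 -> \bar R, [/\ measurable_fun setT B, (forall p, 0 <= B p),
    (forall p, (D p * v p ^+ 2)%:E <= B p) &
    \int[mu]_p B p <= \int[nu]_z (g z ^+ 2 * N z)%:E].
Proof.
move=> mg mw mk mY mD w0 k0 Y0 D0 DY vk kY kN.
pose K (q : T1 * T2) := (D q.1 * Y q.1 * k q * w q.2)%R.
have mK : measurable_fun setT K by rewrite /K; mfun.
have K0 q : (0 <= K q)%R by rewrite /K; nneg.
exists (fun p => \int[nu]_z (g z ^+ 2 * K (p, z))%:E); split.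
- apply: (@measurable_parametric_integral _ _ _ _ _ nu (fun q => g q.2 ^+ 2 * K q)%R).
  by mfun.
- by move=> p; apply: integral_ge0 => z _; rewrite lee_fin; nneg.
- move=> p; have [->|Dp] := eqVneq (D p) 0%R.
    by rewrite mul0r; apply: integral_ge0 => z _; rewrite lee_fin; nneg.
  have mkp : measurable_fun setT (fun z => k (p, z)).
    exact: (measurableT_comp mk (@pair1_measurable _ _ _ _ p)).
  have := @weighted_cauchy_schwarz _ _ _ nu g w (fun z => k (p, z)) (v p) (Y p)
    mg mw mkp w0 (fun z => k0 _) (DY p Dp) (vk p Dp) (kY p Dp).
  rewrite EFinM => /(lee_wpmul2l _) h.
  apply: le_trans (h (D p)%:E _) _; first by rewrite lee_fin.
  rewrite muleA -EFinM -ge0_integralZl_EFin//; last 3 first.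
  + by move=> z _; rewrite lee_fin; nneg.
  + by mfun.
  + by nneg.
  apply: nn_le_integral => z _; first by rewrite -EFinM lee_fin; nneg.
  rewrite -EFinM lee_fin /K/= le_eqVlt; apply/orP; left; apply/eqP; ring.
- apply: (@kernel_integral_le _ _ _ _ _ mu nu (fun z => g z ^+ 2)%R K N) => //.
  + by mfun.
  + by move=> z; nneg.
  + move=> z _; rewrite /K/=; under eq_integral do rewrite EFinM.
    rewrite ge0_integralZr//; last 3 first.
    * apply/measurable_EFinP.
      have := measurableT_comp mk (@pair2_measurable _ _ _ _ z) => mkz.
      by apply: measurable_funM => //; mfun.
    * by move=> p _; rewrite lee_fin; nneg.
    * by rewrite lee_fin; nneg.
    apply: le_trans (lee_wpmul2r _ (kN z)) _; first by rewrite lee_fin; nneg.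
    by rewrite -EFinM lee_fin divfK// gt_eqF.
Qed.

End weighted_schur.

(** * Bounds for the traces *)

Section rectangles.
Local Open Scope ereal_scope.
Context (R : realType).

Lemma integral_rect_mul (x1 x2 y1 y2 : R) (h : R -> R) : (x1 <= x2)%R ->
  measurable_fun setT h -> (forall r, (0 <= h r)%R) ->
  \int[leb2 R]_z (rect x1 x2 y1 y2 z * h z.2)%:E =
  (x2 - x1)%:E * \int[leb R]_r ((y1 <= r <= y2)%R%:R * h r)%:E.
Proof.
move=> x12 mh h0; have mr := measurable_rect x1 x2 y1 y2.
rewrite leb2_tonelli2; last 2 first.
- by mfun.
- by move=> z; rewrite lee_fin mulr_ge0// rect_ge0.
rewrite -ge0_integralZl_EFin ?subr_ge0//; last 2 first.
- by move=> r _; rewrite lee_fin; nneg.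
- by mfun.
apply: eq_integral => r _ /=.
under eq_integral => x _.
  rewrite /rect/= -mulnb natrM -mulrA EFinM.
  over.
rewrite ge0_integralZr//; last 2 first.
- by mfun.
- by rewrite lee_fin; nneg.
by rewrite integral_indic_itv.
Qed.

Lemma continuous_sqrt_comp (f : R -> R) : continuous f -> continuous (fun x => Num.sqrt (f x)).
Proof.
by move=> cf x; apply: (cvg_comp f Num.sqrt); [exact: cf|exact: sqrt_continuous].
Qed.

Lemma measurable_sqrt : measurable_fun setT (@Num.sqrt R).
Proof. by apply: continuous_measurable_fun; exact: sqrt_continuous. Qed.

Lemma is_derive_sqrt_shift (a : R) (x : R) : (0 < x + a)%R ->
  is_derive x 1%R (fun x : R => Num.sqrt (x + a)) (2 * Num.sqrt (x + a))^-1%R.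
Proof.
move=> h.
have d : is_derive x 1%R (fun x : R => x + a)%R 1%R.
  by apply: is_derive_eq; rewrite addr0.
by have := @is_derive1_comp _ Num.sqrt (fun x : R => x + a)%R x _ _ (is_derive1_sqrt h) d; rewrite /comp mulr1.
Qed.

Lemma integral_itv_indic (a b : R) (h : R -> R) :
  \int[leb R]_(x in `[a, b]) (h x)%:E = \int[leb R]_x ((a <= x <= b)%R%:R * h x)%:E.
Proof.
rewrite integral_mkcond; apply: eq_integral => x _.
rewrite patchE mem_setE in_itv/=; case: ifP => _; by rewrite ?mul1r ?mul0r.
Qed.

Lemma integral_rsqrt_le (c e b : R) : (0 < e)%R -> (0 <= b)%R ->
  \int[leb R]_r ((c <= r <= c + b)%R%:R * (Num.sqrt (`|r - c| + e))^-1)%:E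
  <= (2 * Num.sqrt (b + e))%:E.
Proof.
move=> e0 b0.
pose f (r : R) := (Num.sqrt (`|r - c| + e))^-1%R.
have f_gt0 (r : R) : (0 < Num.sqrt (`|r - c| + e))%R.
  by rewrite sqrtr_gt0 ltr_wpDl.
rewrite -integral_itv_indic.
have cbc : (c <= c + b)%R by rewrite lerDl.
have hd (r : R) : (c <= r <= c + b)%R ->
    is_derive r 1%R (fun r => 2 * Num.sqrt (r + (e - c)))%R (f r).
  move=> /andP[cr _].
  have re : (`|r - c| + e = r + (e - c))%R by rewrite ger0_norm ?subr_ge0//; ring.
  rewrite /f re; have rp : (0 < r + (e - c))%R by rewrite -re ltr_wpDl.
  have -> : (Num.sqrt (r + (e - c)))^-1%R = (2 * (2 * Num.sqrt (r + (e - c)))^-1)%R.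
    by rewrite invfM mulrA divff// mul1r.
  exact: (is_derive_mull_cst _ (is_derive_sqrt_shift rp)).
have hc : {within `[c, (c + b)%R], continuous f}.
  apply: continuous_subspaceT => r; rewrite /f; apply: cvgV.
    by rewrite gt_eqF.
  apply: (@continuous_sqrt_comp (fun r => `|r - c| + e)%R) => {}r.
  apply: cvgD; last exact: cvg_cst.
  by apply: cvg_norm; apply: cvgB; [exact: cvg_id|exact: cvg_cst].
have -> := integral_derive cbc hd hc.
rewrite lee_fin lerBlDr (_ : c + b + (e - c) = b + e)%R; last by ring.
by rewrite lerDl mulr_ge0// sqrtr_ge0.
Qed.

(** For t >= 0 the last factor is (t + 2e)^(-3/2), with primitive -2 (t + 2e)^(-1/2). The indicators
    force t >= r - c - e, so t + 2e >= r - c + e at the lower end and the weight of the Schur test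
    reproduces itself. *)
Lemma hardy_weight_le (c e r : R) : (0 < e)%R ->
  \int[leb R]_t ((0 <= t <= 1)%R%:R * (c <= r <= c + t + e)%R%:R *
     (Num.sqrt (`|t| + 2 * e) / (t + 2 * e) ^+ 2))%:E
  <= (2 / Num.sqrt (`|r - c| + e) * (c <= r <= c + 1 + e)%R%:R)%:E.
Proof.
move=> e0.
case: (boolP (c <= r <= c + 1 + e)%R) => [/andP[cr rc]|h]; last first.
  rewrite mulr0 integral0_eq// => t _.
  case: (boolP (0 <= t <= 1)%R) => [/andP[t0 t1]|]; last by rewrite !mul0r.
  case: (boolP (c <= r <= c + t + e)%R) => [/andP[cr rc]|]; last by rewrite mulr0 mul0r.
  by move: h; rewrite cr/= => /negP[]; lra.
rewrite mulr1.
(* The least t >= 0 whose strip [c, c + t + e] reaches r. *)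
pose t0 : R := Num.max 0%R (r - c - e)%R.
have t00 : (0 <= t0)%R by rewrite /t0 le_max lexx.
have t01 : (t0 <= 1)%R by rewrite /t0 ge_max ler01/=; lra.
have t0r : (r - c - e <= t0)%R by rewrite /t0 le_max lexx orbT.
pose f (t : R) := (Num.sqrt (`|t| + 2 * e) / (`|t| + 2 * e) ^+ 2)%R.
have pos (t : R) : (0 < `|t| + 2 * e)%R by rewrite ltr_wpDl// mulr_gt0.
have sq (t : R) : (0 < Num.sqrt (`|t| + 2 * e))%R by rewrite sqrtr_gt0.
apply: (@le_trans _ _ (\int[leb R]_(t in `[t0, 1%R]) (f t)%:E)).
  rewrite integral_itv_indic; apply: nn_le_integral => t _.
    by rewrite lee_fin; nneg.
  rewrite lee_fin.
  case: (boolP (0 <= t <= 1)%R) => [/andP[h0 h1]|]; last first.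
    by rewrite !mul0r mulr_ge0// /f divr_ge0 ?sqr_ge0 ?sqrtr_ge0.
  case: (boolP (c <= r <= c + t + e)%R) => [/andP[h2 h3]|]; last first.
    by rewrite mulr0 mul0r mulr_ge0// /f divr_ge0 ?sqr_ge0 ?sqrtr_ge0.
  have -> : (t0 <= t)%R by rewrite /t0 ge_max h0/=; lra.
  by rewrite h1 !mul1r /f ger0_norm.
have hd (t : R) : (t0 <= t <= 1)%R ->
    is_derive t 1%R (fun t => - 2 * (Num.sqrt (t + 2 * e))^-1)%R (f t).
  move=> /andP[t0t t1]; have tt : (`|t| = t)%R by rewrite ger0_norm// (le_trans t00).
  have tp := pos t; have ts := sq t; rewrite tt in tp ts.
  have ds := is_derive_sqrt_shift tp.
  have h : is_derive t 1%R (fun t => (Num.sqrt (t + 2 * e))^-1)%R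
     (- Num.sqrt (t + 2 * e) ^- 2 *: (2 * Num.sqrt (t + 2 * e))^-1)%R.
    by apply: is_deriveV; rewrite gt_eqF.
  rewrite /f tt.
  suff -> : (Num.sqrt (t + 2 * e) / (t + 2 * e) ^+ 2)%R =
      (- 2 * (- Num.sqrt (t + 2 * e) ^- 2 *: (2 * Num.sqrt (t + 2 * e))^-1))%R.
    exact: (is_derive_mull_cst (- 2) h).
  rewrite /GRing.scale/=.
  have : (Num.sqrt (t + 2 * e) ^+ 2 = t + 2 * e)%R by rewrite sqr_sqrtr ?ltW.
  move: (Num.sqrt (t + 2 * e)) ts => s s0 s2.
  by rewrite -s2; field; rewrite gt_eqF.
have hc : {within `[t0, 1%R], continuous f}.
  apply: continuous_subspaceT => t; rewrite /f.
  have cn : {for t, continuous (fun t : R => `|t| + 2 * e)%R}.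
    by apply: cvgD; [apply: cvg_norm; exact: cvg_id|exact: cvg_cst].
  apply: cvgM.
    by apply: (cvg_comp (fun t : R => `|t| + 2 * e)%R Num.sqrt); [exact: cn|exact: sqrt_continuous].
  apply: cvgV; first by rewrite expf_eq0/= gt_eqF.
  by rewrite expr2; under eq_fun do rewrite expr2; apply: cvgM.
have -> := integral_derive t01 hd hc.
rewrite lee_fin.
have s1 : (0 <= 2 * (Num.sqrt (1 + 2 * e))^-1)%R by rewrite mulr_ge0// invr_ge0 sqrtr_ge0.
have s2 : (2 * (Num.sqrt (t0 + 2 * e))^-1 <= 2 / Num.sqrt (`|r - c| + e))%R.
  rewrite ler_pM2l// lef_pV2 ?posrE ?sqrtr_gt0; first last.
  - by rewrite ltr_wpDl.
  - by rewrite ltr_wpDl// mulr_gt0.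
  apply: ler_wsqrtr; rewrite ger0_norm ?subr_ge0//; lra.
by lra.
Qed.

Lemma integral_strip_le (a e : R) (r : R) : (0 < e)%R -> 
  \int[leb R]_t ((a <= t <= a + 1)%R%:R * (t <= r <= t + e)%R%:R)%:E
  <= (e * (a <= r <= a + 1 + e)%R%:R)%:E.
Proof.
move=> e0; case: (boolP (a <= r <= a + 1 + e)%R) => h; last first.
  rewrite mulr0 integral0_eq// => t _; apply/congr1.
  case: (boolP (a <= t <= a + 1)%R) => [/andP[t0 t1]|]; last by rewrite mul0r.
  case: (boolP (t <= r <= t + e)%R) => [/andP[t2 t3]|]; last by rewrite mulr0.
  by move: h => /negP[]; apply/andP; split; lra.
rewrite mulr1; have re : (r - e <= r)%R by rewrite gerBl ltW.
rewrite [leRHS](_ : _ = (r - (r - e))%:E); last by congr EFin; ring.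
rewrite -integral_indic_itv//.
apply: nn_le_integral => t _; rewrite lee_fin; first by nneg.
rewrite lerBlDr -natrM mulnb ler_nat.
by case: (t <= r)%R; case: (r <= t + e)%R; rewrite ?andbF// leq_b1.
Qed.

End rectangles.

Section plane_schur.
Local Open Scope ereal_scope.
Context (R : realType).

Lemma plane_schur (g w N : R*R -> R) (k : (R*R)*(R*R) -> R) (Y D v : R*R -> R) :
  measurable_fun setT g -> measurable_fun setT w -> measurable_fun setT k ->
  measurable_fun setT Y -> measurable_fun setT D ->
  (forall z, (0 < w z)%R) -> (forall p, (0 <= k p)%R) ->
  (forall p, (0 <= Y p)%R) -> (forall p, (0 <= D p)%R) ->
  (forall p, D p != 0%R -> (0 < Y p)%R) ->
  (forall p, D p != 0%R -> `|v p|%:E <= \int[leb2 R]_z (`|g z| * k (p, z))%:E) ->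
  (forall p, D p != 0%R -> \int[leb2 R]_z (k (p, z) / w z)%:E <= (Y p)%:E) ->
  (forall z, \int[leb2 R]_p (D p * Y p * k (p, z))%:E <= (N z / w z)%:E) ->
  exists B : R*R -> \bar R, [/\ measurable_fun setT B, (forall p, 0 <= B p),
    (forall p, (D p * v p ^+ 2)%:E <= B p) &
    \int[leb2 R]_p B p <= \int[leb2 R]_z (g z ^+ 2 * N z)%:E].
Proof.
move=> *.
exact: (@weighted_schur _ _ _ _ _ (leb2_sf R) (leb2_sf R) g w N k Y D v).
Qed.

Lemma line_schur (g w N : R*R -> R) (k : R*(R*R) -> R) (Y D v : R -> R) :
  measurable_fun setT g -> measurable_fun setT w -> measurable_fun setT k ->
  measurable_fun setT Y -> measurable_fun setT D ->
  (forall z, (0 < w z)%R) -> (forall p, (0 <= k p)%R) ->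
  (forall p, (0 <= Y p)%R) -> (forall p, (0 <= D p)%R) ->
  (forall p, D p != 0%R -> (0 < Y p)%R) ->
  (forall p, D p != 0%R -> `|v p|%:E <= \int[leb2 R]_z (`|g z| * k (p, z))%:E) ->
  (forall p, D p != 0%R -> \int[leb2 R]_z (k (p, z) / w z)%:E <= (Y p)%:E) ->
  (forall z, \int[leb R]_p (D p * Y p * k (p, z))%:E <= (N z / w z)%:E) ->
  exists B : R -> \bar R, [/\ measurable_fun setT B, (forall p, 0 <= B p),
    (forall p, (D p * v p ^+ 2)%:E <= B p) &
    \int[leb R]_p B p <= \int[leb2 R]_z (g z ^+ 2 * N z)%:E].
Proof.
move=> *.
exact: (@weighted_schur _ _ _ _ _ (leb R) (leb2_sf R) g w N k Y D v).
Qed.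

End plane_schur.

(** * Uniform bounds for the pieces of an increment *)

Section line_estimates.
Local Open Scope ereal_scope.
Context (R : realType) (F G1 G2 : R * R -> R) (FG : H1_grad F G1 G2).

Lemma rectE (x1 x2 y1 y2 : R) z :
  rect x1 x2 y1 y2 z = ((x1 <= z.1 <= x2)%R%:R * (y1 <= z.2 <= y2)%R%:R)%R.
Proof. by rewrite /rect -natrM mulnb. Qed.

Lemma integral_shifted_indic (s b a : R) : (0 <= a)%R ->
  \int[leb R]_x ((x + b <= s <= x + b + a)%R%:R)%:E = a%:E.
Proof.
move=> a0; rewrite -[in RHS](_ : (s - b - (s - b - a) = a)%R); last by ring.
rewrite -integral_indic_itv; last by rewrite gerBl.
apply: eq_integral => x _; congr (_%:R)%:E; congr nat_of_bool.
by rewrite lerBrDr !lerBlDr andbC; congr (_ && _); congr (_ <= _)%R; ring.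
Qed.

(** The values s = 0 and s = 1 give the two vertical pieces; the shear x + s t does not affect
    integrals in x. A constant weight would fail: its rows are of size t, and the columns would
    involve the integral of dt / t above r - c, which is logarithmic. With the square root, the rows
    are (2 / e) e 2 sqrt(t + 2e), since the strip has height t + e and the weight adds e; the
    columns give 16 = 4 * 2 * 2. The absolute value in the weight keeps it positive on the whole
    plane. *)
Lemma hardy_bound (c e s : R) : (0 < e)%R ->
  exists B : R * R -> \bar R, [/\ measurable_fun setT B, (forall p, 0 <= B p),
    (forall p, ((0 <= p.2 <= 1)%R%:R / (p.2 + 2 * e) ^+ 2 *
       (moll F e (p.1 + s * p.2) (c + p.2) - moll F e (p.1 + s * p.2) c) ^+ 2)%:E <= B p) &
    \int[leb2 R]_p B p <=
    \int[leb2 R]_z (G2 z ^+ 2 * (16 * (c <= z.2 <= c + 1 + e)%R%:R))%:E].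
Proof.
move=> e0; have [_ [_ [_ [[mG2 _] _]]]] := FG.
have msq := @measurable_sqrt R.
have wpos (r : R) : (0 < Num.sqrt (`|r - c| + e))%R.
  by rewrite sqrtr_gt0 ltr_wpDl.
have e2 : (0 < 2 * e)%R by rewrite mulr_gt0.
have tpos (t : R) : (0 < Num.sqrt (`|t| + 2 * e))%R.
  by rewrite sqrtr_gt0 ltr_wpDl.
have ie : (0 <= 2 / e)%R by rewrite divr_ge0// ltW.
have D0 (p : R * R) : ((0 <= p.2 <= 1)%R%:R / (p.2 + 2 * e) ^+ 2 != 0 -> 0 <= p.2)%R.
  by case: (boolP (0 <= p.2 <= 1)%R) => [/andP[]//|]; rewrite mul0r eqxx.
apply: (@plane_schur R G2
  (fun z => Num.sqrt (`|z.2 - c| + e))%R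
  (fun z => 16 * (c <= z.2 <= c + 1 + e)%R%:R)%R
  (fun q => 2 / e * rect (q.1.1 + s * q.1.2) (q.1.1 + s * q.1.2 + e) c (c + q.1.2 + e) q.2)%R
  (fun p => 4 * Num.sqrt (`|p.2| + 2 * e))%R
  (fun p => (0 <= p.2 <= 1)%R%:R / (p.2 + 2 * e) ^+ 2)%R
  (fun p => moll F e (p.1 + s * p.2) (c + p.2) - moll F e (p.1 + s * p.2) c)%R) => //.
- by mfun.
- by rewrite /rect; mfun.
- by mfun.
- by mfun.
- by move=> q; rewrite mulr_ge0// rect_ge0.
- by move=> p; rewrite divr_ge0// sqr_ge0.
- by move=> p _; rewrite mulr_gt0.
- by move=> p /D0 t0; exact: (moll_vertical FG).
- move=> p /D0 t0 /=.
  under eq_integral do rewrite -(mulrA (2 / e)%R) EFinM.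
  rewrite ge0_integralZl_EFin//; last 2 first.
  + by move=> z _; rewrite lee_fin mulr_ge0 ?rect_ge0// invr_ge0 ltW.
  + have mr := measurable_rect (p.1 + s * p.2) (p.1 + s * p.2 + e) c (c + p.2 + e).
    by mfun.
  rewrite (@integral_rect_mul R _ _ _ _ (fun r => (Num.sqrt (`|r - c| + e))^-1)%R); last 3 first.
  + by rewrite lerDl ltW.
  + by mfun.
  + by move=> r; rewrite invr_ge0 ltW.
  rewrite addrAC subrr add0r -addrA.
  have h := @integral_rsqrt_le R c e (p.2 + e)%R e0 (addr_ge0 t0 (ltW e0)).
  apply: le_trans (lee_wpmul2l _ (lee_wpmul2l _ h)) _; rewrite ?lee_fin ?(ltW e0)//.
  rewrite (ger0_norm t0) -addrA (_ : e + e = 2 * e)%R; last by ring.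
  rewrite le_eqVlt; apply/orP; left; apply/eqP; field; by rewrite gt_eqF.
- move=> z.
  have mr : measurable_fun setT (fun p : R * R => rect (p.1 + s * p.2) (p.1 + s * p.2 + e) c (c + p.2 + e) z).
    by rewrite /rect; mfun.
  rewrite leb2_tonelli2; last 2 first.
  + by mfun.
  + move=> p; rewrite lee_fin.
    apply: mulr_ge0; last by rewrite mulr_ge0 ?rect_ge0.
    by rewrite mulr_ge0 ?mulr_ge0 ?(ltW (tpos _))// invr_ge0 sqr_ge0.
  have -> : (16 * (c <= z.2 <= c + 1 + e)%R%:R / Num.sqrt (`|z.2 - c| + e) =
    8 * (2 / Num.sqrt (`|z.2 - c| + e) * (c <= z.2 <= c + 1 + e)%R%:R))%R by ring.
  rewrite EFinM.
  apply: le_trans (lee_wpmul2l _ (hardy_weight_le c z.2 e0)); last by rewrite lee_fin.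
  rewrite -ge0_integralZl_EFin//; last 2 first.
  + move=> t _; rewrite lee_fin; apply: mulr_ge0; first by nneg.
    by rewrite divr_ge0 ?sqr_ge0// ltW.
  + by mfun.
  rewrite le_eqVlt; apply/orP; left; apply/eqP; apply: eq_integral => t _ /=.
  under eq_integral => x _.
    rewrite rectE/=.
    rewrite [X in X%:E](_ : _ = ((0 <= t <= 1)%R%:R / (t + 2 * e) ^+ 2 * (4 * Num.sqrt (`|t| + 2 * e)) * (2 / e) * (c <= z.2 <= c + t + e)%R%:R) * (x + s * t <= z.1 <= x + s * t + e)%R%:R)%R; last by ring.
    rewrite EFinM; over.
  rewrite ge0_integralZl_EFin//; last 2 first.
  + by mfun.
  + by rewrite !mulr_ge0 ?invr_ge0 ?sqr_ge0 ?(ltW e0)// ltW.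
  rewrite integral_shifted_indic ?(ltW e0)// -!EFinM; congr EFin.
  case: (boolP (0 <= t <= 1)%R) => [/andP[t0 _]|_]; last by rewrite !mul0r mulr0.
  have tp : (0 < t + 2 * e)%R by rewrite ltr_wpDl.
  by field; rewrite !gt_eqF.
Qed.

(** A constant weight suffices here, because a point z is met only for t in an interval of length e.
    The rectangles have width t + e, so rows and columns leave ((t + e) / (t + 2e))^2 <= 1, and 4 is
    the product of the factor 2 of the rows and twice the bound of a bell. *)
Lemma horizontal_bound (c e : R) : (0 < e)%R ->
  exists B : R * R -> \bar R, [/\ measurable_fun setT B, (forall p, 0 <= B p),
    (forall p, ((0 <= p.2 <= 1)%R%:R / (p.2 + 2 * e) ^+ 2 *
       (moll F e (p.1 + p.2) (c + p.2) - moll F e p.1 (c + p.2)) ^+ 2)%:E <= B p) &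
    \int[leb2 R]_p B p <=
    \int[leb2 R]_z (G1 z ^+ 2 * (4 * (c <= z.2 <= c + 1 + e)%R%:R))%:E].
Proof.
move=> e0; have [_ [_ [[mG1 _] _]]] := FG.
have e2 : (0 < 2 * e)%R by rewrite mulr_gt0.
have ie : (0 <= 2 / e)%R by rewrite divr_ge0// ltW.
have D0 (p : R * R) : ((0 <= p.2 <= 1)%R%:R / (p.2 + 2 * e) ^+ 2 != 0 -> 0 <= p.2)%R.
  by case: (boolP (0 <= p.2 <= 1)%R) => [/andP[]//|]; rewrite mul0r eqxx.
apply: (@plane_schur R G1 (fun z => 1%R)
  (fun z => 4 * (c <= z.2 <= c + 1 + e)%R%:R)%R
  (fun q => 2 / e * rect q.1.1 (q.1.1 + q.1.2 + e) (c + q.1.2) (c + q.1.2 + e) q.2)%R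
  (fun p => 2 * (`|p.2| + e))%R
  (fun p => (0 <= p.2 <= 1)%R%:R / (p.2 + 2 * e) ^+ 2)%R
  (fun p => moll F e (p.1 + p.2) (c + p.2) - moll F e p.1 (c + p.2))%R) => //.
- by rewrite /rect; mfun.
- by mfun.
- by mfun.
- by move=> q; rewrite mulr_ge0// rect_ge0.
- by move=> p; rewrite mulr_ge0// addr_ge0// ltW.
- by move=> p; rewrite divr_ge0// sqr_ge0.
- by move=> p _; rewrite mulr_gt0// ltr_wpDl.
- by move=> p /D0 t0; exact: (moll_horizontal FG).
- move=> p /D0 t0 /=.
  have mr := measurable_rect p.1 (p.1 + p.2 + e) (c + p.2) (c + p.2 + e).
  under eq_integral do rewrite -(mulrA (2 / e)%R) EFinM.
  rewrite ge0_integralZl_EFin//; last 2 first.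
  + by move=> z _; rewrite lee_fin mulr_ge0 ?rect_ge0// invr_ge0.
  + by mfun.
  rewrite (@integral_rect_mul R _ _ _ _ (fun r => 1^-1)%R); last 3 first.
  + by rewrite -addrA lerDl addr_ge0// ltW.
  + by mfun.
  + by move=> r; rewrite invr_ge0.
  under eq_integral do rewrite invr1 mulr1.
  rewrite integral_indic_itv; last by rewrite lerDl ltW.
  rewrite -!EFinM lee_fin (ger0_norm t0) le_eqVlt; apply/orP; left; apply/eqP; field; by rewrite gt_eqF.
- move=> z.
  have mr : measurable_fun setT (fun p : R * R => rect p.1 (p.1 + p.2 + e) (c + p.2) (c + p.2 + e) z).
    by rewrite /rect; mfun.
  rewrite leb2_tonelli2; last 2 first.
  + by mfun.
  + move=> p; rewrite lee_fin.
    apply: mulr_ge0; last by rewrite mulr_ge0 ?rect_ge0.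
    by rewrite mulr_ge0 ?mulr_ge0 ?addr_ge0 ?(ltW e0)// invr_ge0 sqr_ge0.
  rewrite divr1.
  have -> : (4 * (c <= z.2 <= c + 1 + e)%R%:R = 4 / e * (e * (c <= z.2 <= c + 1 + e)%R%:R))%R.
    by rewrite mulrA divfK// gt_eqF.
  rewrite EFinM.
  apply: le_trans (lee_wpmul2l _ (integral_strip_le c z.2 e0)); last first.
    by rewrite lee_fin divr_ge0// ltW.
  rewrite -[X in _ <= _ * X](ge0_integral_shift c); last 2 first.
  + by mfun.
  + by move=> t; rewrite lee_fin; nneg.
  rewrite -ge0_integralZl_EFin; last 4 first.
  + exact: measurableT.
  + by move=> t _; rewrite lee_fin; nneg.
  + by mfun.
  + by rewrite divr_ge0// ltW.
  apply: nn_le_integral => t _.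
    apply: integral_ge0 => x _; rewrite lee_fin.
    apply: mulr_ge0; last by rewrite mulr_ge0 ?rect_ge0.
    by rewrite mulr_ge0 ?mulr_ge0 ?addr_ge0 ?(ltW e0)// invr_ge0 sqr_ge0.
  rewrite -EFinM /=.
  have -> : (c <= t + c <= c + 1)%R = (0 <= t <= 1)%R.
    by rewrite -lerBlDr subrr (addrC t) lerD2l.
  case: (boolP (0 <= t <= 1)%R) => [/andP[t0 t1]|_]; last first.
    rewrite integral0_eq ?mul0r ?mulr0// => x _.
    by rewrite !mul0r.
  rewrite mul1r.
  under eq_integral => x _.
    rewrite rectE/=.
    rewrite [X in X%:E](_ : _ = (1 / (t + 2 * e) ^+ 2 * (2 * (`|t| + e)) * (2 / e) * (c + t <= z.2 <= c + t + e)%R%:R) * (x + 0 <= z.1 <= x + 0 + (t + e))%R%:R)%R; last first.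
      by rewrite !addr0 addrA; ring.
    rewrite EFinM; over.
  have te0 : (0 <= t + e)%R by rewrite addr_ge0// ltW.
  rewrite ge0_integralZl_EFin//; last 2 first.
  + by mfun.
  + by rewrite !mulr_ge0 ?invr_ge0 ?sqr_ge0 ?addr_ge0 ?(ltW e0).
  rewrite integral_shifted_indic// -!EFinM lee_fin (ger0_norm t0) [(t + c)%R]addrC.
  rewrite -[(c + t + e)%R]addrA addrA.
  have tep : (0 < t + 2 * e)%R by rewrite ltr_wpDl.
  have -> : (1 / (t + 2 * e) ^+ 2 * (2 * (t + e)) * (2 / e) * (c + t <= z.2 <= c + t + e)%R%:R * (t + e)
     = 4 / e * (c + t <= z.2 <= c + t + e)%R%:R * ((t + e) / (t + 2 * e)) ^+ 2)%R.
    field; by rewrite !gt_eqF.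
  rewrite [true%:R]/(1%R) mul1r -[leRHS]mulr1 ler_wpM2l//; first by rewrite !mulr_ge0// invr_ge0 ltW.
  rewrite expr_le1// ?divr_ge0 ?ler_pdivrMr ?mul1r// ?(ltW tep)//; lra.
Qed.

(** Density and weight are 1, so the Schur test reduces to Cauchy-Schwarz over a height b + e: the
    rows are 2 (b + e) and the columns double this. *)
Lemma difference_bound (c b e : R) : (0 < e)%R -> (0 <= b)%R ->
  exists B : R -> \bar R, [/\ measurable_fun setT B, (forall x, 0 <= B x),
    (forall x, ((moll F e x (c + b) - moll F e x c) ^+ 2)%:E <= B x) &
    \int[leb R]_x B x <=
    \int[leb2 R]_z (G2 z ^+ 2 * (4 * (b + e) * (c <= z.2 <= c + b + e)%R%:R))%:E].
Proof.
move=> e0 b0; have [_ [_ [_ [[mG2 _] _]]]] := FG.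
have ie : (0 <= 2 / e)%R by rewrite divr_ge0// ltW.
have be : (0 < b + e)%R by rewrite ltr_wpDl.
have [|||||||||||||B [mB B0 vB iB]] := @line_schur R G2 (fun z => 1%R)
  (fun z => 4 * (b + e) * (c <= z.2 <= c + b + e)%R%:R)%R
  (fun q => 2 / e * rect q.1 (q.1 + e) c (c + b + e) q.2)%R
  (fun x => 2 * (b + e))%R (fun x => 1%R)
  (fun x => moll F e x (c + b) - moll F e x c)%R => //.
- by rewrite /rect; mfun.
- by move=> q; rewrite mulr_ge0// rect_ge0.
- by move=> p; rewrite mulr_ge0// ltW.
- by move=> p _; rewrite mulr_gt0.
- by move=> p _; exact: (moll_vertical FG).
- move=> x _ /=.
  have mr := measurable_rect x (x + e) c (c + b + e).
  under eq_integral do rewrite -(mulrA (2 / e)%R) EFinM.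
  rewrite ge0_integralZl_EFin//; last 2 first.
  + by move=> z _; rewrite lee_fin mulr_ge0 ?rect_ge0// invr_ge0.
  + by mfun.
  rewrite (@integral_rect_mul R _ _ _ _ (fun r => 1^-1)%R); last 3 first.
  + by rewrite lerDl ltW.
  + by mfun.
  + by move=> r; rewrite invr_ge0.
  under eq_integral do rewrite invr1 mulr1.
  rewrite integral_indic_itv; last by rewrite -addrA lerDl ltW.
  rewrite -!EFinM lee_fin le_eqVlt; apply/orP; left; apply/eqP; field; by rewrite gt_eqF.
- move=> z; rewrite divr1.
  under eq_integral => x _.
    rewrite rectE/=.
    rewrite [X in X%:E](_ : _ = (2 * (b + e) * (2 / e) * (c <= z.2 <= c + b + e)%R%:R) * (x + 0 <= z.1 <= x + 0 + e)%R%:R)%R; last first.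
      by rewrite !addr0; ring.
    rewrite EFinM; over.
  rewrite ge0_integralZl_EFin//; last 2 first.
  + by mfun.
  + by rewrite !mulr_ge0 ?invr_ge0 ?(ltW e0) ?(ltW be).
  rewrite integral_shifted_indic ?(ltW e0)// -!EFinM lee_fin.
  rewrite le_eqVlt; apply/orP; left; apply/eqP; field; by rewrite gt_eqF.
exists B; split=> // x; by have := vB x; rewrite mul1r.
Qed.

End line_estimates.

(** * Convergence of mollifications to the traces *)

Section traces.
Context (R : realType).
Local Open Scope ereal_scope.
Implicit Types (F g : R * R -> R) (f : R -> R).

Lemma moll_sub_le F g (e x y : R) : locally_integrable2 F -> locally_integrable2 g ->
  (0 < e)%R ->
  `|moll F e x y - moll g e x y|%:E <=
  \int[leb2 R]_p (`|F p - g p| * (4 / e ^+ 2 * rect x (x + e) y (y + e) p))%:E.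
Proof.
move=> lF lg e0.
have iF := integrable_moll x y lF e0; have ig := integrable_moll x y lg e0.
have -> : `|moll F e x y - moll g e x y|%:E =
    `|\int[leb2 R]_p ((F p - g p) * (bells e (p.1 - x) * bells e (p.2 - y)))%:E|.
  rewrite -abse_EFin EFinB /moll /Rintegral !fineK; try exact: integrable_fin_num.
  rewrite -integralB//; congr abse; apply: eq_integral => p _ /=.
  by rewrite -EFinB mulrBl.
have [mF _] := lF; have [mg _] := lg; have mb := @measurable_bells R e.
apply: le_abse_integralM; [by mfun|by mfun|move=> p].
rewrite normrM !ger0_norm ?bells_ge0//.
apply: le_trans (ler_pM _ _ (bells_le _ e0) (bells_le _ e0)) _; rewrite ?bells_ge0//.
rewrite rectE mulrACA !subr_ge0 !lerBlDl.
by rewrite (_ : 2 / e * (2 / e) = 4 / e ^+ 2)%R//; field; rewrite gt_eqF.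
Qed.

Lemma integral_bells (e x : R) : (0 < e)%R -> \int[leb R]_s (bells e (s - x))%:E = 1.
Proof.
move=> e0.
transitivity (\int[leb R]_(s in `[x, (x + e)%R]) (bells e (s - x))%:E).
  rewrite integral_itv_indic; apply: eq_integral => s _; congr EFin.
  case: (boolP (x <= s <= x + e)%R) => h; first by rewrite mul1r.
  by rewrite bells_out ?mulr0// subr_ge0 lerBlDl.
have xe : (x <= x + e)%R by rewrite lerDl ltW.
have hd (s : R) : (x <= s <= x + e)%R ->
    is_derive s 1%R (fun s => smoothstep ((s - x) / e))%R (bells e (s - x)).
  by move=> _; exact: (is_derive_affine_comp _ _ _ (@is_derive_smoothstep R)).
have hc : {within `[x, (x + e)%R], continuous (fun s => bells e (s - x))}.
  apply: continuous_subspaceT => s.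
  apply: (cvg_comp (fun s => s - x)%R (bells e)); last exact: continuous_bells.
  by apply: cvgB; [exact: cvg_id|exact: cvg_cst].
rewrite (integral_derive xe hd hc) subrr mul0r (smoothstep_le0 (lexx _)) subr0.
by rewrite addrAC subrr add0r divff ?gt_eqF// smoothstep_ge1.
Qed.

Lemma locally_integrable2_fst f : measurable_fun setT f ->
  (forall a b : R, (leb R).-integrable `[a, b] (fun x => (f x)%:E)) ->
  locally_integrable2 (fun p => f p.1).
Proof.
move=> mf fi; split; first by mfun.
move=> M.
have mS : measurable (`[(-M)%R, M] `*` `[(-M)%R, M] : set (measurableTypeR R * measurableTypeR R)).
  by apply: measurableX; exact: measurable_itv.
apply/integrableP; split; first by apply: measurable_funTS; mfun.
apply: (@le_lt_trans _ _ (\int[leb2 R]_p (rect (-M) M (-M) M p * `|f p.1|)%:E)).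
  rewrite integral_mkcond; apply: nn_le_integral => p _.
    by rewrite patchE; case: ifP => // _; exact: abse_ge0.
  rewrite patchE; case: ifPn => [|_]; last by rewrite lee_fin mulr_ge0// rect_ge0.
  by rewrite inE /= !in_itv/= => -[h1 h2]; rewrite rectE h1 h2 !mul1r.
have mr := @measurable_rect R (-M) M (-M) M.
rewrite leb2_tonelli1; last 2 first.
- by mfun.
- by move=> p; rewrite lee_fin mulr_ge0// rect_ge0.
apply: (@le_lt_trans _ _ (\int[leb R]_x (((-M <= x <= M)%R%:R * `|f x|)%:E * (2 * `|M|)%:E))).
  apply: nn_le_integral => x _.
    by apply: integral_ge0 => y _; rewrite lee_fin mulr_ge0// rect_ge0.
  under eq_integral do rewrite rectE/= mulrAC EFinM.
  rewrite ge0_integralZl_EFin//; last by mfun.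
  apply: lee_wpmul2l; first by rewrite lee_fin; nneg.
  have [M0|M0] := leP 0%R M.
    rewrite integral_indic_itv ?lee_fin ?ger0_norm//; lra.
  rewrite integral0_eq ?lee_fin ?mulr_ge0// => y _.
  case: (boolP (_ <= y <= _)%R) => // /andP[h1 h2]; exfalso; lra.
rewrite ge0_integralZr; last 4 first.
- exact: measurableT.
- by mfun.
- by move=> x _; rewrite lee_fin; nneg.
- by rewrite lee_fin mulr_ge0.
rewrite -integral_itv_indic.
have /integrableP[_ h] := fi (-M)%R M.
have h0 : 0 <= \int[leb R]_(x in `[(- M)%R, M]) `|f x|%:E.
  by apply: integral_ge0 => x _; rewrite lee_fin.
by apply: lte_mul_pinfty; rewrite ?ge0_fin_numE ?ltry.
Qed.

(** It lets the error between a mollification and f(x) be treated by [moll_sub_le] as a difference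
    of two mollifications. *)
Lemma moll_cst (a e x y : R) : (0 < e)%R -> moll (fun=> a) e x y = a.
Proof.
move=> e0; rewrite /moll /Rintegral.
have mb := @measurable_bells R e.
have -> : \int[leb2 R]_p (a * (bells e (p.1 - x) * bells e (p.2 - y)))%:E = a%:E; last by [].
under eq_integral do rewrite EFinM.
rewrite integralZl//; last first.
  have l1 : locally_integrable2 (fun=> 1%R : R).
    apply: (@locally_integrable2_fst (fun=> 1%R : R)) => //.
    move=> b c.
    apply: (@continuous_compact_integrable R (fun=> 1%R)); first exact: segment_compact.
    by apply: continuous_subspaceT => ?; exact: cvg_cst.
  have := integrable_moll x y l1 e0; apply: eq_integrable => // p _.
  by rewrite mul1r.
rewrite leb2_tonelli1; last 2 first.
- by mfun.
- by move=> p; rewrite lee_fin mulr_ge0 ?bells_ge0.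
under eq_integral => s _.
  under eq_integral do rewrite /= EFinM.
  rewrite ge0_integralZl_EFin ?bells_ge0//; last 2 first.
  - by move=> r _; rewrite lee_fin bells_ge0.
  - by mfun.
  rewrite integral_bells// mule1; over.
by rewrite integral_bells// mule1.
Qed.
End traces.

Section trace_sequence.
Context (R : realType).
Local Open Scope ereal_scope.
Implicit Types (F g : R * R -> R) (f : R -> R).

Lemma L2loc_integrable f : L2loc f ->
  forall a b : R, (leb R).-integrable `[a, b] (fun x => (f x)%:E).
Proof.
move=> [mf f2] a b.
have i1 : (leb R).-integrable `[a, b] (fun x => (1%R)%:E).
  apply: (@continuous_compact_integrable R (fun=> 1%R)); first exact: segment_compact.
  by apply: continuous_subspaceT => ?; exact: cvg_cst.
have i2 : (leb R).-integrable `[a, b] (fun x => ((1%R)%:E + (f x ^+ 2)%:E)).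
  by apply: integrableD => //; exact: f2.
apply: le_integrable i2 => //; first by apply: measurable_funTS; mfun.
move=> x _; rewrite -EFinD !abse_EFin lee_fin [leRHS]ger0_norm; last first.
  by rewrite addr_ge0// sqr_ge0.
rewrite -[(f x ^+ 2)%R]real_normK ?num_real//.
by have := sqr_ge0 (`|f x| - 1)%R; rewrite -subr_ge0; nra.
Qed.

(** The mollifier at height c sees only c <= y <= c + e, the strip averaged in [is_trace], and
    reaches at most e <= 1 to the right, hence M + 1. The rows of the kernel are 4 and the columns 4
    (4 / e^2) e = 16 / e. *)
Lemma trace_error F f (c e M : R) : measurable_fun setT F ->
  locally_integrable2 F -> L2loc f -> (0 < e <= 1)%R -> (0 <= M)%R ->
  exists B : R -> \bar R, [/\ measurable_fun setT B, (forall x, 0 <= B x),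
    (forall x, ((-M <= x <= M)%R%:R *
       (moll F e x c - moll (fun p => f p.1) e x c) ^+ 2)%:E <= B x) &
    \int[leb R]_x B x <= 16%:E * ((e^-1)%:E *
      \int[leb2 R]_(p in `[(-(M + 1))%R, (M + 1)%R] `*` `[c, (c + e)%R])
        ((F p - f p.1) ^+ 2)%:E)].
Proof.
move=> mF lF lf /andP[e0 e1] M0; have [mf _] := lf.
have lff : locally_integrable2 (fun p => f p.1).
  by apply: locally_integrable2_fst => //; exact: L2loc_integrable.
have e20 : (0 <= 4 / e ^+ 2)%R by rewrite divr_ge0// exprn_ge0// ltW.
have [|||||||||||||B [mB B0 vB iB]] := @line_schur R (fun p => F p - f p.1)%R (fun=> 1%R)
  (fun z => 16 / e * rect (-(M + 1)) (M + 1) c (c + e) z)%R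
  (fun q => 4 / e ^+ 2 * rect q.1 (q.1 + e) c (c + e) q.2)%R
  (fun x => 4%R) (fun x => (-M <= x <= M)%R%:R)%R
  (fun x => moll F e x c - moll (fun p => f p.1) e x c)%R => //.
- by mfun.
- by rewrite /rect; mfun.
- by mfun.
- by move=> q; rewrite mulr_ge0// rect_ge0.
- by move=> p _; exact: moll_sub_le.
- move=> x _ /=.
  under eq_integral do rewrite -(mulrA (4 / e ^+ 2)%R) EFinM.
  rewrite ge0_integralZl_EFin//; last 2 first.
  + by move=> z _; rewrite lee_fin mulr_ge0 ?rect_ge0// invr_ge0.
  + have mr := measurable_rect x (x + e) c (c + e); by mfun.
  rewrite (@integral_rect_mul R _ _ _ _ (fun r => 1^-1)%R); last 3 first.
  + by rewrite lerDl ltW.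
  + by mfun.
  + by move=> r; rewrite invr_ge0.
  under eq_integral do rewrite invr1 mulr1.
  rewrite integral_indic_itv; last by rewrite lerDl ltW.
  rewrite -!EFinM lee_fin le_eqVlt; apply/orP; left; apply/eqP; field; by rewrite gt_eqF.
- move=> z; rewrite divr1.
  apply: (@le_trans _ _ (\int[leb R]_x
    ((4 * (4 / e ^+ 2) * rect (-(M + 1)) (M + 1) c (c + e) z)%:E *
     ((x + 0 <= z.1 <= x + 0 + e)%R%:R)%:E))).
    apply: nn_le_integral => x _.
      by rewrite lee_fin !mulr_ge0 ?rect_ge0 ?invr_ge0 ?exprn_ge0 ?(ltW e0).
    rewrite -EFinM lee_fin !addr0 !rectE.
    case: (boolP (-M <= x <= M)%R) => [/andP[x1 x2]|_]; last first.
      by rewrite !mul0r !mulr_ge0 ?invr_ge0 ?exprn_ge0 ?(ltW e0).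
    case: (boolP (x <= z.1 <= x + e)%R) => [/andP[z1 z2]|_]; last first.
      by rewrite !(mulr0, mul0r).
    rewrite (_ : (- (M + 1) <= z.1 <= M + 1)%R); last by apply/andP; split; lra.
    by rewrite /= le_eqVlt; apply/orP; left; apply/eqP; ring.
  rewrite ge0_integralZl_EFin; last 4 first.
  + exact: measurableT.
  + by move=> x _; rewrite lee_fin.
  + by mfun.
  + by rewrite !mulr_ge0 ?rect_ge0 ?invr_ge0 ?exprn_ge0 ?(ltW e0).
  rewrite integral_shifted_indic ?(ltW e0)// -EFinM lee_fin.
  rewrite le_eqVlt; apply/orP; left; apply/eqP; field; by rewrite gt_eqF.
exists B; split => //; apply: le_trans iB _.
rewrite muleA -EFinM [in leRHS]integral_mkcond.
rewrite -ge0_integralZl_EFin; last 4 first.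
- exact: measurableT.
- by move=> p _; rewrite patchE; case: ifP => // _; rewrite lee_fin sqr_ge0.
- apply/(measurable_restrictT _ _).1; last by apply: measurable_funTS; mfun.
  by apply: measurableX; exact: measurable_itv.
- by rewrite divr_ge0// ltW.
apply: nn_le_integral => p _; first by rewrite lee_fin mulr_ge0 ?sqr_ge0// mulr_ge0 ?rect_ge0// divr_ge0// ltW.
rewrite patchE; case: ifPn => [|pS].
  rewrite inE /= !in_itv/= => -[h1 h2].
  by rewrite rectE h1 h2 -EFinM lee_fin !mulr1 mulrC.
rewrite rectE mule0 lee_fin.
case: (boolP (_ <= p.1 <= _)%R) => h1; last by rewrite !(mulr0, mul0r).
case: (boolP (_ <= p.2 <= _)%R) => h2; last by rewrite !(mulr0, mul0r).
by move: pS; rewrite notin_setE /= !in_itv/= h1 h2 => /(_ (conj isT isT)).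
Qed.

(** The radius 2e makes the open ball of [davg] contain [x, x + e]. After integration in y the
    kernel is at most 4 / e, which is 16 divided by the length 4e of that ball. *)
Lemma moll_fst_le f (c e x : R) : L2loc f -> (0 < e)%R ->
  `|moll (fun p => f p.1) e x c - f x|%:E <= 16%:E * davg f x (2 * e).
Proof.
move=> lf e0; have [mf _] := lf.
have lff : locally_integrable2 (fun p => f p.1).
  by apply: locally_integrable2_fst => //; exact: L2loc_integrable.
have l1 : locally_integrable2 (fun=> f x).
  apply: (@locally_integrable2_fst R (fun=> f x)) => //.
  move=> b d.
  apply: (@continuous_compact_integrable R (fun=> f x)); first exact: segment_compact.
  by apply: continuous_subspaceT => ?; exact: cvg_cst.
rewrite -[X in `|_ - X|%R%:E](@moll_cst R (f x) e x c e0).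
apply: le_trans (moll_sub_le x c lff l1 e0) _.
have mr := measurable_rect x (x + e) c (c + e).
have e20 : (0 <= 4 / e ^+ 2)%R by rewrite divr_ge0// exprn_ge0// ltW.
rewrite leb2_tonelli1; last 2 first.
- by mfun.
- by move=> p; rewrite lee_fin mulr_ge0// mulr_ge0 ?rect_ge0.
have step (s : R) : \int[leb R]_y (`|f (s, y).1 - f x| * (4 / e ^+ 2 * rect x (x + e) c (c + e) (s, y)))%:E
   = (4 / e * ((x <= s <= x + e)%R%:R * `|f s - f x|))%:E.
  under eq_integral => r _.
    rewrite rectE/= (_ : (_ * _)%R = (`|f s - f x| * (4 / e ^+ 2) * (x <= s <= x + e)%R%:R) * (c <= r <= c + e)%R%:R)%R; last by ring.
    rewrite EFinM; over.
  rewrite ge0_integralZl_EFin; last 4 first.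
  - exact: measurableT.
  - by move=> r _; rewrite lee_fin.
  - by mfun.
  - by rewrite mulr_ge0// mulr_ge0.
  rewrite integral_indic_itv ?lerDl ?(ltW e0)// -EFinM; congr EFin.
  by field; rewrite gt_eqF.
under eq_integral do rewrite step EFinM.
rewrite ge0_integralZl_EFin; last 4 first.
- exact: measurableT.
- by move=> s _; rewrite lee_fin mulr_ge0.
- by mfun.
- by rewrite divr_ge0// ltW.
rewrite /davg /iavg lebesgue_measure_ball; last by rewrite mulr_ge0// ltW.
rewrite inver mulrn_eq0/= gt_eqF ?mulr_gt0// muleA -EFinM.
rewrite (_ : (16 * (2 * e *+ 2)^-1 = 4 / e)%R); last first.
  by rewrite -mulr_natr; field; rewrite gt_eqF.
apply: lee_wpmul2l; first by rewrite lee_fin divr_ge0// ltW.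
rewrite [leRHS]integral_mkcond; apply: nn_le_integral => s _.
  by rewrite lee_fin mulr_ge0.
rewrite patchE; case: ifPn => [_|].
  by rewrite lee_fin; case: (_ <= s <= _)%R; rewrite ?mul1r ?mul0r.
rewrite notin_setE => sB; case: (boolP (x <= s <= x + e)%R) => [/andP[h1 h2]|]; last by rewrite mul0r.
exfalso; apply: sB; rewrite /ball/= distrC ger0_norm ?subr_ge0//; lra.
Qed.

Lemma moll_fst_cvg f (c x : R) (e : nat -> R) : L2loc f -> lebesgue_pt f x ->
  (forall k, 0 < e k)%R -> (e k @[k --> \oo] --> (0%R : R)) ->
  (moll (fun p => f p.1) (e k) x c @[k --> \oo] --> f x).
Proof.
move=> lf fx e0 ecv.
have e20 : ((2 * e k)%R @[k --> \oo] --> (0%R : R)).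
  by rewrite -[X in _ --> X](mulr0 (2 : R)%R); apply: cvgM => //; exact: cvg_cst.
have h : davg f x (2 * e k)%R @[k --> \oo] --> 0.
  by apply: (cvge_at_rightP _ _ _).1 fx _ _; split => // k; rewrite mulr_gt0.
have h16 : 16%:E * davg f x (2 * e k)%R @[k --> \oo] --> 0.
  by rewrite -[X in _ --> X](mule0 16%:E); apply: cvgeZl.
have key : (`|moll (fun p => f p.1) (e k) x c - f x|%:E @[k --> \oo] --> 0).
  apply: (squeeze_cvge _ (cvg_cst 0) h16); apply: nearW => k.
  by rewrite lee_fin normr_ge0/=; exact: moll_fst_le.
move/fine_cvgP : key => [_ /= key].
by apply/subr_cvg0; apply/norm_cvg0P.
Qed.

(** The sum of the series has finite integral, hence is finite almost everywhere, and each term is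
    at most the corresponding tail, which tends to 0. *)
Lemma ae_cvg0_of_summable (B : nat -> R -> \bar R) :
  (forall k, measurable_fun setT (B k)) -> (forall k x, 0 <= B k x) ->
  (forall k, \int[leb R]_x B k x <= (1 / (2 ^ k.+1)%:R)%:E) ->
  {ae leb R, forall x, B k x @[k --> \oo] --> 0}.
Proof.
move=> mB B0 iB.
have mS : measurable_fun setT (fun x => \sum_(k <oo) B k x).
  by apply: ge0_emeasurable_sum => // k x _ _.
have S0 x : 0 <= \sum_(k <oo) B k x by apply: nneseries_ge0 => k _ _.
have iS : (leb R).-integrable setT (fun x => \sum_(k <oo) B k x).
  apply/integrableP; split => //.
  under eq_integral do rewrite gee0_abs//.
  rewrite integral_nneseries//.
  apply: (@le_lt_trans _ _ (\sum_(k <oo) (1 / (2 ^ k.+1)%:R)%:E)).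
    by apply: lee_nneseries => k // _ _; exact: integral_ge0.
  by apply: le_lt_trans (epsilon_trick0 _ ler01) _; rewrite ltry.
have := integrable_ae measurableT iS.
apply: filterS => x /(_ I) Sfin.
have Slt : \sum_(k <oo) B k x < +oo by rewrite -ge0_fin_numE.
have tail := nneseries_tail_cvg Slt (fun k _ => B0 k x).
apply: (squeeze_cvge _ (cvg_cst 0) tail); apply: nearW => k.
rewrite B0/= (nneseries_split _ 1)// .
rewrite addn1 big_nat1 leeDl//; exact: nneseries_ge0.
Qed.

Lemma ae_and (P Q S : R -> Prop) : (forall x, P x -> Q x -> S x) ->
  {ae leb R, forall x, P x} -> {ae leb R, forall x, Q x} ->
  {ae leb R, forall x, S x}.
Proof.
move=> PQS [A [mA A0 PA]] [B [mB B0 QB]]; exists (A `|` B); split.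
- exact: measurableU.
- by apply: null_set_setU.
- move=> x /= nS; apply: contrapT => /not_orP[nA nB]; apply: nS.
  by apply: PQS; apply: contrapT => h; [apply/nA/PA|apply/nB/QB].
Qed.

(** The definition of a trace gives convergence only in a local mean-square sense. Scales chosen so
    that the k-th squared error on [-k, k] has integral at most 2^-(k+1) make the error tend to 0
    almost everywhere; Lebesgue differentiation handles the mollification of f itself. One sequence
    serves both lines, so that their difference can be passed to the limit. *)
Lemma trace_sequence F f f' (c c' : R) : locally_integrable2 F ->
  is_trace F c f -> is_trace F c' f' ->
  exists e : nat -> R, [/\ (forall k, (0 < e k <= 1)%R),
    e k @[k --> \oo] --> (0%R : R) &
    {ae leb R, forall x, (moll F (e k) x c @[k --> \oo] --> f x) /\
                         (moll F (e k) x c' @[k --> \oo] --> f' x)}].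
Proof.
move=> lF [lf tf] [lf' tf'].
have [mF _] := lF.
pose P (g : R -> R) (d : R) k (e : R) (B : R -> \bar R) :=
  [/\ measurable_fun setT B, (forall x, 0 <= B x),
    (forall x, ((- k%:R <= x <= k%:R)%R%:R *
       (moll F e x d - moll (fun p => g p.1) e x d) ^+ 2)%:E <= B x) &
    \int[leb R]_x B x <= (1 / (2 ^ k.+1)%:R)%:E].
have near_small (g : R -> R) (d : R) k : L2loc g ->
    (forall a b : R, (fun e : R => (e^-1)%R%:E *
       \int[leb2 R]_(p in `[a, b] `*` `[d, (d + e)%R]) (((F p - g p.1) ^+ 2)%:E))
      @ 0^'+ --> 0) ->
    \forall e \near (0:R)^'+, (0 < e <= 1)%R -> exists B, P g d k e B.
  move=> lg tg.
  have := tg (- (k%:R + 1))%R (k%:R + 1)%R.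
  move=> /fine_cvgP[h1 /cvgrPdist_le h2].
  (* The division by 16 absorbs the constant of [trace_error]. *)
  have pos : (0 < (1 / (2 ^ k.+1)%:R) / 16 :> R)%R.
    by rewrite !divr_gt0// ltr0n expn_gt0.
  have {}h2 := h2 _ pos.
  pose X (e : R) := (e^-1)%:E * \int[leb2 R]_(p in `[(- (k%:R + 1))%R, (k%:R + 1)%R]
    `*` `[d, (d + e)%R]) ((F p - g p.1) ^+ 2)%:E.
  near=> e => e01.
  have Xf : X e \is a fin_num by near: e.
  have : (`|0 - fine (X e)| <= 1 / (2 ^ k.+1)%:R / 16)%R by near: e.
  rewrite sub0r normrN => /(le_trans (ler_norm _)) hX.
  have [B [mB B0 vB iB]] := @trace_error F g d e k%:R mF lF lg e01 (ler0n _ _).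
  exists B; split => //; apply: le_trans iB _.
  rewrite -/(X e) -[X e]fineK// -EFinM lee_fin mulrC -ler_pdivlMr//.
have ex k : exists e : R, [/\ (0 < e <= 1)%R, (e <= k.+1%:R^-1)%R,
    (exists B, P f c k e B) & (exists B, P f' c' k e B)].
  have h1 : \forall e \near (0:R)^'+, (0 < e)%R by exact: nbhs_right_gt.
  have h2 : \forall e \near (0:R)^'+, (e <= 1)%R by exact: nbhs_right_le.
  have h3 : \forall e \near (0:R)^'+, (e <= k.+1%:R^-1)%R.
    by apply: nbhs_right_le; rewrite invr_gt0.
  have h4 := near_small f c k lf tf; have h5 := near_small f' c' k lf' tf'.
  have : \forall e \near (0:R)^'+, [/\ (0 < e <= 1)%R, (e <= k.+1%:R^-1)%R,
    (exists B, P f c k e B) & (exists B, P f' c' k e B)].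
    near=> e.
    have e01 : (0 < e <= 1)%R.
      by apply/andP; split; [near: e; exact: h1|near: e; exact: h2].
    split=> //; first by near: e; exact: h3.
    - by move: e01; near: e; exact: h4.
    - by move: e01; near: e; exact: h5.
  by move=> /filter_ex[e He]; exists e.
have [e He] := choice ex.
have e01 k : (0 < e k <= 1)%R by have [] := He k.
have e0 k : (0 < e k)%R by have /andP[] := e01 k.
have ecv : e k @[k --> \oo] --> (0%R : R).
  apply: (squeeze_cvgr _ (cvg_cst (0%R:R)) (@cvg_harmonic R)).
  by apply: nearW => k; rewrite /= ltW//=; have [] := He k.
exists e; split=> //.
have main (g : R -> R) (d : R) : L2loc g -> (forall k, exists B, P g d k (e k) B) ->
    {ae leb R, forall x, moll F (e k) x d @[k --> \oo] --> g x}.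
  move=> lg /choice[B HB].
  have lg1 : locally_integrable setT g.
    split; [by case: lg|exact: openT|move=> K _ /compact_bounded[M [Mr HM]]].
    have {}HM : K `<=` `[(- (M + 1))%R, (M + 1)%R].
      move=> x Kx /=; rewrite in_itv/= -ler_norml.
      by apply: (HM (M + 1)%R) => //; rewrite ltrDl.
    have /integrableP[_] := L2loc_integrable lg (- (M + 1)) (M + 1).
    apply: le_lt_trans.
    rewrite integral_mkcond [leRHS]integral_mkcond.
    apply: nn_le_integral => x _; rewrite !patchE.
      by case: ifP => // _; rewrite lee_fin.
    case: ifPn => [|_]; last by case: ifP => // _; exact: abse_ge0.
    by rewrite inE => /HM KM; rewrite ifT// inE.
  have Bcv : {ae leb R, forall x, B k x @[k --> \oo] --> 0}.
    by apply: ae_cvg0_of_summable => k; have [] := HB k.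
  have Lpt := lebesgue_differentiation lg1.
  apply: ae_and Bcv Lpt => x Bx gx.
  have g0 := moll_fst_cvg d lg gx e0 ecv.
  suff h : (moll F (e k) x d - moll (fun p => g p.1) (e k) x d)%R @[k --> \oo] --> (0%R:R).
    have -> : (fun k => moll F (e k) x d) = (fun k => (moll F (e k) x d - moll (fun p => g p.1) (e k) x d) + moll (fun p => g p.1) (e k) x d)%R.
      by apply/funext => k; rewrite subrK.
    by rewrite -[X in _ --> X]add0r; apply: cvgD.
  apply/cvgr0Pnorm_le => dl dl0.
  have /fine_cvgP[fB /cvgr0Pnorm_le fB0] := Bx.
  (* The threshold is a square because [B k] dominates the squared error. *)
  have {}fB0 := fB0 _ (exprn_gt0 2 dl0).
  near=> k.
  have xk : (- k%:R <= x <= k%:R)%R.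
    by rewrite -ler_norml; near: k; exact: nbhs_infty_ger.
  have [_ _ /(_ x) + _] := HB k; rewrite xk mul1r => hk.
  have fk : B k x \is a fin_num by near: k.
  have : (`|fine (B k x)| <= dl ^+ 2)%R by near: k.
  move=> /(le_trans (ler_norm _)) => h2.
  rewrite -(fineK fk) lee_fin in hk.
  have := le_trans hk h2.
  rewrite -[X in (X <= _)%R -> _]real_normK ?num_real//.
  by rewrite ler_pXn2r// nnegrE ltW.
have m1 := main f c lf (fun k => let: And4 _ _ h _ := He k in h).
have m2 := main f' c' lf' (fun k => let: And4 _ _ _ h := He k in h).
by apply: ae_and m1 m2.
Unshelve. all: by end_near. Qed.

End trace_sequence.

(** * Passage to the limit in the bounds *)

Section fatou_bound.
Local Open Scope ereal_scope.
Context d (T : measurableType d) (R : realType) (mu : {measure set T -> \bar R}).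

Lemma le_limn_einf (u v : nat -> \bar R) : (forall k, u k <= v k) ->
  limn_einf u <= limn_einf v.
Proof.
move=> uv; rewrite !limn_einf_lim; apply: lee_lim; try exact: is_cvg_einfs.
apply: nearW => n; rewrite /einfs; apply/ereal_infP => _ [k /= nk <-].
by apply: ge_ereal_inf; exists (u k) => //; exists k.
Qed.

(** The majorants b_k produced by the Schur tests have no limit in general. Convergence is therefore
    asked of minorants a_k, which still force g below the lower limit of the b_k almost
    everywhere. *)
Lemma fatou_ae_le (g : T -> \bar R) (b : nat -> T -> \bar R) (C : \bar R) :
  measurable_fun setT g -> (forall x, 0 <= g x) ->
  (forall k, measurable_fun setT (b k)) -> (forall k x, 0 <= b k x) ->
  (forall k, \int[mu]_x b k x <= C) ->
  {ae mu, forall x, exists2 a : nat -> \bar R, a k @[k --> \oo] --> g x &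
    forall k, a k <= b k x} ->
  \int[mu]_x g x <= C.
Proof.
move=> mg g0 mb b0 bC gb.
apply: (@le_trans _ _ (\int[mu]_x limn_einf (b^~ x))).
  apply: ae_ge0_le_integral => //.
  - move=> x _; rewrite limn_einf_lim; apply: lime_ge; first exact: is_cvg_einfs.
    apply: nearW => n; rewrite /einfs; apply/ereal_infP => _ [k _ <-].
    exact: b0.
  - rewrite /limn_einf; apply: (measurableT_comp (@oppe_measurable R setT)).
    apply: measurable_fun_limn_esup => k.
    exact: (measurableT_comp (@oppe_measurable R setT)).
  - apply: filterS gb => x [a ag ab] _.
    have -> : g x = limn_einf a.
      by rewrite is_cvg_limn_einfE; [apply/esym/cvg_lim|apply/cvg_ex; exists (g x)].
    exact: le_limn_einf.
apply: le_trans (fatou mu measurableT mb (fun n x _ => b0 n x)) _.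
apply: (@le_trans _ _ (limn_einf (fun=> C))); first exact: le_limn_einf.
rewrite is_cvg_limn_einfE; last exact: is_cvg_cst.
by rewrite lim_cst.
Qed.

End fatou_bound.

Section trace_bounds.
Local Open Scope ereal_scope.
Context (R : realType).
Implicit Types (F G : R * R -> R) (f : R -> R).

Lemma cvg_sqr (u : nat -> R) (l : R) : u k @[k --> \oo] --> l ->
  (u k ^+ 2)%R @[k --> \oo] --> (l ^+ 2)%R.
Proof. by move=> h; exact: (cvgM h h). Qed.

(** The integrand is symmetric in its two variables, so the region folds onto 0 < y - x <= 1,
    parametrised by x and t = y - x. The diagonal contributes 0 because the numerator vanishes
    there. *)
Lemma Hhalf_norm2E f : measurable_fun setT f ->
  Hhalf_norm2 f = 2%:E * \int[leb2 R]_p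
    ((0 < p.2 <= 1)%R%:R / p.2 ^+ 2 * (f (p.1 + p.2) - f p.1) ^+ 2)%:E.
Proof.
move=> mf.
pose q (p : R * R) := ((0 < p.2 - p.1 <= 1)%R%:R / (p.2 - p.1) ^+ 2 * (f p.2 - f p.1) ^+ 2)%R.
have mq : measurable_fun setT q by rewrite /q; mfun.
have q0 p : (0 <= q p)%R by rewrite /q; nneg.
have Jq : \int[leb2 R]_p ((0 < p.2 <= 1)%R%:R / p.2 ^+ 2 * (f (p.1 + p.2) - f p.1) ^+ 2)%:E
    = \int[leb R]_x \int[leb R]_y (q (x, y))%:E.
  rewrite leb2_tonelli1; last 2 first.
  - by mfun.
  - by move=> p; rewrite lee_fin; nneg.
  apply: eq_integral => x _.
  rewrite -[RHS](ge0_integral_shift x); last 2 first.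
  - by mfun.
  - by move=> y; rewrite lee_fin.
  by apply: eq_integral => t _; rewrite /q /= addrK (addrC t).
rewrite Jq mule_natl mule2n.
have mq' : measurable_fun setT (fun p => (q (p.2, p.1))%:E) by mfun.
have E1 : \int[leb R]_x \int[leb R]_y (q (x, y))%:E = \int[leb2 R]_p (q p)%:E.
  by rewrite leb2_tonelli1//; mfun.
have E2 : \int[leb R]_x \int[leb R]_y (q (x, y))%:E = \int[leb2 R]_p (q (p.2, p.1))%:E.
  by rewrite leb2_tonelli2// => p; rewrite lee_fin.
rewrite {1}E1 E2.
rewrite -ge0_integralD//; last 3 first.
- by move=> p _; rewrite lee_fin.
- by mfun.
- by move=> p _; rewrite lee_fin.
rewrite /Hhalf_norm2 [LHS]integral_mkcond.
apply: eq_integral => -[x y] _.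
rewrite patchE /q/= -EFinD.
have -> : ((x, y) \in [set p | (`|p.1 - p.2| <= 1)%R]) = (`|x - y| <= 1)%R.
  by apply/idP/idP; rewrite inE.
rewrite [RHS](_ : _ = (((0 < y - x <= 1)%R%:R + (0 < x - y <= 1)%R%:R) * ((f x - f y) ^+ 2 / (x - y) ^+ 2))%:E); last first.
  by rewrite -[(y - x)%R]opprB -[(f y - f x)%R]opprB !sqrrN; congr EFin; ring.
case: ifPn => [|nxy].
  have [xy|xy|->] := ltgtP x y.
  - rewrite ltr0_norm ?subr_lt0// opprB => h.
    by rewrite !subr_gt0 xy h (ltNge y x) (ltW xy)/= addr0 mul1r.
  - rewrite gtr0_norm ?subr_gt0// => h.
    by rewrite xy h (ltNge x y) (ltW xy)/= add0r mul1r.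
  - by rewrite !subrr expr0n/= !mul0r mulr0.
rewrite (_ : (0 < y - x <= 1)%R = false); last first.
  apply/negP => /andP[h1 h2]; move: nxy => /negP; apply.
  by rewrite distrC ger0_norm// ltW.
rewrite (_ : (0 < x - y <= 1)%R = false) ?add0r ?mul0r//.
apply/negP => /andP[h1 h2]; move: nxy => /negP; apply.
by rewrite ger0_norm// ltW.
Qed.

(** For fixed t the slice of the preimage of a null set is a translate of it; Tonelli then makes the
    whole preimage null. *)
Lemma ae_plane_shift (P : R -> Prop) (s : R) : {ae leb R, forall x, P x} ->
  {ae leb2 R, forall p, P (p.1 + s * p.2)%R}.
Proof.
move=> [A [mA A0 PA]].
have mf : measurable_fun setT (fun p : measurableTypeR R * measurableTypeR R => (p.1 + s * p.2)%R : measurableTypeR R).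
  by mfun.
exists ((fun p => p.1 + s * p.2)%R @^-1` A); split.
- by rewrite -[X in measurable X]setTI; exact: mf.
- have mB : measurable ((fun p : measurableTypeR R * measurableTypeR R => (p.1 + s * p.2)%R : measurableTypeR R) @^-1` A).
    by rewrite -[X in measurable X]setTI; exact: mf.
  have := @integral_indic _ _ _ (leb2 R) _ measurableT _ mB.
  rewrite setIT => H; apply: (etrans (esym H)) => {H}.
  rewrite leb2_tonelli2; last 2 first.
  + apply/measurable_EFinP; exact: measurable_indic.
  + by move=> p; rewrite lee_fin.
  apply: integral0_eq => t _.
  have mI : measurable_fun setT (\1_A : R -> R) by exact: measurable_indic.
  transitivity (\int[leb R]_x ((fun x => (\1_A x)%:E) (x + s * t)%R)).
    by apply: eq_integral => x _; rewrite !indicE.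
  rewrite (@ge0_integral_shift R (s * t)%R (fun x => (\1_A x)%:E)); [|exact/measurable_EFinP|by move=> x; rewrite lee_fin].
  by have := @integral_indic _ _ _ (leb R) _ measurableT _ mA; rewrite setIT => ->.
- move=> p /= nP; apply: PA => h; exact: nP.
Qed.

(** The constant is 2 * 3 * (16 + 16 + 4): the factor of [Hhalf_norm2E], the square of a sum of
    three terms, two vertical pieces and one horizontal piece. The height 2 covers 1 + e for every e
    <= 1. *)
Lemma trace_Hhalf_le F (G1 G2 : R * R -> R) f f' (c c' : R) : H1_grad F G1 G2 ->
  is_trace F c f -> is_trace F c' f' ->
  Hhalf_norm2 f <= 216%:E * \int[leb2 R]_z
    ((G1 z ^+ 2 + G2 z ^+ 2) * (c <= z.2 <= c + 2)%R%:R)%:E.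
Proof.
move=> FG tf tf'; have [mF [iF [[mG1 _] [[mG2 _] _]]]] := FG.
have lF : locally_integrable2 F by split.
have [e [e01 e0 ecv]] := trace_sequence lF tf tf'.
have [[mf _] _] := tf.
have epos k : (0 < e k)%R by have /andP[] := e01 k.
rewrite Hhalf_norm2E// (_ : 216 = 2 * 108)%R; last by ring.
rewrite EFinM -muleA; apply: lee_wpmul2l; first by rewrite lee_fin.
have [B0 HB0] := choice (fun k => hardy_bound FG c 0%R (epos k)).
have [B1 HB1] := choice (fun k => hardy_bound FG c 1%R (epos k)).
have [B2 HB2] := choice (fun k => horizontal_bound FG c (epos k)).
apply: (@fatou_ae_le _ _ R (leb2 R)
  (fun p => ((0 < p.2 <= 1)%R%:R / p.2 ^+ 2 * (f (p.1 + p.2) - f p.1) ^+ 2)%:E)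
  (fun k p => 3%:E * (B0 k p + B1 k p + B2 k p))).
- by mfun.
- by move=> p; rewrite lee_fin; nneg.
- move=> k; have [m0 _ _ _] := HB0 k; have [m1 _ _ _] := HB1 k; have [m2 _ _ _] := HB2 k.
  by apply: emeasurable_funM => //; apply: emeasurable_funD => //; exact: emeasurable_funD.
- move=> k p; have [_ p0 _ _] := HB0 k; have [_ p1 _ _] := HB1 k; have [_ p2 _ _] := HB2 k.
  by rewrite mule_ge0// !adde_ge0.
- move=> k; have [m0 p0 _ i0] := HB0 k; have [m1 p1 _ i1] := HB1 k; have [m2 p2 _ i2] := HB2 k.
  rewrite ge0_integralZl_EFin//; last 2 first.
  + by move=> p _; rewrite !adde_ge0.
  + by apply: emeasurable_funD => //; exact: emeasurable_funD.
  rewrite ge0_integralD//; last 2 first.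
  + by move=> p _; rewrite !adde_ge0.
  + exact: emeasurable_funD.
  rewrite ge0_integralD//.
  set I := \int[leb2 R]_z ((G1 z ^+ 2 + G2 z ^+ 2) * _)%:E.
  have I0 : 0 <= I.
    by apply: integral_ge0 => z _; rewrite lee_fin mulr_ge0// addr_ge0 ?sqr_ge0.
  have bnd (G : R * R -> R) (m : R) : (0 <= m)%R ->
      (forall z, (G z ^+ 2 <= G1 z ^+ 2 + G2 z ^+ 2)%R) ->
      \int[leb2 R]_z (G z ^+ 2 * (m * (c <= z.2 <= c + 1 + e k)%R%:R))%:E <= m%:E * I.
    move=> m0' GG; rewrite /I -ge0_integralZl_EFin//; last 2 first.
    - by move=> z _; rewrite lee_fin mulr_ge0// addr_ge0 ?sqr_ge0.
    - by mfun.
    apply: nn_le_integral => z _; first by rewrite lee_fin mulr_ge0 ?sqr_ge0// mulr_ge0.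
    rewrite -EFinM lee_fin mulrCA ler_wpM2l// ler_pM ?sqr_ge0// ler_nat.
    have [_ ek1] := andP (e01 k).
    case: (boolP (c <= z.2 <= c + 1 + e k)%R) => // /andP[-> h2].
    by rewrite (_ : (z.2 <= c + 2)%R = true)//; apply/idP; lra.
  have b0 := le_trans i0 (bnd G2 16%R _ (fun z => _)).
  have b1 := le_trans i1 (bnd G2 16%R _ (fun z => _)).
  have b2 := le_trans i2 (bnd G1 4%R _ (fun z => _)).
  apply: (@le_trans _ _ (3%:E * (16%:E * I + 16%:E * I + 4%:E * I))).
    apply: lee_wpmul2l; first by rewrite lee_fin.
    apply: leeD; first apply: leeD.
    - by apply: b0 => // z; rewrite lerDr sqr_ge0.
    - by apply: b1 => // z; rewrite lerDr sqr_ge0.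
    - by apply: b2 => // z; rewrite lerDl sqr_ge0.
  rewrite -!ge0_muleDl ?lee_fin// muleA -!EFinD -EFinM.
  by rewrite (_ : 3 * (16 + 16 + 4) = 108)%R//; ring.
have a0 := @ae_plane_shift _ 0%R ecv; have a1 := @ae_plane_shift _ 1%R ecv.
have : {ae leb2 R, forall p, (moll F (e k) p.1 c @[k --> \oo] --> f p.1) /\
    (moll F (e k) (p.1 + p.2) c @[k --> \oo] --> f (p.1 + p.2))%R}.
  have := @filterI _ _ (ae_filter_ringOfSetsType (leb2 R)) _ _ a0 a1.
  apply: (@filterS _ _ (ae_filter_ringOfSetsType (leb2 R))) => p [[h0 _] [h1 _]].
  by rewrite mul0r addr0 in h0; rewrite mul1r in h1.
apply: (@filterS _ _ (ae_filter_ringOfSetsType (leb2 R))) => p [h0 h1].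
(* The minorants are the regularised quotients of the mollification: for p.2 > 0 the density (p.2 +
   2 e_k)^-2 tends to p.2^-2, and for the other p the indicator makes everything 0. *)
exists (fun k => ((0 < p.2 <= 1)%R%:R / (p.2 + 2 * e k) ^+ 2 * (moll F (e k) (p.1 + p.2) c - moll F (e k) p.1 c) ^+ 2)%:E).
  apply: cvg_EFin; first by apply: nearW.
  case: (boolP (0 < p.2 <= 1)%R) => [/andP[t0 t1]|_]; last first.
    rewrite mul0r; under eq_fun do rewrite mul0r mul0r.
    by rewrite mul0r; exact: cvg_cst.
  apply: cvgM.
    apply: cvgM; first exact: cvg_cst.
    apply: cvgV; first by rewrite expf_eq0/= gt_eqF.
    have h : (p.2 + 2 * e k)%R @[k --> \oo] --> p.2.
      rewrite -[X in _ --> X]addr0; apply: cvgD; first exact: cvg_cst.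
      by rewrite -[X in _ --> X](mulr0 (2 : R)%R); apply: cvgM => //; exact: cvg_cst.
    exact: cvg_sqr.
  by apply: cvg_sqr; exact: cvgB.
move=> k.
have [_ p0 v0 _] := HB0 k; have [_ p1 v1 _] := HB1 k; have [_ p2 v2 _] := HB2 k.
case: (boolP (0 < p.2 <= 1)%R) => [/andP[t0 t1]|_]; last first.
  by rewrite mul0r mul0r mule_ge0// !adde_ge0.
have := v0 p; have := v1 p; have := v2 p.
rewrite (ltW t0) t1/= mul0r addr0 !mul1r => w2 w1 w0.
apply: le_trans (lee_wpmul2l _ (leeD (leeD w0 w1) w2)); last by rewrite lee_fin.
rewrite -!EFinD -EFinM lee_fin -!mulrDr [leRHS]mulrCA.
have tp : (0 <= (p.2 + 2 * e k) ^- 2)%R by rewrite invr_ge0 sqr_ge0.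
rewrite ler_wpM2l//.
move: (moll F (e k) (p.1 + p.2) c) (moll F (e k) p.1 c)
  (moll F (e k) (p.1 + p.2) (c + p.2)) (moll F (e k) p.1 (c + p.2)) => u v y z.
have := sqr_ge0 ((u - y) - (y - z))%R; have := sqr_ge0 ((y - z) - (z - v))%R.
have := sqr_ge0 ((u - y) - (z - v))%R.
by rewrite -subr_ge0; nra.
Qed.

Lemma trace_difference_le F (G1 G2 : R * R -> R) f f' (c b : R) : H1_grad F G1 G2 -> (0 <= b)%R ->
  is_trace F c f -> is_trace F (c + b) f' ->
  L2_norm2 (fun x => f x - f' x)%R <= (4 * (b + 1))%:E * \int[leb2 R]_z
    ((G1 z ^+ 2 + G2 z ^+ 2) * (c <= z.2 <= c + b + 1)%R%:R)%:E.
Proof.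
move=> FG b0 tf tf'; have [mF [iF [[mG1 _] [[mG2 _] _]]]] := FG.
have lF : locally_integrable2 F by split.
have [e [e01 e0 ecv]] := trace_sequence lF tf tf'.
have [[mf _] _] := tf; have [[mf' _] _] := tf'.
have epos k : (0 < e k)%R by have /andP[] := e01 k.
have [B HB] := choice (fun k => difference_bound FG c (epos k) b0).
apply: (@fatou_ae_le _ _ R (leb R) (fun x => ((f x - f' x) ^+ 2)%:E) B).
- by mfun.
- by move=> p; rewrite lee_fin sqr_ge0.
- by move=> k; have [] := HB k.
- by move=> k; have [] := HB k.
- move=> k; have [m0 p0 _ i0] := HB k; apply: le_trans i0 _.
  rewrite -ge0_integralZl_EFin//; last 3 first.
  + by move=> z _; rewrite lee_fin mulr_ge0// addr_ge0 ?sqr_ge0.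
  + by mfun.
  + by rewrite mulr_ge0// addr_ge0.
  apply: nn_le_integral => z _.
    by rewrite lee_fin mulr_ge0 ?sqr_ge0// mulr_ge0// mulr_ge0// addr_ge0// ltW.
  have [_ ek1] := andP (e01 k).
  rewrite -EFinM lee_fin mulrCA ler_pM//.
  + by rewrite mulr_ge0// addr_ge0// ltW.
  + by rewrite mulr_ge0 ?sqr_ge0.
  + by rewrite ler_pM2l// lerD2l.
  + rewrite ler_pM ?sqr_ge0//; first by rewrite lerDr sqr_ge0.
    rewrite ler_nat; case: (boolP (c <= z.2 <= c + b + e k)%R) => // /andP[-> h2].
    by rewrite (_ : (z.2 <= c + b + 1)%R = true)//; apply/idP; lra.
apply: (@filterS _ _ (ae_filter_ringOfSetsType (leb R))) ecv => x [h h'].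
exists (fun k => ((moll F (e k) x (c + b) - moll F (e k) x c) ^+ 2)%:E); last first.
  by move=> k; have [_ _ v _] := HB k; exact: v.
apply: cvg_EFin; first by apply: nearW.
rewrite -[(f x - f' x)%R]opprB sqrrN.
by apply: cvg_sqr; exact: cvgB.
Qed.

End trace_bounds.

(** * Summation over the lines *)

Section strips.
Local Open Scope ereal_scope.
Context (R : realType).

Lemma line_heightS (n : int) : line_height R (n + 1) = (line_height R n + pi)%R.
Proof. by rewrite /line_height intrD mulrDr mulr1. Qed.

(** With m the integer part of y / pi, only n = m, m - 1 and m - 2 can occur, the last one only when
    y lies exactly on a line. *)
Lemma sum_strips_le (s : seq int) (y : R) : uniq s ->
  (\sum_(n <- s) (line_height R n <= y <= line_height R n + 2 * pi)%R%:R <= 3 :> R)%R.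
Proof.
move=> us; pose m : int := Num.floor (y / pi).
have pi0 := @pi_gt0 R.
have count_le1 (k : int) : (\sum_(n <- s) (n == k)%:R <= 1 :> R)%R.
  rewrite -natr_sum lern1.
  have -> : (\sum_(n <- s) (n == k) = count_mem k s)%N.
    by rewrite -sum1_count [RHS]big_mkcond; apply: eq_bigr => i _ /=; case: eqP.
  by rewrite count_uniq_mem// leq_b1.
apply: (@le_trans _ _ (\sum_(n <- s) ((n == m)%:R + (n == (m - 1)%R)%:R + (n == (m - 2)%R)%:R))%R).
  apply: ler_sum => n _.
  case: (boolP (_ <= y <= _)%R) => [/andP[h1 h2]|_]; last by rewrite !addr_ge0.
  have n1 : (n <= m)%R.
    by rewrite /m floor_ge_int ler_pdivlMr// mulrC.
  have n2 : (m <= n + 2)%R.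
    have : ((Num.floor (y / pi))%:~R <= y / pi :> R)%R by exact: floor_le.
    rewrite -/m ler_pdivlMr// => h3.
    have := le_trans h3 h2; rewrite /line_height (mulrC pi) -mulrDl ler_pM2r//.
    by rewrite -(intrD _ n 2) ler_int.
  have a1 := ler0n R (n == m); have a2 := ler0n R (n == (m - 1)%R).
  have a3 := ler0n R (n == (m - 2)%R).
  have : [|| n == m, n == (m - 1)%R | n == (m - 2)%R] by lia.
  by case/or3P => h; rewrite h /= in a1 a2 a3 *; lra.
rewrite !big_split/=.
have := count_le1 m; have := count_le1 (m - 1)%R; have := count_le1 (m - 2)%R; lra.
Qed.

Lemma esum_strips_le (a : int -> \bar R) (g : R * R -> R) (C : R) : (0 <= C)%R ->
  measurable_fun setT g -> (forall z, (0 <= g z)%R) ->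
  (forall n, a n <= C%:E * \int[leb2 R]_z
     (g z * (line_height R n <= z.2 <= line_height R n + 2 * pi)%R%:R)%:E) ->
  esum [set: int] a <= (3 * C)%:E * \int[leb2 R]_z (g z)%:E.
Proof.
move=> C0 mg g0 aC.
apply: ge_ereal_sup => _ [A [Afin _] <-].
rewrite fsbig_finite//=.
apply: le_trans (@lee_sum _ _ _ _ _ _ (fun n _ => aC n)) _.
rewrite -ge0_sume_distrr//; last first.
  by move=> n _; apply: integral_ge0 => z _; rewrite lee_fin mulr_ge0.
rewrite (mulrC 3%R C) EFinM -muleA; apply: lee_wpmul2l; first by rewrite lee_fin.
rewrite -ge0_integral_sum//; last 2 first.
- by move=> n; mfun.
- by move=> n z _; rewrite lee_fin mulr_ge0.
rewrite -ge0_integralZl_EFin//; last 2 first.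
- by move=> z _; rewrite lee_fin.
- by mfun.
apply: nn_le_integral => z _.
  by apply: sume_ge0 => n _; rewrite lee_fin mulr_ge0.
rewrite sumEFin -EFinM lee_fin -mulr_sumr mulrC ler_wpM2r//.
exact: (sum_strips_le _ (finmap.fset_uniq _)).
Qed.

Lemma L2_sub_lt (f f' : R -> R) : L2loc f -> L2loc f' ->
  L2_norm2 (fun x => f x - f' x)%R < +oo -> L2 (fun x => f x - f' x)%R.
Proof.
move=> [mf _] [mf' _] h; split; first by mfun.
apply/integrableP; split; first by mfun.
apply: le_lt_trans h; rewrite /L2_norm2 le_eqVlt; apply/orP; left; apply/eqP.
by apply: eq_integral => x _; rewrite gee0_abs// lee_fin sqr_ge0.
Qed.

Lemma H1_norm2_lty (G1 G2 : R * R -> R) : L2_R2 G1 -> L2_R2 G2 -> H1_norm2 G1 G2 < +oo.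
Proof.
move=> [mG1 i1] [mG2 i2]; rewrite /H1_norm2.
under eq_integral do rewrite EFinD.
by rewrite integralD//; apply: lte_add_pinfty; exact: integrable_lty.
Qed.

Lemma trace_theorem (F G1 G2 : R * R -> R) (f : int -> R -> R) :
  H1_grad F G1 G2 -> (forall n : int, is_trace F (line_height R n) (f n)) ->
  [/\ forall n : int, Hhalf (f n),
      forall n : int, L2 (fun x => f n x - f (n + 1)%R x)%R &
      family_norm2 f <= (648 + 12 * (pi + 1))%:E * H1_norm2 G1 G2].
Proof.
move=> FG tf; have [_ [_ [lG1 [lG2 _]]]] := FG.
have [mG1 _] := lG1; have [mG2 _] := lG2.
have Glty := H1_norm2_lty lG1 lG2.
have pi0 := @pi_ge2 R.
pose g z := (G1 z ^+ 2 + G2 z ^+ 2)%R.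
have mg : measurable_fun setT g by rewrite /g; mfun.
have g0 z : (0 <= g z)%R by rewrite /g addr_ge0 ?sqr_ge0.
pose I n := \int[leb2 R]_z (g z * (line_height R n <= z.2 <= line_height R n + 2 * pi)%R%:R)%:E.
(* The estimates use strips of height 2 and pi + 1; both fit into 2 pi because pi >= 2, and a common
   height lets one overlap count serve both sums. *)
have widen (c b : R) : (b <= 2 * pi)%R ->
    \int[leb2 R]_z ((G1 z ^+ 2 + G2 z ^+ 2) * (c <= z.2 <= c + b)%R%:R)%:E <=
    \int[leb2 R]_z (g z * (c <= z.2 <= c + 2 * pi)%R%:R)%:E.
  move=> bpi; apply: nn_le_integral => z _; first by rewrite lee_fin mulr_ge0// g0.
  rewrite lee_fin ler_wpM2l ?g0// ler_nat.
  case: (boolP (c <= z.2 <= c + b)%R) => // /andP[-> h].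
  by rewrite (le_trans h)// lerD2l.
have hf n : Hhalf_norm2 (f n) <= 216%:E * I n.
  apply: le_trans (trace_Hhalf_le FG (tf n) (tf n)) _.
  by apply: lee_wpmul2l; [rewrite lee_fin|apply: widen; lra].
have df n : L2_norm2 (fun x => f n x - f (n + 1)%R x)%R <= (4 * (pi + 1))%:E * I n.
  have t1 := tf (n + 1)%R; rewrite line_heightS in t1.
  have p0 : (0 <= pi :> R)%R by lra.
  apply: le_trans (trace_difference_le FG p0 (tf n) t1) _.
  apply: lee_wpmul2l; first by rewrite lee_fin; lra.
  by rewrite -addrA; apply: widen; lra.
have Ilty n : I n < +oo.
  apply: le_lt_trans Glty; apply: nn_le_integral => z _.
    by rewrite lee_fin mulr_ge0// g0.
  by rewrite lee_fin -[leRHS]mulr1 ler_wpM2l ?g0//; case: (_ <= z.2 <= _)%R.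
have I0 n : 0 <= I n by apply: integral_ge0 => z _; rewrite lee_fin mulr_ge0 ?g0.
have lt1 n (C : R) : (0 <= C)%R -> C%:E * I n < +oo.
  by move=> C0; apply: lte_mul_pinfty; rewrite ?lee_fin.
have lf n : L2loc (f n) by have [] := tf n.
split.
- by move=> n; split => //; apply: le_lt_trans (hf n) _; apply: lt1.
- by move=> n; apply: L2_sub_lt => //; apply: le_lt_trans (df n) _; apply: lt1; lra.
- have c1 : (0 <= 4 * (pi + 1) :> R)%R by lra.
  have e1 := @esum_strips_le _ g 216 (ler0n _ _) mg g0 hf.
  have e2 := @esum_strips_le _ g _ c1 mg g0 df.
  apply: le_trans (leeD e1 e2) _; rewrite -ge0_muleDl ?lee_fin//; last lra.
  rewrite -EFinD (_ : 3 * 216 + 3 * (4 * (pi + 1)) = 648 + 12 * (pi + 1))%R//; ring.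
Qed.

End strips.

Section signed_invariance.
Local Open Scope ereal_scope.
Context (R : realType).

Lemma integral_shift (c : R) (g : R -> R) : measurable_fun setT g ->
  \int[leb R]_x (g (x + c)%R)%:E = \int[leb R]_x (g x)%:E.
Proof.
move=> mg; rewrite [LHS]integralE [RHS]integralE.
have mp : measurable_fun setT (fun x => (g x)%:E) by mfun.
congr (_ - _).
- rewrite -[RHS](ge0_integral_shift c)//; last exact: measurable_funepos.
  by apply: eq_integral => x _; rewrite !funeposE.
- rewrite -[RHS](ge0_integral_shift c)//; last exact: measurable_funeneg.
  by apply: eq_integral => x _; rewrite !funenegE.
Qed.

Lemma integrable_normP d (T : measurableType d) (mu : {measure set T -> \bar R}) (g : T -> R) :
  measurable_fun setT g -> \int[mu]_x (`|g x|%R)%:E < +oo ->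
  mu.-integrable setT (fun x => (g x)%:E).
Proof. by move=> mg h; apply/integrableP; split; [mfun|exact: h]. Qed.

End signed_invariance.

(** * Averages along a line *)

Section averaging_kernels.
Local Open Scope ereal_scope.
Context (R : realType).
Implicit Types (f : R -> R) (K : R -> R -> R).

(* K t is supported on [0, t / pi] and of size (t / pi)^-2, the size of the
   derivatives of an approximate identity at scale t / pi; 19 is what the kernels
   [ext_kernel_x] and [ext_kernel_t] need. *)
Definition averaging_kernel K :=
  measurable_fun setT (fun p : R * R => K p.1 p.2) /\
  forall t s : R, (`|K t s| <=
    19 / (t / pi) ^+ 2 * ((0 < t < pi) && (0 <= s <= t / pi))%:R)%R.

Definition average f K (x t : R) : R := (\int[leb R]_s (f (x + s) * K t s))%R.

Definition oscillation f K (x t : R) : R :=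
  (\int[leb R]_s ((f (x + s) - f x) * K t s))%R.

Lemma integrable_average f (x C b : R) (k : R -> R) : L2loc f ->
  measurable_fun setT k -> (0 <= C)%R ->
  (forall s, `|k s| <= C * (0 <= s <= b)%R%:R)%R ->
  (leb R).-integrable setT (fun s => (f (x + s)%R * k s)%:E).
Proof.
move=> lf mk C0 kC; have [mf _] := lf.
have h : \int[leb R]_s ((0 <= s <= b)%R%:R * `|f (x + s)%R|)%:E < +oo.
  rewrite -integral_itv_indic.
  have -> : \int[leb R]_(s in `[0%R, b]) (`|f (x + s)%R|)%:E =
      \int[leb R]_(z in `[x, (x + b)%R]) (`|f z|)%:E.
    rewrite !integral_itv_indic.
    rewrite -[RHS](ge0_integral_shift x); last 2 first.
    - by mfun.
    - by move=> s; rewrite lee_fin mulr_ge0.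
    apply: eq_integral => s _; rewrite (addrC s); congr (_%:R * _)%:E.
    by rewrite lerDl lerD2l.
  by have /integrableP[_] := L2loc_integrable lf x (x + b).
apply: integrable_normP; first by mfun.
apply: (@le_lt_trans _ _ (\int[leb R]_s (C%:E * ((0 <= s <= b)%R%:R * `|f (x + s)%R|)%:E))).
  apply: nn_le_integral => s _; first by rewrite lee_fin.
  rewrite -EFinM lee_fin normrM mulrA mulrC ler_wpM2r//.
rewrite ge0_integralZl_EFin; last 4 first.
- exact: measurableT.
- by move=> s _; rewrite lee_fin mulr_ge0.
- by mfun.
- exact: C0.
apply: lte_mul_pinfty => //; rewrite lee_fin//.
Qed.

Lemma averaging_kernel_bound K (t : R) : averaging_kernel K ->
  exists2 C : R, (0 <= C)%R &
    forall s, (`|K t s| <= C * (0 <= s <= t / pi)%R%:R)%R.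
Proof.
move=> [_ bK]; exists (19 / (t / pi) ^+ 2)%R; first by rewrite divr_ge0// sqr_ge0.
move=> s; apply: le_trans (bK t s) _; rewrite ler_wpM2l//.
  by rewrite divr_ge0// sqr_ge0.
by rewrite ler_nat; case: (0 < t < pi)%R => //=.
Qed.

Lemma measurable_kernel_section K (t : R) : averaging_kernel K -> measurable_fun setT (K t).
Proof. by move=> [mK _]; exact: (measurableT_comp mK (@pair1_measurable _ _ _ _ t)). Qed.

Lemma L2loc_cst (a : R) : L2loc (fun=> a).
Proof.
split=> // b c.
apply: (@continuous_compact_integrable R (fun=> a ^+ 2)%R); first exact: segment_compact.
by apply: continuous_subspaceT => ?; exact: cvg_cst.
Qed.

Lemma integrable_kernel K (t : R) : averaging_kernel K ->
  (leb R).-integrable setT (fun s => (K t s)%:E).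
Proof.
move=> aK; have [C C0 KC] := averaging_kernel_bound t aK.
have := integrable_average 0 (L2loc_cst 1) (measurable_kernel_section t aK) C0 KC.
by apply: eq_integrable => // s _; rewrite mul1r.
Qed.

Lemma average_oscillation f K (x t : R) : L2loc f -> averaging_kernel K ->
  average f K x t = (oscillation f K x t + f x * \int[leb R]_s K t s)%R.
Proof.
move=> lf aK; have [C C0 KC] := averaging_kernel_bound t aK.
have mk := measurable_kernel_section t aK.
have i1 := integrable_average x lf mk C0 KC.
have i2 := integrable_average x (L2loc_cst (f x)) mk C0 KC.
rewrite /average /oscillation -RintegralZl//; last exact: integrable_kernel.
rewrite -RintegralD//.
- by apply: eq_Rintegral => s _; rewrite mulrBl subrK.
- have := integrableB measurableT i1 i2; apply: eq_integrable => // s _.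
  by rewrite /= mulrBl EFinB.
Qed.

(** Half of the squared seminorm [Hhalf_norm2], in the coordinates (x, increment) in which the
    averages are estimated. *)
Definition gagliardo f := \int[leb2 R]_p
  ((0 < p.2 <= 1)%R%:R / p.2 ^+ 2 * (f (p.1 + p.2)%R - f p.1) ^+ 2)%:E.

(** At s = 0 the factor f(x + s) - f(x) vanishes, so the support of the kernel may be cut to 0 < s,
    the range that occurs in [gagliardo]. *)
Lemma oscillation_norm_le f K (x t : R) : L2loc f -> averaging_kernel K ->
  `|oscillation f K x t|%:E <= \int[leb R]_s (`|f (x + s) - f x| *
    (19 / (t / pi) ^+ 2 * ((0 < t < pi) && (0 < s <= t / pi))%:R))%:E.
Proof.
move=> lf aK; have [C C0 KC] := averaging_kernel_bound t aK.
have mk := measurable_kernel_section t aK; have [mf _] := lf.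
have i1 := integrable_average x lf mk C0 KC.
have i2 := integrable_average x (L2loc_cst (f x)) mk C0 KC.
have i3 : (leb R).-integrable setT (fun s => ((f (x + s) - f x) * K t s)%:E).
  have := integrableB measurableT i1 i2; apply: eq_integrable => // s _.
  by rewrite /= mulrBl EFinB.
rewrite /oscillation EFin_normr_Rintegral//.
apply: le_trans (le_abse_integral _ _ _) _ => //; first by mfun.
apply: nn_le_integral => s _; first exact: abse_ge0.
rewrite abse_EFin lee_fin normrM.
have [->|s0] := eqVneq s 0%R; first by rewrite addr0 subrr normr0 !mul0r.
rewrite ler_wpM2l//; have [_ /(_ t s)] := aK.
by rewrite (le_eqVlt 0%R s) eq_sym (negbTE s0).
Qed.

Lemma integral_rcube_le (s : R) : (0 < s <= 1)%R ->
  \int[leb R]_t ((pi * s <= t <= pi)%R%:R * (`|t| ^+ 3)^-1)%:E <= ((2 * (pi * s) ^+ 2)^-1)%:E.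
Proof.
move=> /andP[s0 s1]; rewrite -integral_itv_indic.
have pi0 := @pi_gt0 R.
have ps : (0 < pi * s :> R)%R by rewrite mulr_gt0.
have psp : (pi * s <= pi :> R)%R by rewrite ger_pMr.
(* Capping t from below at pi s changes nothing on the interval of integration and makes the inverse
   cube continuous on the whole line. *)
pose h (t : R) := (Num.max (pi * s) t)%R.
have hpos t : (0 < h t)%R by rewrite /h lt_max ps.
have hE t : (pi * s <= t)%R -> h t = t by move=> ?; rewrite /h; apply/max_idPr.
have -> : \int[leb R]_(t in `[(pi * s)%R, pi]) ((`|t| ^+ 3)^-1)%:E =
    \int[leb R]_(t in `[(pi * s)%R, pi]) (((h t) ^+ 3)^-1)%:E.
  apply: eq_integral => t /[!inE] /= /[!in_itv]/= /andP[t1 t2].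
  by rewrite hE// ger0_norm// (le_trans (ltW ps)).
have hd (t : R) : (pi * s <= t <= pi)%R ->
    is_derive t 1%R (fun t => - 2^-1 * (t ^+ 2)^-1)%R ((h t ^+ 3)^-1)%R.
  move=> /andP[t1 _]; rewrite (hE t t1); have t0 : (0 < t)%R by exact: lt_le_trans t1.
  suff -> : ((t ^+ 3)^-1 = - 2^-1 * (- (t ^+ 2) ^- 2 *: (t *+ 2)))%R.
    apply: is_derive_mull_cst; apply: is_deriveV; first by rewrite expf_eq0 gt_eqF.
    have h1 := @is_derive_id R R t 1%R.
    have -> : (GRing.exp (R:=R))^~ 2%N = (id * id : R -> R)%R by apply/funext => z; rewrite expr2.
    apply: (is_derive_eq (is_deriveM h1 h1)).
    by rewrite /GRing.scale/= mulr1 mulr2n.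
  by rewrite /GRing.scale/= -mulr_natr; field; rewrite gt_eqF.
have hc : {within `[(pi * s)%R, pi], continuous (fun t => (h t ^+ 3)^-1)%R}.
  apply: continuous_subspaceT => t; apply: cvgV; first by rewrite expf_eq0/= gt_eqF.
  have ch : {for t, continuous h}.
    by apply: (@continuous_max _ _ (cst (pi * s)%R) id); [exact: cvg_cst|exact: cvg_id].
  exact: (@continuous_comp _ _ _ h (fun z : R => z ^+ 3)%R t ch (@exprn_continuous _ 3 (h t))).
rewrite (integral_derive psp hd hc) lee_fin invfM.
have : (0 <= 2^-1 * (pi ^+ 2)^-1 :> R)%R by rewrite mulr_ge0// invr_ge0 sqr_ge0.
lra.
Qed.

(** A Schur test in (t, s) with constant weight. With u = t / pi the rows are at most 19 / u; the
    column at s is at most the integral of 361 u^-3 over u >= s, that is 361 pi / (2 s^2), and 181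
    is 361 / 2 rounded up. *)
Lemma oscillation_sqr_le f K (x : R) : L2loc f -> averaging_kernel K ->
  \int[leb R]_t (oscillation f K x t ^+ 2)%:E <=
  \int[leb R]_s ((f (x + s) - f x) ^+ 2 * (181 * pi * ((0 < s <= 1)%R%:R / s ^+ 2)))%:E.
Proof.
move=> lf aK; have [mf _] := lf; have pi0 := @pi_gt0 R.
have ind0 (t : R) : ((0 < t < pi)%R%:R != 0 :> R)%R -> (0 < t < pi)%R.
  by case: (0 < t < pi)%R => //; rewrite eqxx.
have [|||||||||||||B [mB B0 vB iB]] := @weighted_schur _ _ _ _ R (leb R) (leb R)
  (fun s => f (x + s) - f x)%R (fun=> 1%R)
  (fun s => 181 * pi * ((0 < s <= 1)%R%:R / s ^+ 2))%R
  (fun q => 19 / (q.1 / pi) ^+ 2 * ((0 < q.1 < pi)%R && (0 < q.2 <= q.1 / pi)%R)%:R)%R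
  (fun t => 19 / (`|t| / pi))%R (fun t => (0 < t < pi)%R%:R)
  (fun t => oscillation f K x t) => //.
- by mfun.
- by mfun.
- by mfun.
- by mfun.
- by move=> q; rewrite mulr_ge0// divr_ge0// sqr_ge0.
- by move=> t; rewrite divr_ge0// divr_ge0// ltW.
- by move=> t /ind0/andP[t0 _]; rewrite divr_gt0// divr_gt0// normr_gt0 gt_eqF.
- by move=> t _; exact: oscillation_norm_le.
- move=> t /ind0/andP[t0 t1] /=; rewrite t0 t1/=.
  have tp : (0 < t / pi :> R)%R by rewrite divr_gt0.
  apply: (@le_trans _ _ (\int[leb R]_s ((19 / (t / pi) ^+ 2)%R%:E * ((0 <= s <= t / pi)%R%:R)%:E))).
    apply: nn_le_integral => s _.
      by rewrite lee_fin divr1 mulr_ge0// divr_ge0// sqr_ge0.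
    rewrite -EFinM lee_fin divr1 ler_wpM2l//; first by rewrite divr_ge0// sqr_ge0.
    by rewrite ler_nat; case: ltP => //= s0; rewrite (ltW s0).
  rewrite ge0_integralZl_EFin; last 4 first.
  + exact: measurableT.
  + by move=> s _; rewrite lee_fin.
  + by mfun.
  + by rewrite divr_ge0// sqr_ge0.
  rewrite integral_indic_itv ?(ltW tp)// -EFinM lee_fin subr0 (gtr0_norm t0).
  move: (t / pi)%R tp => u u0.
  by rewrite le_eqVlt; apply/orP; left; apply/eqP; field; rewrite gt_eqF.
- move=> s; rewrite divr1.
  have [hs|hs] := boolP (0 < s <= 1)%R; last first.
    rewrite mul0r mulr0 (_ : (fun _ => _) = cst 0) ?integral0// funeqE => t /=.
    congr (_%:E); apply/eqP; rewrite !mulf_eq0.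
    case: (boolP (0 < t < pi)%R) => [/andP[t0 t1]|_]; last by rewrite eqxx.
    case: (boolP (0 < s <= t / pi)%R) => [/andP[s0 s1]|_]; last by rewrite /= eqxx !orbT.
    case/negP: hs; rewrite s0/= (le_trans s1)// ler_pdivrMr// mul1r ltW//.
  have /andP[s0 s1] := hs.
  have [C C0 CE] : exists2 C : R, (0 <= C)%R & C = (361 * pi ^+ 3)%R.
    apply: (ex_intro2 _ _ (361 * pi ^+ 3)%R _ (erefl _)).
    by apply: mulr_ge0; [exact: ler0n|apply: exprn_ge0; exact: ltW].
  apply: (@le_trans _ _ (\int[leb R]_t (C%:E *
      ((pi * s <= t <= pi)%R%:R * (`|t| ^+ 3)^-1)%:E))).
    apply: nn_le_integral => t _.
      rewrite lee_fin; apply: mulr_ge0; apply: mulr_ge0 => //.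
        by apply: divr_ge0 => //; apply: divr_ge0 => //; exact: ltW.
      by apply: divr_ge0 => //; exact: sqr_ge0.
    rewrite -EFinM lee_fin.
    case: (boolP (0 < t < pi)%R) => [/andP[t0 t1]|_]; last first.
      by rewrite !mul0r; do 2 (apply: mulr_ge0 => //); rewrite invr_ge0 exprn_ge0.
    rewrite s0/= ler_pdivlMr// (mulrC s) (ltW t1) andbT.
    case: (pi * s <= t)%R; last by rewrite !(mul0r, mulr0).
    rewrite (gtr0_norm t0) CE le_eqVlt; apply/orP; left; apply/eqP.
    move: (pi : R) pi0 => q q0.
    by field; rewrite ?gt_eqF.
  rewrite ge0_integralZl_EFin; last 4 first.
  + exact: measurableT.
  + by move=> t _; rewrite lee_fin mulr_ge0// invr_ge0 exprn_ge0.
  + by mfun.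
  + exact: C0.
  apply: (@le_trans _ _ (C%:E * ((2 * (pi * s) ^+ 2)^-1)%:E)).
    by rewrite lee_wpmul2l// integral_rcube_le.
  rewrite -EFinM lee_fin mul1r CE.
  have -> : (361 * (pi : R) ^+ 3 * (2 * (pi * s) ^+ 2)^-1 = 361 / 2 * (pi * (s ^+ 2)^-1) :> R)%R.
    by move: (pi : R) pi0 => q q0; field; rewrite !gt_eqF.
  have : (0 <= pi * (s ^+ 2)^-1 :> R)%R by rewrite mulr_ge0 ?invr_ge0 ?sqr_ge0// ltW.
  lra.
apply: le_trans iB; apply: nn_le_integral => t _; first by rewrite lee_fin sqr_ge0.
have := vB t; case: (boolP (0 < t < pi)%R) => [_|ht]; first by rewrite mul1r.
rewrite (_ : oscillation f K x t = 0%R) ?expr0n ?mul0r//.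
rewrite /oscillation; under eq_Rintegral => s _.
  rewrite (_ : K t s = 0%R) ?mulr0; last first.
    by apply/eqP; rewrite -normr_le0; have [_ /(_ t s)] := aK; rewrite (negbTE ht) mulr0.
  over.
by rewrite Rintegral_cst ?mul0r.
Qed.

Lemma measurable_oscillation f K : measurable_fun setT f -> averaging_kernel K ->
  measurable_fun setT (fun p : R * R => oscillation f K p.1 p.2).
Proof.
move=> mf [mK _].
apply: (@measurable_parametric_Rintegral _ _ _ _ _ (leb R)
  (fun q : (R * R) * R => (f (q.1.1 + q.2) - f q.1.1) * K q.1.2 q.2)%R).
apply: measurable_funM; first by mfun.
have mg : measurable_fun setT (fun q : (R * R) * R => (q.1.2, q.2)).
  by mfun.
exact: (measurableT_comp mK mg).
Qed.

Lemma measurable_average f K : measurable_fun setT f -> averaging_kernel K ->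
  measurable_fun setT (fun p : R * R => average f K p.1 p.2).
Proof.
move=> mf [mK _].
apply: (@measurable_parametric_Rintegral _ _ _ _ _ (leb R)
  (fun q : (R * R) * R => f (q.1.1 + q.2) * K q.1.2 q.2)%R).
apply: measurable_funM; first by mfun.
have mg : measurable_fun setT (fun q : (R * R) * R => (q.1.2, q.2)).
  by mfun.
exact: (measurableT_comp mK mg).
Qed.

Lemma oscillation_L2_le f K : L2loc f -> averaging_kernel K ->
  \int[leb2 R]_p (oscillation f K p.1 p.2 ^+ 2)%:E <= (181 * pi)%:E * gagliardo f.
Proof.
move=> lf aK; have [mf _] := lf; have pi0 := @pi_gt0 R.
rewrite leb2_tonelli1; last 2 first.
- by have mo := measurable_oscillation mf aK; mfun.
- by move=> p; rewrite lee_fin sqr_ge0.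
rewrite /gagliardo leb2_tonelli1; last 2 first.
- by mfun.
- by move=> p; rewrite lee_fin mulr_ge0 ?sqr_ge0// divr_ge0// sqr_ge0.
rewrite -ge0_integralZl_EFin; last 4 first.
- exact: measurableT.
- by move=> x _; apply: integral_ge0 => s _; rewrite lee_fin mulr_ge0 ?sqr_ge0// divr_ge0// sqr_ge0.
- apply: (@measurable_parametric_integral _ _ _ _ _ (leb R) (fun q : R * R =>
    (0 < q.2 <= 1)%R%:R / q.2 ^+ 2 * (f (q.1 + q.2) - f q.1) ^+ 2)%R).
  by mfun.
- by rewrite mulr_ge0// ltW.
apply: nn_le_integral => x _; first by apply: integral_ge0 => t _; rewrite lee_fin sqr_ge0.
rewrite -ge0_integralZl_EFin; last 4 first.
- exact: measurableT.
- by move=> s _; rewrite lee_fin mulr_ge0 ?sqr_ge0// divr_ge0// sqr_ge0.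
- by mfun.
- by rewrite mulr_ge0// ltW.
apply: le_trans (oscillation_sqr_le x lf aK) _.
rewrite le_eqVlt; apply/orP; left; apply/eqP; apply: eq_integral => s _.
by rewrite -EFinM/=; congr (_%:E); rewrite mulrC !mulrA.
Qed.

End averaging_kernels.

(** * The kernels of the extension and integration by parts against them *)

Section extension_kernels.
Context (R : realType).
Implicit Types (t s : R).

(* With K t s = (1 - t / pi) * bells (t / pi) s, the next three kernels are K,
   - dK/ds and dK/dt: averaging f(x + s) against them gives a function of (x, t)
   and its partial derivatives. *)
Definition ext_kernel t s : R := (0 < t < pi)%R%:R * ((1 - t / pi) * bells (t / pi) s).

Definition ext_kernel_x t s : R := (0 < t < pi)%R%:R *
  (- ((1 - t / pi) * (bell' (s / (t / pi)) / (t / pi) / (t / pi)))).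

Definition ext_kernel_t t s : R := (0 < t < pi)%R%:R *
  (- (bells (t / pi) s / pi) - (1 - t / pi) / (pi * (t / pi) ^+ 2) *
    (bell' (s / (t / pi)) * (s / (t / pi)) + bell (s / (t / pi)))).

Lemma measurable_bell' : measurable_fun setT (@bell' R).
Proof. by apply: continuous_measurable_fun; exact: continuous_bell'. Qed.

Lemma measurable_bell : measurable_fun setT (@bell R).
Proof. by apply: continuous_measurable_fun; exact: continuous_bell. Qed.

Lemma bell_arg_out t s : 0 < t -> ~~ (0 <= s <= t) -> ~~ (0 < s / t < 1).
Proof.
move=> t0; apply: contra => /andP[]; rewrite pmulr_lgt0 ?invr_gt0// => s0.
by rewrite ltr_pdivrMr// mul1r => st; rewrite !ltW.
Qed.

Lemma ratio_bounds t : (0 < t < pi)%R -> 0 < t / pi < 1.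
Proof.
move=> /andP[t0 t1]; have pi0 := @pi_gt0 R.
by rewrite divr_gt0//= ltr_pdivrMr// mul1r.
Qed.

Lemma kernel_le t s :
  0 <= ext_kernel t s <= 2 / (t / pi) * (1 - t / pi) * ((0 < t < pi) && (0 <= s <= t / pi))%R%:R.
Proof.
rewrite /ext_kernel; case: (boolP (0 < t < pi)) => [/ratio_bounds/andP[]|_]; last first.
  by rewrite mul0r mulr0 lexx.
move: (t / pi) => u u0 u1; rewrite mul1r/= mulr_ge0 ?bells_ge0 ?subr_ge0 ?(ltW u1)//=.
by rewrite mulrAC mulrC ler_wpM2r ?subr_ge0 ?(ltW u1)// bells_le.
Qed.

Lemma averaging_kernel_kernel : averaging_kernel ext_kernel.
Proof.
split; first by have mb := measurable_bell; rewrite /ext_kernel /bells; mfun.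
move=> t s; have /andP[k0 k1] := kernel_le t s.
rewrite ger0_norm//; apply: le_trans k1 _.
case: (boolP (0 < t < pi)) => [/ratio_bounds/andP[]|_]; last by rewrite !mulr0.
move: (t / pi) => u u0 u1; rewrite ler_wpM2r// ler_pdivlMr ?exprn_gt0//.
have -> : 2 / u * (1 - u) * u ^+ 2 = 2 * (1 - u) * u by field; rewrite gt_eqF.
nra.
Qed.

Lemma averaging_kernel_kernel_x : averaging_kernel ext_kernel_x.
Proof.
split; first by have mb := measurable_bell'; rewrite /ext_kernel_x; mfun.
move=> t s; rewrite /ext_kernel_x; case: (boolP (0 < t < pi)) => [/ratio_bounds/andP[]|_]; last first.
  by rewrite mul0r mulr0 normr0.
move: (t / pi) => u u0 u1; rewrite mul1r/= normrN.
case: (boolP (0 <= s <= u)) => [_|/(bell_arg_out u0) h]; last first.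
  by rewrite bell'_out// !(mul0r, mulr0) normr0.
have := bell'_norm_le (s / u); move: (bell' _) => b; rewrite ler_norml => /andP[b1 b2].
have -> : (1 - u) * (b / u / u) = (1 - u) * b / u ^+ 2 by field; rewrite gt_eqF.
rewrite mulr1 normrM [X in _ * X <= _]ger0_norm ?invr_ge0 ?sqr_ge0//.
rewrite ler_wpM2r ?invr_ge0 ?sqr_ge0// ler_norml; apply/andP; split; nra.
Qed.

Lemma averaging_kernel_kernel_t : averaging_kernel ext_kernel_t.
Proof.
split.
  by have mb := measurable_bell'; have mb2 := measurable_bell; rewrite /ext_kernel_t /bells; mfun.
move=> t s; rewrite /ext_kernel_t; case: (boolP (0 < t < pi)) => [/ratio_bounds/andP[]|_]; last first.
  by rewrite mul0r mulr0 normr0.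
have pi2 := pi_ge2 R; move: (pi : R) pi2 => q q2.
move: (t / q) => u u0 u1; rewrite mul1r/=.
case: (boolP (0 <= s <= u)) => [/andP[s0 su]|/(bell_arg_out u0) h]; last first.
  by rewrite /bells bell_out// bell'_out// !(mul0r, mulr0) addr0 mulr0 subr0 oppr0 normr0.
have q0 : 0 < q by lra.
have v0 : 0 <= s / u by rewrite divr_ge0// ltW.
have v1 : s / u <= 1 by rewrite ler_pdivrMr// mul1r.
rewrite mulr1 /bells; have := bell'_norm_le (s / u); have := bell_ge0 (s / u).
have := bell_le2 (s / u); move: (s / u) v0 v1 => v v0 v1.
move: (bell v) (bell' v) => b b' b2 b0 b15.
have -> : - (b / u / q) - (1 - u) / (q * u ^+ 2) * (b' * v + b) =
    - ((b * u + (1 - u) * (b' * v + b)) / q) / u ^+ 2.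
  by field; rewrite !gt_eqF.
rewrite normrM [X in _ * X <= _]ger0_norm ?invr_ge0 ?sqr_ge0//.
rewrite ler_wpM2r ?invr_ge0 ?sqr_ge0// normrN normrM [X in _ * X <= _]ger0_norm ?invr_ge0 ?(ltW q0)//.
(* Origin of the constant 19: b u + (1 - u) (b' v + b) is bounded by 2 + 15 + 2, and dividing by pi
   >= 2 only decreases it. *)
rewrite ler_pdivrMr//; apply: (@le_trans _ _ 19); last by lra.
have b'v : `|b' * v| <= 15.
  by rewrite normrM (ger0_norm v0); have := normr_ge0 b'; nra.
move: (b' * v) b'v => w; rewrite ler_norml => /andP[w1 w2].
rewrite ler_norml; apply/andP; split; nra.
Qed.

Lemma integral_derive0 (F g : R -> R) (a b : R) : a <= b ->
  (forall x, a <= x <= b -> is_derive x 1 F (g x)) ->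
  (forall x, a <= x <= b -> {for x, continuous g}) ->
  F a = 0 -> F b = 0 -> (forall x, ~~ (a <= x <= b) -> g x = 0) ->
  (\int[leb R]_x (g x)%:E = 0)%E.
Proof.
move=> ab hd hc Fa Fb g0.
have hc' : {within `[a, b], continuous g}.
  by apply: continuous_in_subspaceT => x /[!inE]/=; rewrite in_itv/=; exact: hc.
transitivity (\int[leb R]_(x in `[a, b]) (g x)%:E)%E; last first.
  by have -> := integral_derive ab hd hc'; rewrite Fa Fb subrr.
rewrite integral_itv_indic; apply: eq_integral => x _; congr EFin.
by case: (boolP (a <= x <= b)) => [_|/g0 ->]; rewrite ?mul1r ?mulr0.
Qed.

Lemma Rintegral_kernel t : 0 < t < pi -> \int[leb R]_s ext_kernel t s = 1 - t / pi.
Proof.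
move=> ht; have /andP[] := ratio_bounds ht; rewrite /ext_kernel ht.
move: (t / pi) => u u0 u1.
have ib := integral_bells 0 u0.
have mb := measurable_bells u.
rewrite /Rintegral; under eq_integral => s _ do rewrite mul1r EFinM.
rewrite ge0_integralZl_EFin; last 4 first.
- exact: measurableT.
- by move=> s _; rewrite lee_fin bells_ge0.
- by mfun.
- by rewrite subr_ge0 ltW.
rewrite (_ : (fun s => _) = (fun s => (bells u (s - 0))%:E)) ?ib ?mule1//.
by apply/funext => s; rewrite subr0.
Qed.

Lemma Rintegral_kernel_x t : 0 < t < pi -> \int[leb R]_s ext_kernel_x t s = 0.
Proof.
move=> ht; have /andP[] := ratio_bounds ht; rewrite /ext_kernel_x ht.
move: (t / pi) => u u0 u1.
suff h : (\int[leb R]_s (true%:R * - ((1 - u) * (bell' (s / u) / u / u)))%:E = 0)%E.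
  by rewrite /Rintegral h.
pose g s := true%:R * - ((1 - u) * (bell' (s / u) / u / u)).
have gE : g = fun s => - (1 - u) * (bell' ((s - 0) / u) / u / u).
  by apply/funext => s; rewrite /g mul1r subr0 mulNr.
apply: (@integral_derive0 (fun s => - (1 - u) * bells u (s - 0)) g 0 u (ltW u0)).
- move=> s _; rewrite gE; apply: is_derive_mull_cst; exact: is_derive_bells.
- move=> s _; rewrite gE; apply: cvgM; [exact: cvg_cst|exact: continuous_bells'].
- by rewrite subrr /bells mul0r bell_out ?ltxx// mul0r mulr0.
- by rewrite subr0 /bells divff ?gt_eqF// bell_out ?ltxx ?andbF// mul0r mulr0.
- by move=> s /(bell_arg_out u0) h; rewrite /g bell'_out// !mul0r !mulr0 oppr0 mulr0.
Qed.

(** The value is the derivative of the mass 1 - t / pi, obtained without differentiating under the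
    integral. Adding c times [ext_kernel] cancels the term in which 1 - t / pi was differentiated;
    what remains is the s-derivative of A s bell(s / u), which has integral 0. *)
Lemma Rintegral_kernel_t t : 0 < t < pi -> \int[leb R]_s ext_kernel_t t s = - pi^-1.
Proof.
move=> ht; have ik := integrable_kernel t averaging_kernel_kernel.
have ikt := integrable_kernel t averaging_kernel_kernel_t.
have Ik := Rintegral_kernel ht; have pi0 := @pi_gt0 R.
have /andP[] := ratio_bounds ht.
pose c := (pi * (1 - t / pi))^-1 : R.
have : \int[leb R]_s (ext_kernel_t t s + c * ext_kernel t s) = 0.
  pose u := t / pi; pose A := - ((1 - u) / (pi * u ^+ 2)).
  have /andP[] := ratio_bounds ht; rewrite -/u => u0 u1.
  pose g s := A * (s * (bell' ((s - 0) / u) / u) + bell ((s - 0) / u)).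
  rewrite (_ : (fun s => _) = g); last first.
    apply/funext => s; rewrite /g /ext_kernel_t /ext_kernel ht /c /A -/u /bells !subr0 !mul1r.
    move: (pi : R) pi0 => q q0; move: (bell' _) (bell _) => b' b.
    by field; rewrite !gt_eqF ?subr_gt0.
  suff h : (\int[leb R]_s (g s)%:E = 0)%E by rewrite /Rintegral h.
  apply: (@integral_derive0 (fun s => A * (s * bell ((s - 0) / u))) g 0 u (ltW u0)).
  - move=> s _; apply: is_derive_mull_cst.
    have h1 := @is_derive_affine_comp _ _ _ u 0 s (@is_derive_bell R).
    have h2 := @is_derive_id R R s 1.
    apply: (is_derive_eq (is_deriveM h2 h1)).
    by rewrite /GRing.scale/= mulr1.
  - move=> s _; rewrite /g; apply: cvgM; first exact: cvg_cst.
    have ca : {for s, continuous (fun s : R => (s - 0) / u)}.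
      by apply: cvgM; [apply: cvgB; [exact: cvg_id|exact: cvg_cst]|exact: cvg_cst].
    apply: cvgD; first (apply: cvgM; first exact: cvg_id).
      apply: cvgM; last exact: cvg_cst.
      exact: (@continuous_comp _ _ _ _ (@bell' R) s ca (@continuous_bell' R _)).
    exact: (@continuous_comp _ _ _ _ (@bell R) s ca (@continuous_bell R _)).
  - by rewrite mul0r mulr0.
  - by rewrite subr0 divff ?gt_eqF// bell_out ?ltxx ?andbF// mulr0 mulr0.
  - move=> s /(bell_arg_out u0) h; rewrite /g !subr0 bell'_out// bell_out//.
    by rewrite !mul0r !mulr0 addr0 mulr0.
rewrite RintegralD//; last first.
  by have := integrableZl measurableT c ik; apply: eq_integrable.
rewrite RintegralZl// Ik /c; move: (\int[leb R]_s ext_kernel_t t s) => I.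
have pin0 : pi != 0 :> R by rewrite gt_eqF.
move: (t / pi) => u h u0 u1; move: h.
by rewrite invfM mulfVK ?gt_eqF ?subr_gt0// => /eqP; rewrite addr_eq0 => /eqP.
Qed.

Lemma is_derive_kernel_x (t z x : R) :
  is_derive x 1 (fun x => ext_kernel t (z - x)) (ext_kernel_x t (z - x)).
Proof.
have h1 : is_derive (z - x) 1 (bells (t / pi)) (bell' ((z - x) / (t / pi)) / (t / pi) / (t / pi)).
  have := is_derive_bells (t / pi) 0 (z - x); rewrite subr0.
  by rewrite (_ : (fun z => _) = bells (t / pi))//; apply/funext => y; rewrite subr0.
have h2 : is_derive x 1 (fun x => z - x) (- 1).
  by apply: (is_derive_eq (is_deriveB (is_derive_cst z x 1) (is_derive_id x 1))); rewrite sub0r.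
have h3 := @is_derive1_comp _ (bells (t / pi)) (fun x : R => z - x) _ _ _ h1 h2.
apply: (is_derive_eq (is_derive_mull_cst _ (is_derive_mull_cst (1 - t / pi) h3))).
by rewrite /ext_kernel_x !mulrN mulr1.
Qed.

Lemma is_derive_kernel_t (s t : R) : 0 < t ->
  is_derive t 1 (fun t => (1 - t / pi) * bells (t / pi) s)
    (- (bells (t / pi) s / pi) - (1 - t / pi) / (pi * (t / pi) ^+ 2) *
    (bell' (s / (t / pi)) * (s / (t / pi)) + bell (s / (t / pi)))).
Proof.
have pi0 := @pi_gt0 R; move: (pi : R) pi0 => q q0 t0.
have u0 : 0 < t / q by rewrite divr_gt0.
have u0' : t / q != 0 by rewrite gt_eqF.
have hu : is_derive t 1 (fun t => t / q) q^-1.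
  by apply: (is_derive_eq (is_derive_mulr_cst q^-1 (is_derive_id t 1))); rewrite mul1r.
have hi : is_derive t 1 (fun t => (t / q)^-1) (- (t / q) ^- 2 * q^-1).
  by apply: (is_derive_eq (@is_deriveV _ (fun t : R => t / q) t _ _ u0' hu)).
have hs : is_derive t 1 (fun t => s / (t / q)) (s * (- (t / q) ^- 2 * q^-1)).
  exact: is_derive_mull_cst.
have hb := @is_derive1_comp _ (@bell R) (fun t : R => s / (t / q)) _ _ _ (is_derive_bell (s / (t / q))) hs.
have h1 : is_derive t 1 (fun t => 1 - t / q) (- q^-1).
  have h := @is_deriveB _ _ _ _ (fun t : R => t / q) t 1 _ _ (is_derive_cst (1 : R) t 1) hu.
  by apply: (is_derive_eq h); rewrite sub0r.
have hbi := @is_deriveM _ _ _ (fun t : R => (t / q)^-1) t 1 _ _ hb hi.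
have hm := @is_deriveM _ _ (fun t : R => 1 - t / q) _ t 1 _ _ h1 hbi.
apply: (is_derive_eq hm).
rewrite /GRing.scale/= /bells.
change ((@bell R \o (fun t : R => s / (t / q))) * (fun t : R => (t / q)^-1)) with
  (fun t : R => bell (s / (t / q)) * (t / q)^-1).
cbv beta; move: (bell' _) (bell _) => b' b.
by field; rewrite !gt_eqF.
Qed.

Lemma integral_parts0 (F g h : R -> R) (a b : R) : a <= b ->
  (forall x, a <= x <= b -> is_derive x 1 F (g x + h x)) ->
  (forall x, a <= x <= b -> {for x, continuous g}) ->
  (forall x, a <= x <= b -> {for x, continuous h}) -> F a = F b ->
  (\int[leb R]_(x in `[a, b]) (g x)%:E = - \int[leb R]_(x in `[a, b]) (h x)%:E)%E.
Proof.
move=> ab hd cg ch Fab.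
have w (k : R -> R) : (forall x, a <= x <= b -> {for x, continuous k}) ->
    {within `[a, b], continuous k}.
  by move=> ck; apply: continuous_in_subspaceT => x /[!inE]/=; rewrite in_itv/=; exact: ck.
have ig := continuous_compact_integrable (@segment_compact R a b) (w _ cg).
have ih := continuous_compact_integrable (@segment_compact R a b) (w _ ch).
have cc : {within `[a, b], continuous (fun x => g x + h x)}.
  by apply: w => x hx; exact: cvgD (cg x hx) (ch x hx).
have := integral_derive ab hd cc; rewrite Fab subrr; under eq_integral do rewrite EFinD.
rewrite integralD//.
have f1 : (\int[leb R]_(x in `[a, b]) (g x)%:E)%E \is a fin_num by apply: integrable_fin_num.
have f2 : (\int[leb R]_(x in `[a, b]) (h x)%:E)%E \is a fin_num by apply: integrable_fin_num.
move=> /esym/eqP; rewrite eq_sym -[eqbLHS]/(\int[leb R]_(x in `[a, b]) (g x)%:E +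
  \int[leb R]_(x in `[a, b]) (h x)%:E)%E.
rewrite -(fineK f1) -(fineK f2) -EFinD eqe addr_eq0 => /eqP ->.
by rewrite EFinN.
Qed.

Lemma kernel_arg_out s t : ~~ (0 < s < 1) -> 0 < t < pi -> ~~ (0 < s / (t / pi) < 1).
Proof.
move=> hs /ratio_bounds/andP[]; move: (t / pi) => u u0 u1.
apply: contra hs => /andP[]; rewrite pmulr_lgt0 ?invr_gt0// => ->/=.
by rewrite ltr_pdivrMr// mul1r => /lt_trans; exact.
Qed.

(** For fixed s > 0 the kernels vanish when t < pi s, so the integral runs over a compact interval
    away from the singularity t = 0. *)
Lemma integral_kernel_itv (h : R -> R) s : measurable_fun setT h ->
  (forall t, 0 < t < pi * s -> h t = 0) -> 0 < s ->
  (\int[leb R]_t ((0 < t < pi)%R%:R * h t)%:E = \int[leb R]_(t in `[(pi * s)%R, pi]) (h t)%:E)%E.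
Proof.
move=> mh h0 s0; have pi0 := @pi_gt0 R.
rewrite -integral_itv_bndo_bndc; last by apply: measurable_funTS; mfun.
rewrite [RHS]integral_mkcond; apply: eq_integral => t _.
rewrite patchE mem_setE in_itv/=; case: (boolP (pi * s <= t < pi)) => [/andP[t1 t2]|ht].
  by rewrite t2 (lt_le_trans _ t1) ?mulr_gt0// mul1r.
case: (boolP (0 < t < pi)) => [/andP[t1 t2]|_]; last by rewrite mul0r.
by rewrite h0 ?mulr0// t1/= ltNge; apply: contra ht => ->.
Qed.

(** Only 0 < s < 1 matters, since otherwise s exceeds every t / pi or is not positive and the
    kernels vanish. On [pi s, pi] both boundary terms are 0: at t = pi s because a bell vanishes at
    1, at t = pi because of the factor 1 - t / pi. *)
Lemma kernel_t_parts s (b b' : R -> R) :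
  (forall t : R, is_derive t 1 b (b' t)) -> continuous b' ->
  (\int[leb R]_t (ext_kernel t s * b' t)%:E = - \int[leb R]_t (ext_kernel_t t s * b t)%:E)%E.
Proof.
move=> db cb'; have pi0 := @pi_gt0 R.
have cb : continuous b by move=> t; exact: is_derive_continuous (db t).
case: (boolP (0 < s < 1)) => [/andP[s0 s1]|hs]; last first.
  rewrite !integral0_eq ?oppe0// => t _; rewrite /ext_kernel/ext_kernel_t/bells.
    case: (boolP (0 < t < pi)) => [/(kernel_arg_out hs) h|_]; last by rewrite !mul0r.
    by rewrite bell_out// bell'_out// !(mul0r, mulr0, addr0, oppr0).
  case: (boolP (0 < t < pi)) => [/(kernel_arg_out hs) h|_]; last by rewrite !mul0r.
  by rewrite bell_out// !(mul0r, mulr0).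
pose k0 t := (1 - t / pi) * bells (t / pi) s.
pose kt0 t := - (bells (t / pi) s / pi) - (1 - t / pi) / (pi * (t / pi) ^+ 2) *
    (bell' (s / (t / pi)) * (s / (t / pi)) + bell (s / (t / pi))).
have dk t : 0 < t -> is_derive t 1 k0 (kt0 t) by exact: is_derive_kernel_t.
have out t : 0 < t < pi * s -> ~~ (0 < s / (t / pi) < 1).
  move=> /andP[t0 t1]; rewrite negb_and -!leNgt; apply/orP; right.
  by rewrite ler_pdivlMr ?divr_gt0// mul1r ler_pdivrMr// mulrC ltW.
have k00 t : 0 < t < pi * s -> k0 t * b' t = 0.
  by move=> /out h; rewrite /k0 /bells bell_out// !(mul0r, mulr0).
have kt00 t : 0 < t < pi * s -> kt0 t * b t = 0.
  by move=> /out h; rewrite /kt0 /bells bell_out// bell'_out// !(mul0r, mulr0, addr0, oppr0).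
have mb := continuous_measurable_fun cb.
have mb' := continuous_measurable_fun cb'.
have m1 := measurable_bell; have m2 := measurable_bell'.
have mk : measurable_fun setT (fun t => k0 t * b' t) by rewrite /k0 /bells; mfun.
have mkt : measurable_fun setT (fun t => kt0 t * b t) by rewrite /kt0 /bells; mfun.
transitivity (\int[leb R]_t ((0 < t < pi)%R%:R * (k0 t * b' t))%:E)%E.
  by apply: eq_integral => t _; congr EFin; rewrite /ext_kernel -[LHS]mulrA.
rewrite (integral_kernel_itv mk k00 s0).
transitivity (- \int[leb R]_t ((0 < t < pi)%R%:R * (kt0 t * b t))%:E)%E; last first.
  by congr (- _)%E; apply: eq_integral => t _; congr EFin; rewrite /ext_kernel_t -[RHS]mulrA.
rewrite (integral_kernel_itv mkt kt00 s0).
have psp : pi * s <= pi by rewrite ger_pMr// ltW.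
have pos t : pi * s <= t <= pi -> 0 < t.
  by move=> /andP[/(lt_le_trans _) h _]; apply: h; rewrite mulr_gt0.
have ck0 t : 0 < t -> {for t, continuous k0}.
  by move=> /dk; exact: is_derive_continuous.
have ckt0 t : 0 < t -> {for t, continuous kt0}.
  move=> t0; have u0 : 0 < t / pi by rewrite divr_gt0.
  have c1 : {for t, continuous (fun t : R => t / pi)} by apply: cvgM; [exact: cvg_id|exact: cvg_cst].
  have c2 : {for t, continuous (fun t : R => s / (t / pi))}.
    by apply: cvgM; [exact: cvg_cst|apply: cvgV => //; rewrite gt_eqF].
  have c3 := @continuous_comp _ _ _ _ (@bell R) t c2 (@continuous_bell R _).
  have c4 := @continuous_comp _ _ _ _ (@bell' R) t c2 (@continuous_bell' R _).
  have c5 : {for t, continuous (fun t : R => (t / pi)^-1)} by apply: cvgV => //; rewrite gt_eqF.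
  rewrite /kt0 /bells; apply: cvgB.
    apply: cvgN; apply: cvgM; last exact: cvg_cst.
    exact: cvgM c3 c5.
  apply: cvgM; last exact: cvgD (cvgM c4 c2) c3.
  apply: cvgM; first by apply: cvgB c1; exact: cvg_cst.
  apply: cvgV; first by rewrite mulf_neq0 ?gt_eqF// exprn_gt0.
  apply: cvgM; first exact: cvg_cst.
  exact: (@continuous_comp _ _ _ _ (fun z : R => z ^+ 2) t c1 (@exprn_continuous _ 2 _)).
have c1 t : 0 < t -> {for t, continuous (fun t => k0 t * b' t)}.
  by move=> t0; exact: cvgM (ck0 t t0) (cb' t).
have c2 t : 0 < t -> {for t, continuous (fun t => kt0 t * b t)}.
  by move=> t0; exact: cvgM (ckt0 t t0) (cb t).
apply: (@integral_parts0 (fun t => k0 t * b t) (fun t => k0 t * b' t) (fun t => kt0 t * b t) _ _ psp).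
- move=> t /pos t0; apply: (is_derive_eq (is_deriveM (dk t t0) (db t))).
  by rewrite /GRing.scale/= mulrC [X in _ + X]mulrC; ring.
- by move=> t /pos; exact: c1.
- by move=> t /pos; exact: c2.
rewrite {2}/k0 divff ?gt_eqF// subrr !mul0r.
suff -> : k0 (pi * s) = 0 by rewrite mul0r.
rewrite /k0 /bells mulrAC divff ?gt_eqF// mul1r divff ?gt_eqF// bell_out ?mul0r ?mulr0//.
by rewrite ltxx andbF.
Qed.

Lemma kernel_x_parts (t z : R) (b b' : R -> R) :
  (forall x : R, is_derive x 1 b (b' x)) -> continuous b' ->
  (\int[leb R]_x (ext_kernel t (z - x) * b' x)%:E =
   - \int[leb R]_x (ext_kernel_x t (z - x) * b x)%:E)%E.
Proof.
move=> db cb'; have pi0 := @pi_gt0 R.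
have cb : continuous b by move=> x; exact: is_derive_continuous (db x).
have [ht|/negbTE ht] := boolP (0 < t < pi); last first.
  by rewrite !integral0_eq ?oppe0// => x _; rewrite /ext_kernel_x /ext_kernel ht !mul0r.
have /andP[u0 u1] := ratio_bounds ht.
have u10 : ~~ (0 < 1 / (t / pi) < 1).
  by rewrite negb_and -!leNgt ler_pdivlMr// !mul1r (ltW u1) orbT.
have k0 : ext_kernel t 0 = 0 by rewrite /ext_kernel /bells mul0r bell_out ?ltxx// mul0r !mulr0.
have k1 : ext_kernel t 1 = 0 by rewrite /ext_kernel /bells bell_out// mul0r !mulr0.
(* Since t / pi < 1, the kernel as a function of x lives on [z - 1, z]; the two endpoints correspond
   to the arguments 1 and 0, where [ext_kernel] vanishes. *)
have itv (K : R -> R -> R) (h : R -> R) : averaging_kernel K ->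
    (\int[leb R]_x (K t (z - x) * h x)%:E =
     \int[leb R]_(x in `[(z - 1)%R, z]) (K t (z - x) * h x)%:E)%E.
  move=> aK; rewrite integral_itv_indic; apply: eq_integral => x _; congr EFin.
  case: (boolP (z - 1 <= x <= z)) => hx; first by rewrite mul1r.
  rewrite (_ : K t (z - x) = 0) ?mul0r ?mulr0//.
  apply/eqP; rewrite -normr_le0; have [_ /(_ t (z - x))] := aK.
  rewrite (_ : 0 <= z - x <= t / pi = false) ?andbF ?mulr0//.
  apply/negP => /andP[h1 h2]; case/negP: hx.
  by rewrite lerBlDr -lerBlDl (le_trans h2 (ltW u1))/= -subr_ge0.
rewrite (itv _ _ averaging_kernel_kernel) (itv _ _ averaging_kernel_kernel_x).
have ck : continuous (fun x => ext_kernel t (z - x)).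
  by move=> x; exact: is_derive_continuous (is_derive_kernel_x t z x).
have ckx : continuous (fun x => ext_kernel_x t (z - x)).
  move=> x; rewrite /ext_kernel_x; apply: cvgM; first exact: cvg_cst.
  apply: cvgN; apply: cvgM; first exact: cvg_cst.
  do 2 (apply: cvgM; last exact: cvg_cst).
  have ca : {for x, continuous (fun x : R => (z - x) / (t / pi))}.
    by apply: cvgM; [apply: cvgB; [exact: cvg_cst|exact: cvg_id]|exact: cvg_cst].
  exact: (@continuous_comp _ _ _ _ (@bell' R) x ca (@continuous_bell' R _)).
apply: (@integral_parts0 (fun x => ext_kernel t (z - x) * b x)
  (fun x => ext_kernel t (z - x) * b' x) (fun x => ext_kernel_x t (z - x) * b x)).
- by rewrite gerBl.
- move=> x _; apply: (is_derive_eq (is_deriveM (is_derive_kernel_x t z x) (db x))).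
  by rewrite /GRing.scale/= [X in _ + X]mulrC.
- by move=> x _; exact: cvgM (ck x) (cb' x).
- by move=> x _; exact: cvgM (ckx x) (cb x).
- by rewrite subKr k1 subrr k0 !mul0r.
Qed.

End extension_kernels.

(** * Fubini and changes of variables for signed integrands *)

Section signed_fubini.
Local Open Scope ereal_scope.
Context (R : realType).

Lemma integrableN_integral d (T : measurableType d) (mu : {measure set T -> \bar R})
    (f : T -> \bar R) : mu.-integrable setT f ->
  \int[mu]_x - f x = - \int[mu]_x f x.
Proof. by move=> fi; rewrite integralN// integrable_add_def. Qed.

Lemma leb2_fubini1 (f : R * R -> \bar R) : (leb2 R).-integrable setT f ->
  \int[leb2 R]_p f p = \int[leb R]_x \int[leb R]_y f (x, y).
Proof. by move=> fi; rewrite -(@integral12_prod_meas1 _ _ _ _ _ (leb R) (leb R) f fi). Qed.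

Lemma leb2_fubini2 (f : R * R -> \bar R) : (leb2 R).-integrable setT f ->
  \int[leb2 R]_p f p = \int[leb R]_y \int[leb R]_x f (x, y).
Proof. by move=> fi; rewrite -(@integral21_prod_meas1 _ _ _ _ _ (leb R) (leb R) f fi). Qed.

Lemma ge0_leb2_shift (c : R) (g : R * R -> \bar R) : measurable_fun setT g ->
  (forall p, 0 <= g p) -> \int[leb2 R]_p g (p.1, (p.2 + c)%R) = \int[leb2 R]_p g p.
Proof.
move=> mg g0; have ms : measurable_fun setT (fun p : R * R => (p.1, (p.2 + c)%R)) by mfun.
rewrite (@leb2_tonelli1 R (fun p => g (p.1, (p.2 + c)%R)) (measurableT_comp mg ms) (fun p => g0 _)).
rewrite (leb2_tonelli1 mg g0).
apply: eq_integral => x _ /=.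
rewrite (@ge0_integral_shift R c (fun y => g (x, y)))//.
exact: (measurableT_comp mg (@pair1_measurable _ _ _ _ x)).
Qed.

Lemma ge0_leb2_opp (g : R * R -> \bar R) : measurable_fun setT g ->
  (forall p, 0 <= g p) -> \int[leb2 R]_p g (p.1, (- p.2)%R) = \int[leb2 R]_p g p.
Proof.
move=> mg g0; have ms : measurable_fun setT (fun p : R * R => (p.1, (- p.2)%R)) by mfun.
rewrite (@leb2_tonelli1 R (fun p => g (p.1, (- p.2)%R)) (measurableT_comp mg ms) (fun p => g0 _)).
rewrite (leb2_tonelli1 mg g0).
apply: eq_integral => x _ /=.
rewrite (@ge0_integral_opp R (fun y => g (x, y)))//.
exact: (measurableT_comp mg (@pair1_measurable _ _ _ _ x)).
Qed.

Lemma leb2_shift (c : R) (g : R * R -> R) : measurable_fun setT g ->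
  \int[leb2 R]_p (g (p.1, (p.2 + c)%R))%:E = \int[leb2 R]_p (g p)%:E.
Proof.
move=> mg; rewrite [LHS]integralE [RHS]integralE.
have mp : measurable_fun setT (fun p => (g p)%:E) by mfun.
congr (_ - _).
- rewrite -[RHS](ge0_leb2_shift c)//; last exact: measurable_funepos.
  by apply: eq_integral => x _; rewrite !funeposE.
- rewrite -[RHS](ge0_leb2_shift c)//; last exact: measurable_funeneg.
  by apply: eq_integral => x _; rewrite !funenegE.
Qed.

Lemma leb2_opp (g : R * R -> R) : measurable_fun setT g ->
  \int[leb2 R]_p (g (p.1, (- p.2)%R))%:E = \int[leb2 R]_p (g p)%:E.
Proof.
move=> mg; rewrite [LHS]integralE [RHS]integralE.
have mp : measurable_fun setT (fun p => (g p)%:E) by mfun.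
congr (_ - _).
- rewrite -[RHS]ge0_leb2_opp//; last exact: measurable_funepos.
  by apply: eq_integral => x _; rewrite !funeposE.
- rewrite -[RHS]ge0_leb2_opp//; last exact: measurable_funeneg.
  by apply: eq_integral => x _; rewrite !funenegE.
Qed.

Lemma integrable_fubini_G d1 d2 (T1 : measurableType d1) (T2 : measurableType d2)
    (m1 : {sigma_finite_measure set T1 -> \bar R})
    (m2 : {sigma_finite_measure set T2 -> \bar R}) (f : T1 * T2 -> \bar R) :
  (m1 \x m2).-integrable setT f -> m2.-integrable setT (fun y => \int[m1]_x f (x, y)).
Proof.
move=> fi; have mf := measurable_int _ fi.
apply/integrableP; split; first exact: measurable_fubini_G fi.
apply: le_lt_trans ((integrable21ltyP m1 m2 mf).1 fi).
apply: nn_le_integral => y _; first exact: abse_ge0.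
apply: (@le_abse_integral _ _ _ m1 setT (fun x => f (x, y))) => //.
exact: (measurableT_comp mf (@pair2_measurable _ _ _ _ y)).
Qed.

Lemma fubini_parts (g h : R * R -> R) :
  (leb2 R).-integrable setT (fun p => (g p)%:E) ->
  (leb2 R).-integrable setT (fun p => (h p)%:E) ->
  (forall y, \int[leb R]_x (g (x, y))%:E = - \int[leb R]_x (h (x, y))%:E) ->
  \int[leb2 R]_p (g p)%:E = - \int[leb2 R]_p (h p)%:E.
Proof.
move=> ig ih gh; rewrite (leb2_fubini2 ig) (leb2_fubini2 ih).
rewrite -(integrableN_integral (@integrable_fubini_G _ _ _ _ (leb R) (leb R) _ ih)).
by apply: eq_integral => y _; rewrite gh.
Qed.

(** Fubini moves the integral in s outside, so that for fixed x and s the identity in t can be used.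
    The sections are integrable only for almost every s, hence the comparison almost everywhere. *)
Lemma swap_parts (T1 T2 : (R * R) * R -> R) :
  measurable_fun setT T1 -> measurable_fun setT T2 ->
  \int[leb2 R]_q \int[leb R]_s (`|T1 (q, s)|%R)%:E < +oo ->
  \int[leb2 R]_q \int[leb R]_s (`|T2 (q, s)|%R)%:E < +oo ->
  (forall x s, \int[leb R]_t (T1 ((x, t), s))%:E = - \int[leb R]_t (T2 ((x, t), s))%:E) ->
  \int[leb2 R]_q \int[leb R]_s (T1 (q, s))%:E = - \int[leb2 R]_q \int[leb R]_s (T2 (q, s))%:E.
Proof.
move=> m1 m2 f1 f2 T12.
have i1 : (@leb2_sf R \x leb R).-integrable setT (fun p => (T1 p)%:E).
  by apply/integrable12ltyP; [mfun|exact: f1].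
have i2 : (@leb2_sf R \x leb R).-integrable setT (fun p => (T2 p)%:E).
  by apply/integrable12ltyP; [mfun|exact: f2].
have F1 := Fubini i1; have F2 := Fubini i2.
have iG := integrable_fubini_G i2.
rewrite [LHS]F1 [X in - X]F2 -(integrableN_integral iG).
apply: ae_eq_integral => //.
- exact: measurable_fubini_G i1.
- by apply: measurableT_comp => //; exact: measurable_fubini_G i2.
- apply: (ae_and _ (ae_integrable2 i1) (ae_integrable2 i2)) => s j1 j2 _ /=.
  rewrite /fubini_G.
  rewrite [LHS](leb2_fubini1 j1) [X in - X](leb2_fubini1 j2).
  rewrite -(integrableN_integral (@integrable_fubini_F _ _ _ _ _ (leb R) (leb R) _ j2)).
  by apply: eq_integral => x _; rewrite T12.
Qed.

End signed_fubini.

(** * Weak derivatives of the extension of one line *)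

Section weak_derivatives.
Local Open Scope ereal_scope.
Context (R : realType).

Lemma integral_average_mulr (f : R -> R) K (x t c : R) : L2loc f -> averaging_kernel K ->
  \int[leb R]_s (f (x + s) * K t s * c)%:E = (average f K x t * c)%:E.
Proof.
move=> lf aK; have [C C0 KC] := averaging_kernel_bound t aK.
have mk := measurable_kernel_section t aK.
have i1 := integrable_average x lf mk C0 KC.
rewrite EFinM /average/Rintegral fineK; last exact: integrable_fin_num.
rewrite -integralZr//.
Qed.

(** The integral in x of |f(x + s)| is at most that of |f| over [-M, M + 1], as s <= 1. The integral
    in s over a length t / pi then cancels the factor (t / pi)^-1, and t runs over a bounded
    interval. *)
Lemma kernel_triple_lty (f : R -> R) (T : (R * R) * R -> R) (C M : R) :
  L2loc f -> (0 <= C)%R ->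
  (forall q s, `|T (q, s)| <= C / (`|q.2| / pi) * ((0 < q.2 < pi)%R && (0 <= s <= q.2 / pi)%R)%:R *
    ((- M <= q.1 <= M)%R%:R * `|f (q.1 + s)|))%R ->
  \int[leb2 R]_q \int[leb R]_s (`|T (q, s)|%R)%:E < +oo.
Proof.
move=> lf C0 TC; have [mf _] := lf; have pi0 := @pi_gt0 R.
pose H (p : (R * R) * R) := (C / (`|p.1.2| / pi) * ((0 < p.1.2 < pi)%R && (0 <= p.2 <= p.1.2 / pi)%R)%:R *
    ((- M <= p.1.1 <= M)%R%:R * `|f (p.1.1 + p.2)|))%R.
have mH : measurable_fun setT H by rewrite /H; mfun.
have C0' t : (0 <= C / (`|t| / pi))%R.
  by apply: divr_ge0 => //; apply: divr_ge0 => //; exact: ltW.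
have H0 p : (0 <= H p)%R.
  by apply: mulr_ge0; apply: mulr_ge0.
pose N := \int[leb R]_(z in `[(- M)%R, (M + 1)%R]) (`|f z|%R)%:E.
have Nfin : N < +oo by have /integrableP[_] := L2loc_integrable lf (- M) (M + 1).
have N0 : 0 <= N by apply: integral_ge0 => z _; rewrite lee_fin.
have NfE : N = (fine N)%:E by rewrite fineK// ge0_fin_numE.
have n0 : (0 <= fine N)%R by rewrite fine_ge0.
apply: (@le_lt_trans _ _ (\int[leb2 R]_q \int[leb R]_s (H (q, s))%:E)).
  apply: nn_le_integral => q _.
    by apply: integral_ge0 => s _; rewrite lee_fin.
  by apply: nn_le_integral => s _; rewrite lee_fin//; exact: TC.
rewrite (@leb2_tonelli2 R (fun q => \int[leb R]_s (H (q, s))%:E)); last 2 first.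
- exact: (@measurable_parametric_integral _ _ _ _ _ (leb R) H).
- by move=> q; apply: integral_ge0 => s _; rewrite lee_fin.
apply: (@le_lt_trans _ _ (\int[leb R]_t ((C * fine N)%:E * ((0 <= t <= pi)%R%:R)%:E))); last first.
  rewrite ge0_integralZl_EFin; last 4 first.
  - exact: measurableT.
  - by move=> s _; rewrite lee_fin.
  - by mfun.
  - exact: mulr_ge0.
  by rewrite integral_indic_itv ?(ltW pi0)// -EFinM ltry.
apply: nn_le_integral => t _.
  by apply: integral_ge0 => x _; apply: integral_ge0 => s _; rewrite lee_fin.
have mHt : measurable_fun setT (fun p : R * R => (H ((p.1, t), p.2))%:E).
  have mg : measurable_fun setT (fun p : R * R => ((p.1, t), p.2)) by mfun.
  by apply/measurable_EFinP; exact: (measurableT_comp mH mg).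
rewrite (@fubini_tonelli _ _ _ _ _ (leb R) (leb R) (fun p => (H ((p.1, t), p.2))%:E))//=; last first.
  by move=> p; rewrite lee_fin.
have [ht|ht] := boolP (0 < t < pi)%R; last first.
  rewrite integral0_eq; first by rewrite -EFinM lee_fin; do 2 (apply: mulr_ge0 => //).
  by move=> s _; rewrite integral0_eq// => x _; rewrite /H/= (negbTE ht)/= mulr0 mul0r.
have /andP[t0 t1] := ht; rewrite (ltW t0) (ltW t1) mule1.
have u0 : (0 < t / pi)%R by rewrite divr_gt0.
apply: (@le_trans _ _ (\int[leb R]_s ((C / (t / pi) * fine N)%:E * ((0 <= s <= t / pi)%R%:R)%:E))); last first.
  rewrite ge0_integralZl_EFin; last 4 first.
  - exact: measurableT.
  - by move=> s _; rewrite lee_fin.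
  - by mfun.
  - by apply: mulr_ge0 => //; apply: divr_ge0 => //; exact: ltW.
  by rewrite integral_indic_itv ?(ltW u0)// -EFinM subr0 mulrAC divfK ?gt_eqF.
apply: nn_le_integral => s _; first by apply: integral_ge0 => x _; rewrite lee_fin.
have [hs|hs] := boolP (0 <= s <= t / pi)%R; last first.
  rewrite mule0 integral0_eq// => x _.
  by rewrite /H/= (negbTE hs) andbF mulr0 mul0r.
have /andP[s0 s1] := hs.
have s1' : (s <= 1)%R by apply: le_trans s1 _; rewrite ler_pdivrMr// mul1r ltW.
rewrite mule1 EFinM -NfE /N integral_itv_indic.
rewrite -(@ge0_integral_shift R s (fun z => ((- M <= z <= M + 1)%R%:R * `|f z|)%:E)); last 2 first.
- by mfun.
- by move=> z; rewrite lee_fin mulr_ge0.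
rewrite -ge0_integralZl_EFin; last 4 first.
- exact: measurableT.
- by move=> x _; rewrite lee_fin mulr_ge0.
- by mfun.
- by apply: divr_ge0 => //; exact: ltW.
apply: nn_le_integral => x _; first by rewrite lee_fin.
rewrite /H/= ht hs -EFinM lee_fin mulr1 (gtr0_norm t0).
rewrite ler_wpM2l//; first by apply: divr_ge0 => //; exact: ltW.
rewrite ler_wpM2r// ler_nat; case: (boolP (- M <= x <= M)%R) => // /andP[h1 h2].
by rewrite (le_trans h1) ?lerDl// lerD.
Qed.

(* |a| <= L |t| turns the t^-2 size of [ext_kernel_t] into t^-1, which makes the
   integrand absolutely integrable in (x, t, s); integration by parts is then
   done in t for fixed x and s. *)
Lemma vertical_parts (f : R -> R) (a a' : R * R -> R) (L M : R) : L2loc f ->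
  measurable_fun setT a -> measurable_fun setT a' ->
  (forall x t : R, is_derive t 1%R (fun t : R => a (x, t)) (a' (x, t))) ->
  (forall x, continuous (fun t => a' (x, t))) -> (0 <= L)%R ->
  (forall q, `|a' q| <= L * (- M <= q.1 <= M)%R%:R)%R ->
  (forall q, `|a q| <= L * `|q.2| * (- M <= q.1 <= M)%R%:R)%R ->
  \int[leb2 R]_q (average f (@ext_kernel R) q.1 q.2 * a' q)%:E =
  - \int[leb2 R]_q (average f (@ext_kernel_t R) q.1 q.2 * a q)%:E.
Proof.
move=> lf ma ma' da ca' L0 bL' bL; have [mf _] := lf; have pi0 := @pi_gt0 R.
have [mk _] := averaging_kernel_kernel R; have [mkt bkt] := averaging_kernel_kernel_t R.
have mq : measurable_fun setT (fun p : (R * R) * R => (p.1.2, p.2)) by mfun.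
under eq_integral do rewrite -(integral_average_mulr _ _ _ lf (averaging_kernel_kernel R)).
under [X in _ = - X]eq_integral do
  rewrite -(integral_average_mulr _ _ _ lf (averaging_kernel_kernel_t R)).
pose T1 (p : (R * R) * R) := (f (p.1.1 + p.2) * ext_kernel p.1.2 p.2 * a' p.1)%R.
pose T2 (p : (R * R) * R) := (f (p.1.1 + p.2) * ext_kernel_t p.1.2 p.2 * a p.1)%R.
apply: (@swap_parts R T1 T2).
- have := measurableT_comp mk mq; rewrite /comp/= => mk'.
  have ma1 : measurable_fun setT (fun p : (R * R) * R => a' p.1) by exact: measurableT_comp ma' _.
  by rewrite /T1; mfun.
- have := measurableT_comp mkt mq; rewrite /comp/= => mk'.
  have ma1 : measurable_fun setT (fun p : (R * R) * R => a p.1) by exact: measurableT_comp ma _.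
  by rewrite /T2; mfun.
- apply: (@kernel_triple_lty f T1 (2 * L)%R M lf); first by rewrite mulr_ge0.
  move=> q s; rewrite /T1/= 2!normrM.
  have k1 : (`|ext_kernel q.2 s| <= 2 / (`|q.2| / pi) * ((0 < q.2 < pi) && (0 <= s <= q.2 / pi))%:R)%R.
    have /andP[k0 k1] := kernel_le q.2 s; rewrite ger0_norm//; apply: le_trans k1 _.
    case: (boolP (0 < q.2 < pi)%R) => [hq|_]; last by rewrite !mulr0.
    have /andP[u0 u1] := ratio_bounds hq; have /andP[q0 _] := hq.
    rewrite (gtr0_norm q0) ler_wpM2r// ger_pMr ?divr_gt0//.
    by rewrite gerBl ltW.
  apply: le_trans (ler_pM _ _ (ler_wpM2l (normr_ge0 (f (q.1 + s)%R)) k1) (bL' q)) _ => //.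
  by rewrite le_eqVlt; apply/orP; left; apply/eqP; ring.
- apply: (@kernel_triple_lty f T2 (19 * pi * L)%R M lf).
    by apply: mulr_ge0 => //; apply: mulr_ge0 => //; exact: ltW.
  move=> q s; rewrite /T2/= 2!normrM.
  apply: le_trans (ler_pM _ _ (ler_wpM2l (normr_ge0 (f (q.1 + s)%R)) (bkt q.2 s)) (bL q)) _ => //.
  case: (boolP (0 < q.2 < pi)%R) => [/andP[q0 _]|_]; last by rewrite /= !(mulr0, mul0r).
  rewrite (gtr0_norm q0) le_eqVlt; apply/orP; left; apply/eqP.
  move: (_ && _)%:R (_ <= _ <= _)%R%:R => i1 i2.
  by move: (pi : R) pi0 (q.2) q0 => p p0 t t0; field; rewrite !gt_eqF.
move=> x s /=.
have h1 : \int[leb R]_t (f (x + s) * ext_kernel t s * a' (x, t))%:E =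
    \int[leb R]_t (ext_kernel t s * (f (x + s) * a' (x, t)))%:E.
  by apply: eq_integral => t _; congr EFin; ring.
have h2 : \int[leb R]_t (f (x + s) * ext_kernel_t t s * a (x, t))%:E =
    \int[leb R]_t (ext_kernel_t t s * (f (x + s) * a (x, t)))%:E.
  by apply: eq_integral => t _; congr EFin; ring.
rewrite h1 h2; apply: (@kernel_t_parts R s (fun t => f (x + s)%R * a (x, t))%R) => t.
by apply: cvgM; [exact: cvg_cst|exact: ca'].
Qed.

(** The substitution z = x + s moves the dependence on x from f, which cannot be differentiated, to
    the kernel. *)
Lemma integral_average_convolution (f : R -> R) K (x t c : R) : L2loc f -> averaging_kernel K ->
  (average f K x t * c)%:E = \int[leb R]_z (f z * K t (z - x) * c)%:E.
Proof.
move=> lf aK; have [mf _] := lf; have mk := measurable_kernel_section t aK.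
rewrite -integral_average_mulr//.
rewrite -(@integral_shift R x (fun z => f z * K t (z - x) * c)%R).
  by apply: eq_integral => s _; rewrite (addrC s) addrAC subrr add0r.
have ms : measurable_fun setT (fun z : R => z - x)%R by mfun.
have := measurableT_comp mk ms; rewrite /comp => ?.
by mfun.
Qed.

Lemma integrable_convolution (f : R -> R) K (b : R -> R) (t L M : R) : L2loc f ->
  averaging_kernel K -> measurable_fun setT b -> (0 <= L)%R ->
  (forall x, `|b x| <= L * (- M <= x <= M)%R%:R)%R ->
  (leb2 R).-integrable setT (fun q => (f q.2 * K t (q.2 - q.1) * b q.1)%:E).
Proof.
move=> lf aK mb L0 bL; have [mf _] := lf; have mk := measurable_kernel_section t aK.
have [C C0 KC] := averaging_kernel_bound t aK.
pose N := \int[leb R]_z ((- M <= z <= M + t / pi)%R%:R * `|f z|%R)%:E.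
have Nfin : N < +oo.
  by rewrite /N -integral_itv_indic; have /integrableP[_] := L2loc_integrable lf (- M) (M + t / pi).
have N0 : 0 <= N by apply: integral_ge0 => z _; rewrite lee_fin mulr_ge0.
have NfE : N = (fine N)%:E by rewrite fineK// ge0_fin_numE.
have n0 : (0 <= fine N)%R by rewrite fine_ge0.
have ms : measurable_fun setT (fun q : R * R => q.2 - q.1)%R by mfun.
have := measurableT_comp mk ms; rewrite /comp => m1.
apply/(integrable12ltyP (leb R) (leb R)); first by mfun.
apply: (@le_lt_trans _ _ (\int[leb R]_x ((C * L * fine N)%:E * (- `|M| <= x <= `|M|)%R%:R%:E))).
  apply: nn_le_integral => x _; first by apply: integral_ge0 => z _; exact: abse_ge0.
  rewrite -EFinM mulrAC EFinM -NfE /N.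
  rewrite -ge0_integralZl_EFin; last 4 first.
  - exact: measurableT.
  - by move=> z _; rewrite lee_fin mulr_ge0.
  - by mfun.
  - by apply: mulr_ge0 => //; apply: mulr_ge0.
  apply: nn_le_integral => z _; first exact: abse_ge0.
  rewrite /= lee_fin 2!normrM.
  apply: le_trans (ler_pM _ _ (ler_wpM2l (normr_ge0 (f z)) (KC (z - x)%R)) (bL x)) _ => //.
  have -> : (`|f z| * (C * (0 <= z - x <= t / pi)%R%:R) * (L * (- M <= x <= M)%R%:R) =
      C * L * ((- M <= x <= M)%R%:R * (0 <= z - x <= t / pi)%R%:R) * `|f z|)%R by ring.
  rewrite [leRHS]mulrA ler_wpM2r// -[leRHS]mulrA ler_wpM2l ?mulr_ge0//.
  rewrite -!natrM ler_nat; case: (boolP (- M <= x <= M)%R) => //= /andP[h1 h2].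
  case: (boolP (0 <= z - x <= t / pi)%R) => //= /andP[h3 h4].
  have -> : (- `|M| <= x <= `|M|)%R.
    by rewrite (le_trans h2 (ler_norm M)) andbT lerNl (le_trans _ (ler_norm M))// lerNl.
  have -> : (- M <= z <= M + t / pi)%R by move: h1 h2 h3 h4; move: (t / pi)%R => u *; lra.
  by [].
rewrite ge0_integralZl_EFin; last 4 first.
- exact: measurableT.
- by move=> x _; rewrite lee_fin.
- by mfun.
- by apply: mulr_ge0 => //; apply: mulr_ge0.
by rewrite integral_indic_itv ?ge0_cp// -EFinM ltry.
Qed.

Lemma average_parts (f b b' : R -> R) (t L M : R) : L2loc f ->
  (forall x : R, is_derive x 1%R b (b' x)) -> continuous b' -> (0 <= L)%R ->
  (forall x, `|b x| <= L * (- M <= x <= M)%R%:R)%R ->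
  (forall x, `|b' x| <= L * (- M <= x <= M)%R%:R)%R ->
  \int[leb R]_x (average f (@ext_kernel R) x t * b' x)%:E =
  - \int[leb R]_x (average f (@ext_kernel_x R) x t * b x)%:E.
Proof.
move=> lf db cb' L0 bL bL'.
have cb : continuous b by move=> x; exact: is_derive_continuous (db x).
have mb := continuous_measurable_fun cb; have mb' := continuous_measurable_fun cb'.
have ak := averaging_kernel_kernel R; have akx := averaging_kernel_kernel_x R.
have i1 := integrable_convolution t lf ak mb' L0 bL'.
have i2 := integrable_convolution t lf akx mb L0 bL.
under eq_integral do rewrite (integral_average_convolution _ _ _ lf ak).
under [X in _ = - X]eq_integral do rewrite (integral_average_convolution _ _ _ lf akx).
rewrite -[LHS](leb2_fubini1 i1) -[X in - X](leb2_fubini1 i2).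
apply: fubini_parts => // z /=.
have h1 : \int[leb R]_x (f z * ext_kernel t (z - x) * b' x)%:E =
    \int[leb R]_x (ext_kernel t (z - x) * (f z * b' x))%:E.
  by apply: eq_integral => x _; congr EFin; ring.
have h2 : \int[leb R]_x (f z * ext_kernel_x t (z - x) * b x)%:E =
    \int[leb R]_x (ext_kernel_x t (z - x) * (f z * b x))%:E.
  by apply: eq_integral => x _; congr EFin; ring.
rewrite h1 h2; apply: (@kernel_x_parts R t z (fun x => f z * b x)%R) => x.
by apply: cvgM; [exact: cvg_cst|exact: cb'].
Qed.

Lemma horizontal_parts (f : R -> R) (a a' : R * R -> R) (L M : R) : L2loc f ->
  (leb2 R).-integrable setT (fun q => (average f (@ext_kernel R) q.1 q.2 * a' q)%:E) ->
  (leb2 R).-integrable setT (fun q => (average f (@ext_kernel_x R) q.1 q.2 * a q)%:E) ->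
  (forall x t : R, is_derive x 1%R (fun x : R => a (x, t)) (a' (x, t))) ->
  (forall t, continuous (fun x => a' (x, t))) -> (0 <= L)%R ->
  (forall q, `|a q| <= L * (- M <= q.1 <= M)%R%:R)%R ->
  (forall q, `|a' q| <= L * (- M <= q.1 <= M)%R%:R)%R ->
  \int[leb2 R]_q (average f (@ext_kernel R) q.1 q.2 * a' q)%:E =
  - \int[leb2 R]_q (average f (@ext_kernel_x R) q.1 q.2 * a q)%:E.
Proof.
move=> lf i1 i2 da ca' L0 bL bL'; apply: fubini_parts => // t.
exact: (@average_parts f (fun x => a (x, t)) (fun x => a' (x, t)) t L M).
Qed.

End weak_derivatives.

(** * Continuous functions and test functions on the plane *)

Section continuous_plane_functions.
Context (R : realType).
Implicit Types (g : R * R -> R).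

(** An open set of the plane is a countable union of open boxes with rational centres and
    half-widths 1 / (n + 1), which links the product topology, in which test functions are
    continuous, to the product sigma-algebra. *)
Lemma open_plane_measurable (O : set (R * R)) : open O ->
  measurable (O : set (measurableTypeR R * measurableTypeR R)).
Proof.
move=> oO.
pose S (q r : rat) (n : nat) : set (R * R) :=
  `](ratr q - n.+1%:R^-1), (ratr q + n.+1%:R^-1)[ `*`
  `](ratr r - n.+1%:R^-1), (ratr r + n.+1%:R^-1)[.
have -> : O = \bigcup_q \bigcup_r \bigcup_n
    (if `[< S q r n `<=` O >] then S q r n else set0).
  rewrite eqEsubset; split=> [[x y] Oxy|p [q _ [r _ [n _]]]]; last first.
    by case: asboolP => // /[apply].
  have /nbhs_ballP[e /= e0 eO] := open_nbhs_nbhs (conj oO Oxy).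
  (* The bound is e / 2 because both the given point and any point of the box are within 1 / (n + 1)
     of the centre in each coordinate. *)
  have [n ne] : exists n : nat, n.+1%:R^-1 < e / 2.
    have e2 : 0 < e / 2 by rewrite divr_gt0.
    by have [N _ h] := near_infty_natSinv_lt (PosNum e2); exists N; exact: (h N (leqnn N)).
  have n0 : 0 < n.+1%:R^-1 :> R by rewrite invr_gt0.
  have xx (z : R) : z - n.+1%:R^-1 < z + n.+1%:R^-1 by rewrite ltrBlDr -addrA ltrDl addr_gt0.
  have [q qx] := rat_in_itvoo (xx x); have [r ry] := rat_in_itvoo (xx y).
  exists q => //; exists r => //; exists n => //.
  have [d dE] : exists d : R, d = n.+1%:R^-1 by eexists.
  move: qx ry ne n0; rewrite !in_itv/= -dE => /andP[q1 q2] /andP[r1 r2] de d0.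
  case: asboolP => [_|[]].
    by split => /=; rewrite in_itv/= -dE; apply/andP; split; lra.
  move=> [u v] [/=]; rewrite !in_itv/= -dE => /andP[u1 u2] /andP[v1 v2].
  by apply: eO; split => /=; rewrite /ball/= ltr_norml; apply/andP; split; lra.
apply: bigcupT_measurable_rat => q; apply: bigcupT_measurable_rat => r.
apply: bigcupT_measurable => n; case: asboolP => // _.
by apply: measurableX; exact: measurable_itv.
Qed.

Lemma continuous_plane_measurable g : continuous g -> measurable_fun setT g.
Proof.
move=> /continuousP cg; apply: (measurability _ (RGenOpens.measurableE R)).
move=> _ [_ [a [b ->] <-]]; rewrite setTI; apply: open_plane_measurable.
exact/cg/interval_open.
Qed.

Lemma continuous_plane_bounded g (M : R) : continuous g ->
  exists2 L, 0 <= L & forall p, `|p.1| <= M -> `|p.2| <= M -> `|g p| <= L.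
Proof.
move=> cg.
have cK : compact (`[-M, M] `*` `[-M, M] : set (R * R)).
  by apply: compact_setX; exact: segment_compact.
have cgK : {within `[-M, M] `*` `[-M, M], continuous g} by exact: continuous_subspaceT.
have [N [_ hN]] := compact_bounded (continuous_compact cgK cK).
exists (`|N| + 1); first by rewrite addr_ge0.
move=> p p1 p2; apply: (hN (`|N| + 1)).
  by rewrite (le_lt_trans (ler_norm N))// ltrDl.
by exists p => //; split => /=; rewrite in_itv/= -ler_norml.
Qed.

Lemma test_fun_is_derive (phi : R * R -> R) (x y : R) : test_fun phi ->
  is_derive x 1 (fun s => phi (s, y)) (d1 phi (x, y)) /\
  is_derive y 1 (fun t => phi (x, t)) (d2 phi (x, y)).
Proof.
move=> [df _]; have [/= h1 h2] := df (x, y).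
split; first by apply: (is_derive_eq (derivableP h1)); rewrite /d1/= derive1E.
by apply: (is_derive_eq (derivableP h2)); rewrite /d2/= derive1E.
Qed.

Lemma test_fun_bounded (phi : R * R -> R) : test_fun phi ->
  exists L M : R, [/\ 0 <= L, forall p, `|phi p| <= L * rect (- M) M (- M) M p,
    forall p, `|d1 phi p| <= L * rect (- M) M (- M) M p &
    forall p, `|d2 phi p| <= L * rect (- M) M (- M) M p].
Proof.
move=> [df [cf [c1 [c2 [M hM]]]]].
have zero (h : R -> R) (z : R) : M < `|z| -> (forall s, M < `|s| -> h s = 0) -> derive1 h z = 0.
  move=> Mz h0; rewrite derive1E.
  have hz : \forall s \near z, M < `|s|.
    apply/nbhs_ballP; exists (`|z| - M); first by rewrite /= subr_gt0.
    by move=> s /= hs; have := le_lt_trans (lerB_dist z s) hs; rewrite ltrD2l ltrN2.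
  rewrite (@near_eq_derive R R R h (cst 0) z 1) ?derive_cst//.
  exact: filterS hz.
have zero' (h : R -> R) (z : R) : (forall s, h s = 0) -> derive1 h z = 0.
  by move=> h0; rewrite (_ : h = cst 0) ?derive1_cst//; apply/funext.
(* Two reasons for vanishing: when the differentiated coordinate is large, phi is 0 near the point
   along that line; when the other one is large, phi is 0 on the whole line. *)
have out1 p : M < `|p.1| \/ M < `|p.2| -> d1 phi p = 0.
  case=> hp; first by apply: zero => // s hs; apply: hM; left.
  by apply: zero' => s; apply: hM; right.
have out2 p : M < `|p.1| \/ M < `|p.2| -> d2 phi p = 0.
  case=> hp; last by apply: zero => // s hs; apply: hM; right.
  by apply: zero' => s; apply: hM; left.
have [L0 L00 b0] := continuous_plane_bounded M cf.
have [L1 L10 b1] := continuous_plane_bounded M c1.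
have [L2 L20 b2] := continuous_plane_bounded M c2.
have aux (g : R * R -> R) (L L' : R) : L' <= L ->
    (forall p, M < `|p.1| \/ M < `|p.2| -> g p = 0) ->
    (forall p, `|p.1| <= M -> `|p.2| <= M -> `|g p| <= L') ->
    forall p, `|g p| <= L * rect (- M) M (- M) M p.
  move=> LL g0 gL p; rewrite /rect -!ler_norml.
  have [p1|p1] := leP `|p.1| M; last by rewrite mulr0 g0 ?normr0//; left.
  have [p2|p2] := leP `|p.2| M; last by rewrite mulr0 g0 ?normr0//; right.
  by rewrite mulr1 (le_trans (gL _ p1 p2)).
exists (L0 + L1 + L2), M; split.
- by rewrite !addr_ge0.
- by apply: (aux _ _ L0) => //; rewrite -addrA lerDl addr_ge0.
- by apply: (aux _ _ L1) => //; rewrite addrAC lerDr addr_ge0.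
- by apply: (aux _ _ L2) => //; rewrite lerDr addr_ge0.
Qed.

Lemma continuous_section1 g (y : R) : continuous g -> continuous (fun x => g (x, y)).
Proof.
move=> cg x; apply: (@continuous_comp _ _ _ (fun x : R => (x, y)) g); last exact: cg.
exact: (cvg_pair (@cvg_id _ _) (@cvg_cst _ _ _ _ _)).
Qed.

Lemma continuous_section2 g (x : R) : continuous g -> continuous (fun y => g (x, y)).
Proof.
move=> cg y; apply: (@continuous_comp _ _ _ (fun y : R => (x, y)) g); last exact: cg.
exact: (cvg_pair (@cvg_cst _ _ _ _ _) (@cvg_id _ _)).
Qed.

End continuous_plane_functions.

(** * Local integrability, translations and reflections in the second variable *)

Section plane_flips.
Local Open Scope ereal_scope.
Context (R : realType).
Implicit Types (f : R -> R) (g h psi : R * R -> R) (c e : R).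

Lemma locally_integrable2_rect g (M : R) : locally_integrable2 g ->
  \int[leb2 R]_p (rect (- M) M (- M) M p * `|g p|)%:E < +oo.
Proof.
move=> [mg gi]; have /integrableP[_] := gi M; apply: le_lt_trans.
rewrite [leRHS]integral_mkcond; apply: nn_le_integral => p _.
  by rewrite lee_fin mulr_ge0// rect_ge0.
rewrite patchE; case: ifPn => [|h].
  by rewrite inE /= !in_itv/= => -[h1 h2]; rewrite rectE h1 h2 !mul1r.
rewrite rectE; move: h; rewrite notin_setE /= !in_itv/= => h.
case: (boolP (- M <= p.1 <= M)%R) => h1; last by rewrite !mul0r.
by case: (boolP (- M <= p.2 <= M)%R) => h2; [case: h|rewrite mulr0 mul0r].
Qed.

Lemma rect_locally_integrable2 g : measurable_fun setT g ->
  (forall M : R, \int[leb2 R]_p (rect (- M) M (- M) M p * `|g p|)%:E < +oo) ->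
  locally_integrable2 g.
Proof.
move=> mg gi; split=> // M; apply/integrableP; split; first by apply: measurable_funTS; mfun.
apply: le_lt_trans (gi M); rewrite integral_mkcond; apply: nn_le_integral => p _.
  by rewrite patchE; case: ifP => // _; exact: abse_ge0.
rewrite patchE; case: ifPn => [|_]; last by rewrite lee_fin mulr_ge0// rect_ge0.
by rewrite inE /= !in_itv/= => -[h1 h2]; rewrite rectE h1 h2 !mul1r.
Qed.

Lemma locally_integrable2D g h : locally_integrable2 g -> locally_integrable2 h ->
  locally_integrable2 (fun p => g p + h p)%R.
Proof.
move=> [mg gi] [mh hi]; split=> [|M]; first by mfun.
have mS : measurable (`[(- M)%R, M] `*` `[(- M)%R, M] : set (measurableTypeR R * measurableTypeR R)).
  by apply: measurableX; exact: measurable_itv.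
by have := integrableD mS (gi M) (hi M); apply: eq_integrable.
Qed.

Lemma locally_integrable2Z (k : R) g : locally_integrable2 g ->
  locally_integrable2 (fun p => k * g p)%R.
Proof.
move=> [mg gi]; split=> [|M]; first by mfun.
have mS : measurable (`[(- M)%R, M] `*` `[(- M)%R, M] : set (measurableTypeR R * measurableTypeR R)).
  by apply: measurableX; exact: measurable_itv.
by have := integrableZl mS k (gi M); apply: eq_integrable.
Qed.

Lemma le_locally_integrable2 g h : measurable_fun setT g -> locally_integrable2 h ->
  (forall p, `|g p| <= `|h p|)%R -> locally_integrable2 g.
Proof.
move=> mg hi gh; apply: rect_locally_integrable2 => // M.
apply: le_lt_trans (locally_integrable2_rect M hi); apply: nn_le_integral => p _.
  by rewrite lee_fin mulr_ge0// rect_ge0.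
by rewrite lee_fin ler_wpM2l// rect_ge0.
Qed.

Lemma L2_locally_integrable2 g : measurable_fun setT g ->
  \int[leb2 R]_p (g p ^+ 2)%:E < +oo -> locally_integrable2 g.
Proof.
move=> mg g2; apply: rect_locally_integrable2 => // M.
have l1 : locally_integrable2 (fun=> 1%R : R).
  by apply: (@locally_integrable2_fst _ (fun=> 1%R : R)) => //; exact: (L2loc_integrable (L2loc_cst 1%R)).
have mr := @measurable_rect R (- M) M (- M) M.
apply: (@le_lt_trans _ _ (\int[leb2 R]_p ((rect (- M) M (- M) M p * `|1|)%:E + (g p ^+ 2)%:E))).
  apply: nn_le_integral => p _; first by rewrite lee_fin mulr_ge0// rect_ge0.
  rewrite -EFinD lee_fin normr1 mulr1 /rect; case: (_ && _); last by rewrite mul0r add0r sqr_ge0.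
  rewrite mul1r mulr1n -(real_normK (num_real (g p))); have := sqr_ge0 (`|g p| - 1)%R; nra.
rewrite ge0_integralD//.
- by rewrite lte_add_pinfty//; exact: locally_integrable2_rect.
- by move=> p _; rewrite lee_fin mulr_ge0// rect_ge0.
- by mfun.
- by move=> p _; rewrite lee_fin sqr_ge0.
- by mfun.
Qed.

Lemma measurable_flip c e : measurable_fun setT (fun p : R * R => (p.1, (e * p.2 + c)%R)).
Proof. by mfun. Qed.

Lemma ge0_leb2_flip c e (G : R * R -> \bar R) : e = 1%R \/ e = (- 1)%R ->
  measurable_fun setT G -> (forall p, 0 <= G p) ->
  \int[leb2 R]_p G (p.1, (e * p.2 + c)%R) = \int[leb2 R]_p G p.
Proof.
move=> e1 mG G0; rewrite -[RHS](ge0_leb2_shift c)//.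
case: e1 => ->; first by apply: eq_integral => p _; rewrite mul1r.
rewrite -[RHS]ge0_leb2_opp//; first by apply: eq_integral => p _; rewrite mulN1r.
have ms : measurable_fun setT (fun p : R * R => (p.1, (p.2 + c)%R)) by mfun.
exact: (measurableT_comp mG ms).
Qed.

Lemma leb2_flip c e g : e = 1%R \/ e = (- 1)%R -> measurable_fun setT g ->
  \int[leb2 R]_p (g (p.1, (e * p.2 + c)%R))%:E = \int[leb2 R]_p (g p)%:E.
Proof.
move=> e1 mg; rewrite -[RHS](leb2_shift c)//.
case: e1 => ->; first by apply: eq_integral => p _; rewrite mul1r.
rewrite -[RHS](leb2_opp (g := fun p => g (p.1, p.2 + c)%R)).
  by apply: eq_integral => p _; rewrite mulN1r.
have ms : measurable_fun setT (fun p : R * R => (p.1, (p.2 + c)%R)) by mfun.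
exact: (measurableT_comp mg ms).
Qed.

Lemma rect_flip c e (M : R) (p : R * R) : e = 1%R \/ e = (- 1)%R ->
  (rect (- M) M (- M) M (p.1, e * p.2 + c) <=
   rect (- (`|M| + `|c|)) (`|M| + `|c|) (- (`|M| + `|c|)) (`|M| + `|c|) p)%R.
Proof.
move=> e1; rewrite /rect/= ler_nat.
case: (boolP (_ && _)) => // /andP[/andP[h1 h2] /andP[h3 h4]].
have := ler_norm M; have := ler_norm c; have := ler_norm (- c); rewrite normrN => k1 k2 k3.
have k4 := normr_ge0 c.
suff -> : ((- (`|M| + `|c|) <= p.1 <= `|M| + `|c|) && (- (`|M| + `|c|) <= p.2 <= `|M| + `|c|))%R by [].
by case: e1 h3 h4 => -> h3 h4; apply/andP; split; apply/andP; split; lra.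
Qed.

Lemma flipK c e (y : R) : e = 1%R \/ e = (- 1)%R -> (e * (e * y + c - c) = y)%R.
Proof. by case=> ->; ring. Qed.

Lemma locally_integrable2_flip c e g : e = 1%R \/ e = (- 1)%R ->
  locally_integrable2 g -> locally_integrable2 (fun p => g (p.1, e * (p.2 - c)))%R.
Proof.
move=> e1 li; have [mg _] := li.
have mf : measurable_fun setT (fun p : R * R => (p.1, e * (p.2 - c))%R) by mfun.
have mgf := measurableT_comp mg mf.
apply: rect_locally_integrable2 => // M.
have mr := @measurable_rect R (- M) M (- M) M.
rewrite -(@ge0_leb2_flip c e (fun p => (rect (- M) M (- M) M p * `|g (p.1, e * (p.2 - c))|)%:E))//.
- apply: le_lt_trans (locally_integrable2_rect (`|M| + `|c|)%R li).
  apply: nn_le_integral => p _; first by rewrite lee_fin mulr_ge0// rect_ge0.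
  by rewrite lee_fin/= flipK// -surjective_pairing ler_wpM2r// rect_flip.
- by have := mgf; rewrite /comp => ?; mfun.
- by move=> p; rewrite lee_fin mulr_ge0// rect_ge0.
Qed.

End plane_flips.

Section one_sided_extension.
Local Open Scope ereal_scope.
Context (R : realType).
Implicit Types (f : R -> R) (K : R -> R -> R) (psi phi : R * R -> R) (c e : R).

(* e = 1 or e = -1 selects the half-plane above or below the line of height c. *)
Definition one_sided f K c e (p : R * R) : R := average f K p.1 (e * (p.2 - c)).

(** The size of K alone gives a bound of order 1 / t, which is not locally integrable. Splitting off
    f(x) times the mean of K, which is bounded, leaves the oscillation, and that is in L^2. *)
Lemma locally_integrable2_average f K (B : R) : L2loc f -> gagliardo f < +oo ->
  averaging_kernel K -> (0 <= B)%R -> (forall t, `|\int[leb R]_s K t s| <= B)%R ->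
  locally_integrable2 (fun q => average f K q.1 q.2).
Proof.
move=> lf Jf aK B0 KB; have [mf _] := lf.
have mo := measurable_oscillation mf aK; have ma := measurable_average mf aK.
have lo : locally_integrable2 (fun q => `|oscillation f K q.1 q.2|)%R.
  apply: L2_locally_integrable2; first by mfun.
  under eq_integral do rewrite real_normK ?num_real//.
  apply: le_lt_trans (oscillation_L2_le lf aK) _.
  by rewrite lte_mul_pinfty// ?lee_fin ?mulr_ge0 ?pi_ge0.
have l1 : locally_integrable2 (fun q : R * R => B * `|f q.1|)%R.
  apply: (@locally_integrable2Z _ B (fun q => `|f q.1|)%R).
  apply: (@le_locally_integrable2 _ _ (fun q => f q.1)) => [||p]; first by mfun.
    exact: locally_integrable2_fst mf (L2loc_integrable lf).
  by rewrite normr_id.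
apply: le_locally_integrable2 (locally_integrable2D lo l1) _ => // q.
rewrite [leRHS]ger0_norm ?addr_ge0// ?mulr_ge0// average_oscillation//.
apply: le_trans (ler_normD _ _) _; rewrite lerD2l// normrM mulrC ler_wpM2r//.
Qed.

Lemma locally_integrable2_one_sided f K c e (B : R) : e = 1%R \/ e = (- 1)%R ->
  L2loc f -> gagliardo f < +oo ->
  averaging_kernel K -> (0 <= B)%R -> (forall t, `|\int[leb R]_s K t s| <= B)%R ->
  locally_integrable2 (one_sided f K c e).
Proof.
move=> e1 lf Jf aK B0 KB.
exact: (locally_integrable2_flip c e1 (locally_integrable2_average lf Jf aK B0 KB)).
Qed.

Lemma integral_one_sided f K c e psi : e = 1%R \/ e = (- 1)%R -> measurable_fun setT f ->
  averaging_kernel K -> measurable_fun setT psi ->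
  \int[leb2 R]_p (one_sided f K c e p * psi p)%:E =
  \int[leb2 R]_q (average f K q.1 q.2 * psi (q.1, e * q.2 + c)%R)%:E.
Proof.
move=> e1 mf aK mpsi; have ma := measurable_average mf aK.
have mfl : measurable_fun setT (fun p : R * R => (p.1, e * (p.2 - c))%R) by mfun.
have := measurableT_comp ma mfl; rewrite /comp/= => m1.
have mg : measurable_fun setT (fun p => one_sided f K c e p * psi p)%R.
  by rewrite /one_sided; mfun.
rewrite -(leb2_flip c e1 mg).
by apply: eq_integral => q _; rewrite /one_sided /= flipK.
Qed.

Lemma integrable_mul_test (F psi : R * R -> R) (L M : R) : locally_integrable2 F ->
  measurable_fun setT psi -> (0 <= L)%R ->
  (forall p, `|psi p| <= L * rect (- M) M (- M) M p)%R ->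
  (leb2 R).-integrable setT (fun p => (F p * psi p)%:E).
Proof. by move=> [mF iF] mpsi L0 bpsi; exact: (integrable_mul_bounded mF (iF M) mpsi L0 bpsi). Qed.

Lemma flip_bounded c e (psi : R * R -> R) (L M : R) : e = 1%R \/ e = (- 1)%R -> (0 <= L)%R ->
  (forall p, `|psi p| <= L * rect (- M) M (- M) M p)%R ->
  forall q : R * R, (`|psi (q.1, e * q.2 + c)| <=
    L * rect (- (`|M| + `|c|)) (`|M| + `|c|) (- (`|M| + `|c|)) (`|M| + `|c|) q)%R.
Proof. by move=> e1 L0 bp q; apply: le_trans (bp _) _; rewrite ler_wpM2l// rect_flip. Qed.

Lemma flip_bounded1 c e (psi : R * R -> R) (L M : R) : (0 <= L)%R ->
  (forall p, `|psi p| <= L * rect (- M) M (- M) M p)%R ->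
  forall q : R * R, (`|psi (q.1, e * q.2 + c)| <= L * (- M <= q.1 <= M)%R%:R)%R.
Proof.
move=> L0 bp q; apply: le_trans (bp _) _; rewrite ler_wpM2l// rectE/= ler_piMr//.
by case: (_ <= _ <= _)%R.
Qed.

(** The substitutions t = y - c above and t = c - y below bring both halves to one average in (x,
    t); the pairing with psi becomes a pairing with psi(x, c + t) + k psi(x, c - t). For k = -1 this
    combination vanishes at t = 0. *)
Lemma integral_two_sided f K c (k B L M : R) psi : L2loc f -> gagliardo f < +oo ->
  averaging_kernel K -> (0 <= B)%R -> (forall t, `|\int[leb R]_s K t s| <= B)%R ->
  measurable_fun setT psi -> (0 <= L)%R ->
  (forall p, `|psi p| <= L * rect (- M) M (- M) M p)%R ->
  \int[leb2 R]_p ((one_sided f K c 1 p + k * one_sided f K c (- 1) p) * psi p)%:E =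
  \int[leb2 R]_q (average f K q.1 q.2 *
    (psi (q.1, q.2 + c) + k * psi (q.1, - q.2 + c)))%:E.
Proof.
move=> lf Jf aK B0 KB mpsi L0 bpsi; have [mf _] := lf.
have s1 : (1 : R)%R = 1%R \/ (1 : R)%R = (- 1)%R by left.
have s2 : (- 1 : R)%R = 1%R \/ (- 1 : R)%R = (- 1)%R by right.
pose psi' p := (k * psi p)%R.
have mpsi' : measurable_fun setT psi' by rewrite /psi'; mfun.
have kL0 : (0 <= `|k| * L)%R by rewrite mulr_ge0.
have bpsi' p : (`|psi' p| <= `|k| * L * rect (- M) M (- M) M p)%R.
  by rewrite /psi' normrM -mulrA ler_wpM2l.
have os1 := locally_integrable2_one_sided c s1 lf Jf aK B0 KB.
have os2 := locally_integrable2_one_sided c s2 lf Jf aK B0 KB.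
have i1 := integrable_mul_test os1 mpsi L0 bpsi.
have i2 := integrable_mul_test os2 mpsi' kL0 bpsi'.
have li := locally_integrable2_average lf Jf aK B0 KB.
have mt1 : measurable_fun setT (fun q : R * R => psi (q.1, 1 * q.2 + c)%R).
  exact: measurableT_comp mpsi (measurable_flip c 1).
have mt2 : measurable_fun setT (fun q : R * R => psi' (q.1, - 1 * q.2 + c)%R).
  exact: measurableT_comp mpsi' (measurable_flip c (- 1)).
have k1 := integrable_mul_test li mt1 L0 (flip_bounded c s1 L0 bpsi).
have k2 := integrable_mul_test li mt2 kL0 (flip_bounded c s2 kL0 bpsi').
have E1 := integral_one_sided c s1 mf aK mpsi.
have E2 := integral_one_sided c s2 mf aK mpsi'.
transitivity (\int[leb2 R]_p ((one_sided f K c 1 p * psi p)%:E + (one_sided f K c (- 1) p * psi' p)%:E)).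
  by apply: eq_integral => p _; rewrite -EFinD /psi'; congr EFin; ring.
rewrite (integralD measurableT i1 i2) E1 E2 -(integralD measurableT k1 k2).
apply: eq_integral => q _; rewrite -EFinD -mulrDr /psi'; congr (_ * (psi (_, _) + _ * psi (_, _)))%R%:E.
- by rewrite mul1r.
- by rewrite mulN1r.
Qed.

Lemma norm_Rintegral_ext_kernel (t : R) : (`|\int[leb R]_s ext_kernel t s| <= 1)%R.
Proof.
have [ht|ht] := boolP (0 < t < pi)%R.
  rewrite Rintegral_kernel//; have /andP[u0 u1] := ratio_bounds ht.
  by rewrite ger0_norm ?subr_ge0 ?(ltW u1)// gerBl ltW.
rewrite (_ : (fun s => _) = cst 0%R); first by rewrite Rintegral_cst// mul0r normr0.
by apply/funext => s; rewrite /ext_kernel (negbTE ht) mul0r.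
Qed.

Lemma norm_Rintegral_ext_kernel_x (t : R) : (`|\int[leb R]_s ext_kernel_x t s| <= 0)%R.
Proof.
have [ht|ht] := boolP (0 < t < pi)%R; first by rewrite Rintegral_kernel_x// normr0.
rewrite (_ : (fun s => _) = cst 0%R); first by rewrite Rintegral_cst// mul0r normr0.
by apply/funext => s; rewrite /ext_kernel_x (negbTE ht) mul0r.
Qed.

Lemma norm_Rintegral_ext_kernel_t (t : R) : (`|\int[leb R]_s ext_kernel_t t s| <= pi^-1)%R.
Proof.
have pi0 := @pi_ge0 R.
have [ht|ht] := boolP (0 < t < pi)%R.
  by rewrite Rintegral_kernel_t// normrN ger0_norm// invr_ge0.
rewrite (_ : (fun s => _) = cst 0%R); first by rewrite Rintegral_cst// mul0r normr0 invr_ge0.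
by apply/funext => s; rewrite /ext_kernel_t (negbTE ht) mul0r.
Qed.

End one_sided_extension.

Section line_extension.
Local Open Scope ereal_scope.
Context (R : realType).
Variables (f : R -> R) (c : R).
Hypotheses (lf : L2loc f) (Jf : gagliardo f < +oo).

(** On the line itself t = 0 and the kernels are 0, so all three functions vanish there; this
    affects only a null set. The minus sign in [line_ext_y] comes from t = c - y below the line. *)
Definition line_ext (p : R * R) : R :=
  (one_sided f (@ext_kernel R) c 1 p + one_sided f (@ext_kernel R) c (- 1) p)%R.
Definition line_ext_x (p : R * R) : R :=
  (one_sided f (@ext_kernel_x R) c 1 p + one_sided f (@ext_kernel_x R) c (- 1) p)%R.
Definition line_ext_y (p : R * R) : R :=
  (one_sided f (@ext_kernel_t R) c 1 p - one_sided f (@ext_kernel_t R) c (- 1) p)%R.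

Let sg1 : (1 : R)%R = 1%R \/ (1 : R)%R = (- 1)%R. Proof. by left. Qed.
Let sgN1 : (- 1 : R)%R = 1%R \/ (- 1 : R)%R = (- 1)%R. Proof. by right. Qed.

Lemma locally_integrable2_os e : e = 1%R \/ e = (- 1)%R ->
  [/\ locally_integrable2 (one_sided f (@ext_kernel R) c e),
      locally_integrable2 (one_sided f (@ext_kernel_x R) c e) &
      locally_integrable2 (one_sided f (@ext_kernel_t R) c e)].
Proof.
move=> e1; split.
- apply: (@locally_integrable2_one_sided _ _ _ _ _ 1%R) => //.
    exact: averaging_kernel_kernel.
  exact: norm_Rintegral_ext_kernel.
- apply: (@locally_integrable2_one_sided _ _ _ _ _ 0%R) => //.
    exact: averaging_kernel_kernel_x.
  exact: norm_Rintegral_ext_kernel_x.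
- apply: (@locally_integrable2_one_sided _ _ _ _ _ pi^-1%R) => //.
  + exact: averaging_kernel_kernel_t.
  + by rewrite invr_ge0 pi_ge0.
  + exact: norm_Rintegral_ext_kernel_t.
Qed.

Lemma locally_integrable2_line_ext : [/\ locally_integrable2 line_ext,
  locally_integrable2 line_ext_x & locally_integrable2 line_ext_y].
Proof.
have [a1 a2 a3] := locally_integrable2_os sg1; have [b1 b2 b3] := locally_integrable2_os sgN1.
split; [exact: locally_integrable2D|exact: locally_integrable2D|].
have := locally_integrable2D a3 (locally_integrable2Z (- 1) b3).
by under eq_fun do rewrite mulN1r.
Qed.

Lemma one_sided_weak_x e (phi : R * R -> R) : e = 1%R \/ e = (- 1)%R -> test_fun phi ->
  \int[leb2 R]_p (one_sided f (@ext_kernel R) c e p * d1 phi p)%:E =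
  - \int[leb2 R]_p (one_sided f (@ext_kernel_x R) c e p * phi p)%:E.
Proof.
move=> e1 tf; have [mf _] := lf; have [df [cf [c1 [c2 _]]]] := tf.
have [L [M [L0 b0 b1 b2]]] := test_fun_bounded tf.
have mphi := continuous_plane_measurable cf; have m1 := continuous_plane_measurable c1.
have ak := averaging_kernel_kernel R; have akx := averaging_kernel_kernel_x R.
rewrite (integral_one_sided _ e1 mf ak m1) (integral_one_sided _ e1 mf akx mphi).
have mfl := measurable_flip c e.
have m1' := measurableT_comp m1 mfl; have mphi' := measurableT_comp mphi mfl.
have li := locally_integrable2_average lf Jf ak ler01 (@norm_Rintegral_ext_kernel R).
have lix := locally_integrable2_average lf Jf akx (lexx _) (@norm_Rintegral_ext_kernel_x R).
apply: (@horizontal_parts R f (fun q => phi (q.1, e * q.2 + c)%R)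
  (fun q => d1 phi (q.1, e * q.2 + c)%R) L M) => //=.
- exact: (integrable_mul_test li m1' L0 (flip_bounded c e1 L0 b1)).
- exact: (integrable_mul_test lix mphi' L0 (flip_bounded c e1 L0 b0)).
- by move=> x t; have [] := test_fun_is_derive x (e * t + c)%R tf.
- by move=> t; exact: continuous_section1.
- by move=> q; exact: (flip_bounded1 c e L0 b0).
- by move=> q; exact: (flip_bounded1 c e L0 b1).
Qed.

Lemma line_ext_weak_x (phi : R * R -> R) : test_fun phi ->
  \int[leb2 R]_p (line_ext p * d1 phi p)%:E = - \int[leb2 R]_p (line_ext_x p * phi p)%:E.
Proof.
move=> tf; have [df [cf [c1 [c2 _]]]] := tf.
have [L [M [L0 b0 b1 b2]]] := test_fun_bounded tf.
have mphi := continuous_plane_measurable cf; have m1 := continuous_plane_measurable c1.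
have [p1 p2 _] := locally_integrable2_os sg1; have [q1 q2 _] := locally_integrable2_os sgN1.
under eq_integral do rewrite mulrDl EFinD.
under [X in _ = - X]eq_integral do rewrite mulrDl EFinD.
have i1 := integrable_mul_test p1 m1 L0 b1; have i2 := integrable_mul_test q1 m1 L0 b1.
have j1 := integrable_mul_test p2 mphi L0 b0; have j2 := integrable_mul_test q2 mphi L0 b0.
rewrite integralD// integralD// (one_sided_weak_x sg1 tf) (one_sided_weak_x sgN1 tf).
by rewrite oppeD// fin_num_adde_defl// integrable_fin_num.
Qed.

(** Above and below must be treated together: separately, each would leave a boundary term on the
    line. After folding, the test function becomes a, which vanishes at t = 0, with t-derivative a',
    and the boundary terms cancel. *)
Lemma line_ext_weak_y (phi : R * R -> R) : test_fun phi ->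
  \int[leb2 R]_p (line_ext p * d2 phi p)%:E = - \int[leb2 R]_p (line_ext_y p * phi p)%:E.
Proof.
move=> tf; have [mf _] := lf; have [df [cf [c1 [c2 _]]]] := tf.
have [L [M [L0 b0 b1 b2]]] := test_fun_bounded tf.
have mphi := continuous_plane_measurable cf; have m2 := continuous_plane_measurable c2.
have ak := averaging_kernel_kernel R; have akt := averaging_kernel_kernel_t R.
have pi0 : (0 <= pi^-1 :> R)%R by rewrite invr_ge0 pi_ge0.
pose a (q : R * R) := (phi (q.1, q.2 + c) - phi (q.1, - q.2 + c))%R.
pose a' (q : R * R) := (d2 phi (q.1, q.2 + c) + d2 phi (q.1, - q.2 + c))%R.
transitivity (\int[leb2 R]_q (average f (@ext_kernel R) q.1 q.2 * a' q)%:E).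
  transitivity (\int[leb2 R]_p ((one_sided f (@ext_kernel R) c 1 p +
      1 * one_sided f (@ext_kernel R) c (- 1) p) * d2 phi p)%:E).
    by apply: eq_integral => p _; rewrite mul1r.
  rewrite (integral_two_sided c 1 lf Jf ak ler01 (@norm_Rintegral_ext_kernel R) m2 L0 b2).
  by apply: eq_integral => q _; rewrite mul1r.
transitivity (- \int[leb2 R]_q (average f (@ext_kernel_t R) q.1 q.2 * a q)%:E); last first.
  congr (- _); transitivity (\int[leb2 R]_p ((one_sided f (@ext_kernel_t R) c 1 p +
      - 1 * one_sided f (@ext_kernel_t R) c (- 1) p) * phi p)%:E).
    rewrite (integral_two_sided c (- 1) lf Jf akt pi0 (@norm_Rintegral_ext_kernel_t R) mphi L0 b0).
    by apply: eq_integral => q _; rewrite mulN1r.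
  by apply: eq_integral => p _; rewrite mulN1r.
have dp (x t : R) : is_derive t 1%R (fun t : R => phi (x, t + c)%R) (d2 phi (x, t + c))%R.
  have [_ d] := test_fun_is_derive x (t + c)%R tf.
  have da : is_derive t 1%R (fun t : R => t + c)%R 1%R by apply: is_derive_eq; rewrite addr0.
  have := @is_derive1_comp _ (fun y => phi (x, y)) (fun t : R => t + c)%R _ _ _ d da.
  by rewrite mulr1.
have dn (x t : R) : is_derive t 1%R (fun t : R => phi (x, - t + c)%R) (- d2 phi (x, - t + c))%R.
  have [_ d] := test_fun_is_derive x (- t + c)%R tf.
  have da : is_derive t 1%R (fun t : R => - t + c)%R (- 1)%R.
    by apply: is_derive_eq; rewrite addr0.
  have := @is_derive1_comp _ (fun y => phi (x, y)) (fun t : R => - t + c)%R _ _ _ d da.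
  by rewrite mulrN1.
apply: (@vertical_parts R f a a' (2 * L)%R M) => //.
- have h1 : measurable_fun setT (fun q : R * R => (q.1, q.2 + c)%R) by mfun.
  have h2 : measurable_fun setT (fun q : R * R => (q.1, - q.2 + c)%R) by mfun.
  by apply: measurable_funB; [exact: measurableT_comp mphi h1|exact: measurableT_comp mphi h2].
- have h1 : measurable_fun setT (fun q : R * R => (q.1, q.2 + c)%R) by mfun.
  have h2 : measurable_fun setT (fun q : R * R => (q.1, - q.2 + c)%R) by mfun.
  by apply: measurable_funD; [exact: measurableT_comp m2 h1|exact: measurableT_comp m2 h2].
- move=> x t; apply: (is_derive_eq (is_deriveB (dp x t) (dn x t))).
  by rewrite opprK.
- move=> x t.
  have cp : {for t, continuous (fun t : R => t + c)%R} by apply: cvgD; [exact: cvg_id|exact: cvg_cst].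
  have cn : {for t, continuous (fun t : R => - t + c)%R}.
    by apply: cvgD; [apply: cvgN; exact: cvg_id|exact: cvg_cst].
  have cs : continuous (fun y => d2 phi (x, y)) by exact: continuous_section2.
  apply: cvgD.
    exact: (@continuous_comp _ _ _ _ (fun y => d2 phi (x, y)) t cp (cs _)).
  exact: (@continuous_comp _ _ _ _ (fun y => d2 phi (x, y)) t cn (cs _)).
- by rewrite mulr_ge0.
- move=> q; apply: le_trans (ler_normD _ _) _.
  have := lerD (flip_bounded1 c 1 L0 b2 q) (flip_bounded1 c (- 1) L0 b2 q).
  rewrite mul1r mulN1r => /le_trans; apply.
  by rewrite -mulrA mulr2n mulrDl !mul1r.
- move=> q; have [hq|hq] := boolP (- M <= q.1 <= M)%R; last first.
    have z y : phi (q.1, y)%R = 0%R.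
      apply/eqP; rewrite -normr_le0; apply: le_trans (b0 _) _.
      by rewrite rectE/= (negbTE hq) mul0r mulr0.
    by rewrite /a !z subrr normr0 mulr_ge0// mulr_ge0// mulr_ge0.
  rewrite mulr1.
  have b2' y : (`|d2 phi (q.1, y)| <= L)%R.
    apply: le_trans (b2 _) _; rewrite -[leRHS]mulr1 ler_wpM2l// /rect.
    by case: (_ && _).
  (* The mean value theorem on [c - t, c + t] gives the linear bound that [vertical_parts] asks
     for. *)
  have pos x (t : R) : (0 <= t)%R -> (forall y, `|d2 phi (x, y)| <= L)%R ->
      (`|phi (x, t + c) - phi (x, - t + c)| <= 2 * L * t)%R.
    move=> t0 bx.
    have tc : (- t + c <= t + c)%R by rewrite lerD2r; lra.
    have hd y : y \in `](- t + c)%R, (t + c)%R[%R ->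
        is_derive y 1%R (fun y => phi (x, y)) (d2 phi (x, y)).
      by move=> _; have [_ ] := test_fun_is_derive x y tf.
    have hc : {within `[(- t + c)%R, (t + c)%R], continuous (fun y => phi (x, y))}.
      by apply: continuous_subspaceT; exact: continuous_section2.
    have [y _ ->] := MVT_segment tc hd hc.
    have -> : (t + c - (- t + c) = 2 * t)%R by ring.
    have t2 : (0 <= 2 * t)%R by rewrite mulr_ge0.
    rewrite normrM (ger0_norm t2); have -> : (2 * L * t = L * (2 * t))%R by ring.
    by rewrite ler_wpM2r.
  have [t0|/ltW t0] := leP 0%R q.2.
    by rewrite /a (ger0_norm t0) pos.
  by rewrite /a (ler0_norm t0) distrC -{2}(opprK q.2) pos ?oppr_ge0.
Qed.

End line_extension.

(** * Gluing the extensions *)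

Section glue.
Local Open Scope ereal_scope.
Context (R : realType).
Implicit Types (v w : int -> R * R -> R) (p : R * R).

Definition strip_index (y : R) : int := Num.floor (y / pi).

(* On the strip of index m, a sum over n of functions supported in
   |y - pi n| < pi reduces to its terms m and m + 1. *)
Definition strip_glue v p : R := (v (strip_index p.2) p + v (strip_index p.2 + 1)%R p)%R.

Definition strip_supported v := forall n p, (pi <= `|p.2 - line_height R n|)%R -> v n p = 0%R.

Lemma strip_indexP (y : R) :
  (line_height R (strip_index y) <= y < line_height R (strip_index y) + pi)%R.
Proof.
have pi0 := @pi_gt0 R; rewrite /line_height /strip_index.
have /andP[h1 h2] := Num.Theory.floor_itv (y / pi).
apply/andP; split; first by rewrite mulrC -ler_pdivlMr.
by move: h2; rewrite ltr_pdivrMr// intrD mulrDl mul1r mulrC.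
Qed.

Lemma strip_supported_out v n p : strip_supported v ->
  n != strip_index p.2 -> n != (strip_index p.2 + 1)%R -> v n p = 0%R.
Proof.
move=> sv n0 n1; apply: sv; have pi0 := @pi_gt0 R.
have /andP[h1 h2] := strip_indexP p.2; move: (strip_index p.2) n0 n1 h1 h2 => m n0 n1 h1 h2.
have [nm|nm] : (n <= m - 1)%R \/ (m + 2 <= n)%R by lia.
- have : (line_height R n <= line_height R (m - 1))%R.
    by rewrite /line_height ler_pM2l// ler_int.
  have := line_heightS R (m - 1); rewrite subrK => e1 e2.
  by rewrite ger0_norm; lra.
- have : (line_height R (m + 2) <= line_height R n)%R.
    by rewrite /line_height ler_pM2l// ler_int.
  have := line_heightS R (m + 1); rewrite -addrA => e1 e2.
  have := line_heightS R m => e3.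
  by rewrite ler0_norm; lra.
Qed.

(** On a bounded range of y the glued function is a fixed finite sum over |n| <= N. This gives its
    measurability as a limit, its local integrability, and its weak derivatives by linearity. *)
Lemma strip_glue_sum v (N : nat) p : strip_supported v -> (`|p.2| < pi * N%:R)%R ->
  strip_glue v p = (\sum_(i < N.*2.+1) v (i%:Z - N%:Z) p)%R.
Proof.
move=> sv pN; rewrite /strip_glue; have pi0 := @pi_gt0 R.
have /andP[h1 h2] := strip_indexP p.2.
have out n := @strip_supported_out v n p sv.
move: (strip_index p.2) h1 h2 out => m h1 h2 out.
move: pN; rewrite ltr_norml => /andP[p1 p2].
have mN : (m < N%:Z)%R.
  by rewrite -(ltr_int R) -(ltr_pM2l pi0); exact: le_lt_trans h1 p2.
have Nm : (- N%:Z < m + 1)%R.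
  rewrite -(ltr_int R) -(ltr_pM2l pi0) -[X in (_ < X)%R]/(line_height R (m + 1)) line_heightS.
  by apply: lt_trans h2; rewrite mulrNz mulrN.
have [k km] : exists k : nat, (k < N.*2)%N /\ m = (k%:Z - N%:Z)%R.
  by exists (absz (m + N%:Z)%R); split; lia.
have [kN mE] := km.
have k0 : (k < N.*2.+1)%N by lia.
have k1 : (k.+1 < N.*2.+1)%N by lia.
rewrite (bigD1 (Ordinal k0))//= (bigD1 (Ordinal k1))/=; last by rewrite -val_eqE/=; lia.
rewrite big1 ?addr0.
  by rewrite mE; congr (v _ _ + v _ _)%R; lia.
move=> i /andP[]; rewrite -!val_eqE/= => i0 i1; apply: out; lia.
Qed.

Lemma strip_glue_sum_near v p : strip_supported v ->
  \forall N \near \oo, (\sum_(i < N.*2.+1) v (i%:Z - N%:Z) p)%R = strip_glue v p.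
Proof.
move=> sv; have pi0 := @pi_gt0 R.
exists (Num.truncn (`|p.2| / pi)).+1 => // N /= hN; rewrite (strip_glue_sum (N := N))//.
rewrite mulrC -ltr_pdivrMr//; apply: lt_le_trans (truncnS_gt _) _.
by rewrite ler_nat.
Qed.

Lemma measurable_strip_glue v : strip_supported v -> (forall n, measurable_fun setT (v n)) ->
  measurable_fun setT (strip_glue v).
Proof.
move=> sv mv; apply: (@measurable_fun_cvg _ _ _ _
  (fun N p => \sum_(i < N.*2.+1) v (i%:Z - N%:Z) p)%R) => [N|p _].
  by apply: measurable_sum => i.
by apply: cvg_near_cst; exact: strip_glue_sum_near.
Qed.

Lemma locally_integrable2_sum (I : Type) (s : seq I) (v : I -> R * R -> R) :
  (forall i, locally_integrable2 (v i)) ->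
  locally_integrable2 (fun p => \sum_(i <- s) v i p)%R.
Proof.
move=> lv; elim: s => [|a s IH].
  under eq_fun do rewrite big_nil.
  apply: (@locally_integrable2_fst _ (fun=> 0%R : R)) => //.
  exact: (L2loc_integrable (L2loc_cst 0%R)).
by under eq_fun do rewrite big_cons; exact: locally_integrable2D.
Qed.

Lemma locally_integrable2_strip_glue v : strip_supported v ->
  (forall n, locally_integrable2 (v n)) -> locally_integrable2 (strip_glue v).
Proof.
move=> sv lv; apply: rect_locally_integrable2.
  by apply: measurable_strip_glue => // n; have [] := lv n.
move=> M; have pi0 := @pi_gt0 R.
pose N := (Num.truncn (`|M| / pi)).+1.
have MN : (`|M| < pi * N%:R)%R by rewrite mulrC -ltr_pdivrMr//; exact: truncnS_gt.
have := locally_integrable2_rect M (locally_integrable2_sum (index_enum 'I_(N.*2.+1))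
  (fun i : 'I_(N.*2.+1) => lv (i%:Z - N%:Z)%R)).
congr (_ < _); apply: eq_integral => p _.
rewrite rectE; case: (boolP (- M <= p.2 <= M)%R) => h; last by rewrite !mulr0 !mul0r.
rewrite (strip_glue_sum (N := N))//; apply: le_lt_trans MN.
by rewrite (le_trans _ (ler_norm M))// ler_norml.
Qed.

(** The bounds on psi and chi confine both to |y| <= |M|, where the glued functions are finite sums;
    the identities for the separate lines then add up. *)
Lemma strip_glue_weak v w (psi chi : R * R -> R) (L M : R) :
  strip_supported v -> strip_supported w ->
  (forall n, locally_integrable2 (v n)) -> (forall n, locally_integrable2 (w n)) ->
  measurable_fun setT psi -> measurable_fun setT chi -> (0 <= L)%R ->
  (forall p, `|psi p| <= L * rect (- M) M (- M) M p)%R ->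
  (forall p, `|chi p| <= L * rect (- M) M (- M) M p)%R ->
  (forall n, \int[leb2 R]_p (v n p * psi p)%:E = - \int[leb2 R]_p (w n p * chi p)%:E) ->
  \int[leb2 R]_p (strip_glue v p * psi p)%:E = - \int[leb2 R]_p (strip_glue w p * chi p)%:E.
Proof.
move=> sv sw lv lw mpsi mchi L0 bpsi bchi vw; have pi0 := @pi_gt0 R.
pose N := (Num.truncn (`|M| / pi)).+1.
have MN : (`|M| < pi * N%:R)%R by rewrite mulrC -ltr_pdivrMr//; exact: truncnS_gt.
have glueE u (eta : R * R -> R) : strip_supported u ->
    (forall p, `|eta p| <= L * rect (- M) M (- M) M p)%R ->
    \int[leb2 R]_p (strip_glue u p * eta p)%:E =
    \int[leb2 R]_p ((\sum_(i < N.*2.+1) u (i%:Z - N%:Z) p) * eta p)%:E.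
  move=> su beta; apply: eq_integral => p _.
  have [hp|hp] := leP `|p.2|%R `|M|%R; first by rewrite (strip_glue_sum (N := N))//; exact: le_lt_trans MN.
  rewrite (_ : eta p = 0%R) ?mulr0//; apply/eqP; rewrite -normr_le0.
  apply: le_trans (beta p) _; rewrite rectE.
  have -> : (- M <= p.2 <= M)%R = false; last by rewrite !mulr0.
  by rewrite -ler_norml; apply/negbTE; rewrite -ltNge (le_lt_trans (ler_norm M)).
rewrite (glueE v psi)// (glueE w chi)//.
elim: (index_enum 'I_(N.*2.+1)) => [|a s IH].
  by rewrite !integral0_eq ?oppe0// => p _; rewrite big_nil mul0r.
have i1 := integrable_mul_test (lv (a%:Z - N%:Z)%R) mpsi L0 bpsi.
have j1 := integrable_mul_test (lw (a%:Z - N%:Z)%R) mchi L0 bchi.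
have lvs := locally_integrable2_sum s (fun i : 'I_(N.*2.+1) => lv (i%:Z - N%:Z)%R).
have lws := locally_integrable2_sum s (fun i : 'I_(N.*2.+1) => lw (i%:Z - N%:Z)%R).
have i2 := integrable_mul_test lvs mpsi L0 bpsi.
have j2 := integrable_mul_test lws mchi L0 bchi.
under eq_integral do rewrite big_cons mulrDl EFinD.
under [X in _ = - X]eq_integral do rewrite big_cons mulrDl EFinD.
rewrite (integralD measurableT i1 i2) (integralD measurableT j1 j2) vw IH.
by rewrite oppeD// fin_num_adde_defl// integrable_fin_num.
Qed.

End glue.

Section kernels_out.
Local Open Scope ereal_scope.
Context (R : realType).
Implicit Types (f : R -> R) (K : R -> R -> R).

Lemma averaging_kernel_out K (t s : R) : averaging_kernel K -> ~~ (0 < t < pi)%R -> K t s = 0%R.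
Proof.
move=> [_ /(_ t s)] bK ht; move: bK; rewrite (negbTE ht) mulr0 normr_le0.
by move=> /eqP.
Qed.

Lemma average_out f K (x t : R) : averaging_kernel K -> ~~ (0 < t < pi)%R ->
  average f K x t = 0%R.
Proof.
move=> aK ht; rewrite /average (_ : (fun s => _) = cst 0%R) ?Rintegral_cst ?mul0r//.
by apply/funext => s; rewrite (averaging_kernel_out s aK ht) mulr0.
Qed.

Lemma oscillation_out f K (x t : R) : averaging_kernel K -> ~~ (0 < t < pi)%R ->
  oscillation f K x t = 0%R.
Proof.
move=> aK ht; rewrite /oscillation (_ : (fun s => _) = cst 0%R) ?Rintegral_cst ?mul0r//.
by apply/funext => s; rewrite (averaging_kernel_out s aK ht) mulr0.
Qed.

Lemma average_ext_kernel f (x t : R) : L2loc f -> (0 < t < pi)%R ->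
  average f (@ext_kernel R) x t = (oscillation f (@ext_kernel R) x t + f x * (1 - t / pi))%R.
Proof.
move=> lf ht; rewrite average_oscillation//; last exact: averaging_kernel_kernel.
by rewrite Rintegral_kernel.
Qed.

Lemma average_ext_kernel_x f (x t : R) : L2loc f ->
  average f (@ext_kernel_x R) x t = oscillation f (@ext_kernel_x R) x t.
Proof.
move=> lf; rewrite average_oscillation//; last exact: averaging_kernel_kernel_x.
have := norm_Rintegral_ext_kernel_x t; rewrite normr_le0 => /eqP ->.
by rewrite mulr0 addr0.
Qed.

Lemma average_ext_kernel_t f (x t : R) : L2loc f ->
  average f (@ext_kernel_t R) x t =
  (oscillation f (@ext_kernel_t R) x t - (0 < t < pi)%R%:R * f x / pi)%R.
Proof.
move=> lf; have [ht|ht] := boolP (0 < t < pi)%R.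
  rewrite average_oscillation//; last exact: averaging_kernel_kernel_t.
  by rewrite Rintegral_kernel_t// mul1r mulrN.
rewrite average_out ?oscillation_out ?mul0r ?subr0//; exact: averaging_kernel_kernel_t.
Qed.

Lemma one_sided_out f K (c e : R) (p : R * R) : e = 1%R \/ e = (- 1)%R ->
  averaging_kernel K -> (pi <= `|p.2 - c|)%R -> one_sided f K c e p = 0%R.
Proof.
move=> e1 aK h; apply: average_out => //; apply/negP => /andP[h1 h2].
move: h; rewrite leNgt => /negP; apply; rewrite ltr_norml.
by case: e1 h1 h2 => ->; rewrite ?mul1r ?mulN1r => h1 h2; apply/andP; split; lra.
Qed.

End kernels_out.

(** * Energy of the glued extension *)

Section glued_energy.
Local Open Scope ereal_scope.
Context (R : realType).
Variable f : int -> R -> R.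
Hypothesis lf : forall n, L2loc (f n).

Let c := line_height R.
Let one1 : (1 : R)%R = 1%R \/ (1 : R)%R = (- 1)%R. Proof. by left. Qed.
Let oneN1 : (- 1 : R)%R = 1%R \/ (- 1 : R)%R = (- 1)%R. Proof. by right. Qed.
Lemma strip_supported_ext :
  [/\ strip_supported (fun n => line_ext (f n) (c n)),
      strip_supported (fun n => line_ext_x (f n) (c n)) &
      strip_supported (fun n => line_ext_y (f n) (c n))].
Proof.
have k := averaging_kernel_kernel R; have kx := averaging_kernel_kernel_x R.
have kt := averaging_kernel_kernel_t R.
split=> n p h; rewrite /line_ext /line_ext_x /line_ext_y !one_sided_out//.
- by rewrite addr0.
- by rewrite addr0.
- by rewrite subr0.
Qed.

Definition strip_osc (K : R -> R -> R) n (e : R) (p : R * R) : R :=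
  oscillation (f n) K p.1 (e * (p.2 - c n))%R.

(** The contribution of one line: the oscillations on both of its sides and the difference with the
    next line on the strip in between. Arranging it by lines makes its integral a term of
    [family_norm2] up to a constant; 3 comes from the square of a sum of three terms. *)
Definition strip_energy n (p : R * R) : R :=
  (3 * (strip_osc (@ext_kernel_x R) n 1 p ^+ 2 + strip_osc (@ext_kernel_x R) n (- 1) p ^+ 2 +
        (strip_osc (@ext_kernel_t R) n 1 p ^+ 2 + strip_osc (@ext_kernel_t R) n (- 1) p ^+ 2)) +
   3 / pi ^+ 2 * ((f n p.1 - f (n + 1) p.1) ^+ 2 * (c n <= p.2 < c n + pi)%R%:R))%R.

Lemma measurable_strip_osc K n e : averaging_kernel K -> measurable_fun setT (strip_osc K n e).
Proof.
move=> aK; have [mf _] := lf n; have mo := measurable_oscillation mf aK.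
have ms : measurable_fun setT (fun p : R * R => (p.1, e * (p.2 - c n))%R) by mfun.
exact: (measurableT_comp mo ms).
Qed.

Lemma measurable_strip_energy n : measurable_fun setT (strip_energy n).
Proof.
have m1 := measurable_strip_osc n 1 (averaging_kernel_kernel_x R).
have m2 := measurable_strip_osc n (- 1) (averaging_kernel_kernel_x R).
have m3 := measurable_strip_osc n 1 (averaging_kernel_kernel_t R).
have m4 := measurable_strip_osc n (- 1) (averaging_kernel_kernel_t R).
have [mf _] := lf n; have [mf1 _] := lf (n + 1)%R.
by rewrite /strip_energy; mfun.
Qed.

Lemma strip_energy_ge0 n p : (0 <= strip_energy n p)%R.
Proof.
rewrite /strip_energy; apply: addr_ge0.
  by apply: mulr_ge0 => //; apply: addr_ge0; apply: addr_ge0; exact: sqr_ge0.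
by apply: mulr_ge0; [apply: divr_ge0 => //; exact: sqr_ge0|apply: mulr_ge0 => //; exact: sqr_ge0].
Qed.

Lemma integral_strip_osc_le K n e : e = 1%R \/ e = (- 1)%R -> averaging_kernel K ->
  \int[leb2 R]_p (strip_osc K n e p ^+ 2)%:E <= (181 * pi)%:E * gagliardo (f n).
Proof.
move=> e1 aK; apply: le_trans (oscillation_L2_le (lf n) aK).
have ms := measurable_strip_osc n e aK.
rewrite -(@ge0_leb2_flip R (c n) e (fun p => (strip_osc K n e p ^+ 2)%:E))//.
- by rewrite /strip_osc; under eq_integral do rewrite /= flipK//.
- by mfun.
- by move=> p; rewrite lee_fin sqr_ge0.
Qed.

Lemma integral_strip_difference n :
  \int[leb2 R]_p ((f n p.1 - f (n + 1)%R p.1) ^+ 2 * (c n <= p.2 < c n + pi)%R%:R)%:E =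
  pi%:E * L2_norm2 (fun x => f n x - f (n + 1) x)%R.
Proof.
have [mf _] := lf n; have [mf1 _] := lf (n + 1)%R; have pi0 := @pi_gt0 R.
rewrite leb2_tonelli1; last 2 first.
- by mfun.
- by move=> p; rewrite lee_fin mulr_ge0// sqr_ge0.
rewrite /L2_norm2 -ge0_integralZl_EFin; last 4 first.
- exact: measurableT.
- by move=> x _; rewrite lee_fin sqr_ge0.
- by mfun.
- exact: ltW.
apply: eq_integral => x _ /=; under eq_integral do rewrite EFinM.
rewrite ge0_integralZl_EFin; last 4 first.
- exact: measurableT.
- by move=> y _; rewrite lee_fin.
- by mfun.
- exact: sqr_ge0.
rewrite muleC; congr (_ * _).
transitivity (\int[leb R]_y (\1_(`[c n, (c n + pi)%R[%classic) y)%:E).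
  by apply: eq_integral => y _; rewrite indicE mem_setE in_itv/=.
rewrite integral_indic//= setIT /leb lebesgue_measure_itv/= lte_fin ltrDl pi0.
by rewrite -EFinD addrAC subrr add0r.
Qed.

Lemma glued_energy_le (p : R * R) :
  (strip_glue (fun n => line_ext_x (f n) (c n)) p ^+ 2 +
   strip_glue (fun n => line_ext_y (f n) (c n)) p ^+ 2 <= strip_glue strip_energy p)%R.
Proof.
have pi0 := @pi_gt0 R.
have k := averaging_kernel_kernel R; have kx := averaging_kernel_kernel_x R.
have kt := averaging_kernel_kernel_t R.
have /andP[] := strip_indexP p.2; rewrite /strip_glue -/c.
move: (strip_index p.2) => m h1 h2; have cS : c (m + 1) = (c m + pi)%R by exact: line_heightS.
have z1 K : averaging_kernel K -> one_sided (f m) K (c m) (- 1) p = 0%R.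
  by move=> aK; apply: average_out => //; rewrite mulN1r; apply/negP => /andP[]; lra.
have z2 K : averaging_kernel K -> one_sided (f (m + 1)) K (c (m + 1)) 1 p = 0%R.
  by move=> aK; apply: average_out => //; rewrite mul1r cS; apply/negP => /andP[]; lra.
rewrite /line_ext_x /line_ext_y !z1// !z2// subr0 sub0r addr0 add0r.
rewrite /one_sided !average_ext_kernel_x// !average_ext_kernel_t//.
(* The distances to the two adjacent lines are t and pi - t, so the two mean terms carry the same
   indicator and combine into one difference. *)
have -> : (0 < -1 * (p.2 - c (m + 1)) < pi)%R = (0 < 1 * (p.2 - c m) < pi)%R.
  by rewrite cS mul1r; apply/idP/idP => /andP[g1 g2]; apply/andP; split; lra.
rewrite /strip_energy -/(strip_osc (@ext_kernel_x R) m 1 p) -/(strip_osc (@ext_kernel_t R) m 1 p).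
rewrite -/(strip_osc (@ext_kernel_x R) (m + 1) (-1) p) -/(strip_osc (@ext_kernel_t R) (m + 1) (-1) p).
rewrite h1 h2 /= mulr1.
move: (strip_osc (@ext_kernel_x R) m 1 p) (strip_osc (@ext_kernel_x R) m (-1) p) => a1 a2.
move: (strip_osc (@ext_kernel_t R) m 1 p) (strip_osc (@ext_kernel_t R) m (-1) p) => a3 a4.
move: (strip_osc (@ext_kernel_x R) (m + 1) 1 p) (strip_osc (@ext_kernel_x R) (m + 1) (-1) p) => b1 b2.
move: (strip_osc (@ext_kernel_t R) (m + 1) 1 p) (strip_osc (@ext_kernel_t R) (m + 1) (-1) p) => b3 b4.
have d2 : (0 <= 3 / pi ^+ 2 * ((f (m + 1) p.1 - f (m + 1 + 1) p.1) ^+ 2 *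
    (c (m + 1) <= p.2 < c (m + 1) + pi)%R%:R))%R.
  by apply: mulr_ge0; [apply: divr_ge0 => //; exact: sqr_ge0|apply: mulr_ge0 => //; exact: sqr_ge0].
move: (3 / pi ^+ 2 * (_ * (_ <= _ < _)%R%:R))%R d2 => D D0.
have -> : (3 / pi ^+ 2 * (f m p.1 - f (m + 1) p.1) ^+ 2 =
    3 * ((f m p.1 - f (m + 1) p.1) / pi) ^+ 2 :> R)%R.
  by rewrite exprMn -exprVn; ring.
(* This indicator is 0 exactly when p lies on the lower line of its strip. *)
set I := (0 < 1 * (p.2 - c m) < pi)%R%:R.
have I1 : I = 0%R \/ I = 1%R by rewrite /I; case: (_ < _ < _)%R; [right|left].
have -> : (a3 - I * f m p.1 / pi - (b4 - I * f (m + 1) p.1 / pi) =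
   a3 - b4 - I * ((f m p.1 - f (m + 1) p.1) / pi))%R by ring.
move: ((f m p.1 - f (m + 1) p.1) / pi)%R => z.
have s1 := sqr_ge0 a1; have s2 := sqr_ge0 a2; have s3 := sqr_ge0 a3; have s4 := sqr_ge0 a4.
have t1 := sqr_ge0 b1; have t2 := sqr_ge0 b2; have t3 := sqr_ge0 b3; have t4 := sqr_ge0 b4.
have z0 := sqr_ge0 z.
have e1 : ((a1 + b2) ^+ 2 <= 2 * (a1 ^+ 2 + b2 ^+ 2))%R by have := sqr_ge0 (a1 - b2); nra.
have e2 : ((a3 - b4 - I * z) ^+ 2 <= 3 * (a3 ^+ 2 + b4 ^+ 2 + z ^+ 2))%R.
  have := sqr_ge0 (a3 + b4); have := sqr_ge0 (a3 + z); have := sqr_ge0 (b4 - z).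
  by case: I1 => ->; nra.
lra.
Qed.

End glued_energy.

Section energy_bound.
Local Open Scope ereal_scope.
Context (R : realType).

Lemma le_integralD d (T : measurableType d) (mu : {measure set T -> \bar R})
    (g h : T -> R) (A B : \bar R) :
  measurable_fun setT g -> measurable_fun setT h ->
  (forall p, 0 <= g p)%R -> (forall p, 0 <= h p)%R ->
  \int[mu]_p (g p)%:E <= A -> \int[mu]_p (h p)%:E <= B ->
  \int[mu]_p (g p + h p)%:E <= A + B.
Proof.
move=> mg mh g0 h0 gA hB; under eq_integral do rewrite EFinD.
rewrite ge0_integralD ?leeD//; [by move=> p _; rewrite lee_fin|by mfun|
  by move=> p _; rewrite lee_fin|by mfun].
Qed.

Lemma le_integralZ d (T : measurableType d) (mu : {measure set T -> \bar R})
    (k : R) (g : T -> R) (A : \bar R) : (0 <= k)%R ->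
  measurable_fun setT g -> (forall p, 0 <= g p)%R ->
  \int[mu]_p (g p)%:E <= A -> \int[mu]_p (k * g p)%:E <= k%:E * A.
Proof.
move=> k0 mg g0 gA; under eq_integral do rewrite EFinM.
rewrite ge0_integralZl_EFin//; last 2 first.
- by move=> p _; rewrite lee_fin.
- by mfun.
by rewrite lee_wpmul2l.
Qed.

Lemma sum_le_esum (a : int -> \bar R) (N : int) (s : seq nat) : uniq s ->
  \sum_(i <- s) a (i%:Z - N)%R <= esum [set: int] a.
Proof.
move=> us; apply: esum_ge; exists [set` [seq (i%:Z - N)%R | i <- s]].
  by split => //; exact: finite_seq.
rewrite -fsbig_seq; first by rewrite big_map.
by rewrite map_inj_uniq// => i j /addIr [].
Qed.

Variable f : int -> R -> R.
Hypothesis hf : forall n, Hhalf (f n).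
Hypothesis df : forall n : int, L2 (fun x => f n x - f (n + 1) x)%R.

Let lf n : L2loc (f n). Proof. by have [] := hf n. Qed.
Let c := line_height R.

Lemma gagliardoE n : Hhalf_norm2 (f n) = 2%:E * gagliardo (f n).
Proof. by have [mf _] := lf n; rewrite Hhalf_norm2E. Qed.

Lemma gagliardo_ge0 (g : R -> R) : 0 <= gagliardo g.
Proof.
by apply: integral_ge0 => p _; rewrite lee_fin mulr_ge0 ?sqr_ge0// divr_ge0// sqr_ge0.
Qed.

Lemma gagliardo_lty n : gagliardo (f n) < +oo.
Proof.
have [_] := hf n; rewrite gagliardoE; apply: le_lt_trans.
by rewrite -[leLHS]mul1e lee_wpmul2r ?gagliardo_ge0// lee_fin ler1n.
Qed.

Lemma L2_norm2_ge0 (g : R -> R) : 0 <= L2_norm2 g.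
Proof. by apply: integral_ge0 => x _; rewrite lee_fin sqr_ge0. Qed.

(** Four oscillations at 181 pi each, with the factor 3, give 12 * 181 pi times [gagliardo], which
    is half of the seminorm. The difference only costs (3 / pi^2) pi = 3 / pi <= 2. *)
Lemma integral_strip_energy_le n : \int[leb2 R]_p (strip_energy f n p)%:E <=
  (12 * (181 * pi))%:E * (Hhalf_norm2 (f n) + L2_norm2 (fun x => f n x - f (n + 1) x)%R).
Proof.
have pi0 := @pi_gt0 R; have pi2 := @pi_ge2 R.
have k := averaging_kernel_kernel_x R; have kt := averaging_kernel_kernel_t R.
have s1 : (1 : R)%R = 1%R \/ (1 : R)%R = (- 1)%R by left.
have s2 : (- 1 : R)%R = 1%R \/ (- 1 : R)%R = (- 1)%R by right.
have i1 := integral_strip_osc_le lf n s1 k; have i2 := integral_strip_osc_le lf n s2 k.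
have i3 := integral_strip_osc_le lf n s1 kt; have i4 := integral_strip_osc_le lf n s2 kt.
have m1 := measurable_strip_osc lf n 1 k; have m2 := measurable_strip_osc lf n (- 1) k.
have m3 := measurable_strip_osc lf n 1 kt; have m4 := measurable_strip_osc lf n (- 1) kt.
have D := integral_strip_difference lf n.
have [mf _] := lf n; have [mf1 _] := lf (n + 1)%R.
have md : measurable_fun setT (fun p : R * R =>
    (f n p.1 - f (n + 1) p.1) ^+ 2 * (c n <= p.2 < c n + pi)%R%:R)%R by mfun.
have p30 : (0 <= 3 / pi ^+ 2 :> R)%R by apply: divr_ge0 => //; exact: sqr_ge0.
have [_ /integrableP[_ D2]] := df n.
have Dfin : L2_norm2 (fun x => f n x - f (n + 1) x)%R < +oo.
  apply: le_lt_trans D2; apply: nn_le_integral => x _; first by rewrite lee_fin sqr_ge0.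
  by rewrite abse_EFin lee_fin ler_norm.
have DE : L2_norm2 (fun x => f n x - f (n + 1) x)%R =
    (fine (L2_norm2 (fun x => f n x - f (n + 1) x)%R))%:E.
  by rewrite fineK// ge0_fin_numE// L2_norm2_ge0.
have d0 : (0 <= fine (L2_norm2 (fun x => f n x - f (n + 1) x)%R))%R.
  by rewrite fine_ge0// L2_norm2_ge0.
have JE : gagliardo (f n) = (fine (gagliardo (f n)))%:E.
  by rewrite fineK// ge0_fin_numE ?gagliardo_ge0// gagliardo_lty.
have j0 : (0 <= fine (gagliardo (f n)))%R by rewrite fine_ge0// gagliardo_ge0.
have sq (a : R) : (0 <= a ^+ 2)%R by exact: sqr_ge0.
pose o1 p := strip_osc f (@ext_kernel_x R) n 1 p; pose o2 p := strip_osc f (@ext_kernel_x R) n (- 1) p.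
pose o3 p := strip_osc f (@ext_kernel_t R) n 1 p; pose o4 p := strip_osc f (@ext_kernel_t R) n (- 1) p.
have mo12 : measurable_fun setT (fun p => o1 p ^+ 2 + o2 p ^+ 2)%R by rewrite /o1 /o2; mfun.
have mo34 : measurable_fun setT (fun p => o3 p ^+ 2 + o4 p ^+ 2)%R by rewrite /o3 /o4; mfun.
have mO : measurable_fun setT (fun p => o1 p ^+ 2 + o2 p ^+ 2 + (o3 p ^+ 2 + o4 p ^+ 2))%R.
  by rewrite /o1 /o2 /o3 /o4; mfun.
have o12 := @le_integralD _ _ (leb2 R) _ _ _ _ (measurable_funX 2 m1) (measurable_funX 2 m2)
  (fun p => sq (o1 p)) (fun p => sq (o2 p)) i1 i2.
have o34 := @le_integralD _ _ (leb2 R) _ _ _ _ (measurable_funX 2 m3) (measurable_funX 2 m4)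
  (fun p => sq (o3 p)) (fun p => sq (o4 p)) i3 i4.
have o12_0 p : (0 <= o1 p ^+ 2 + o2 p ^+ 2)%R by rewrite addr_ge0.
have o34_0 p : (0 <= o3 p ^+ 2 + o4 p ^+ 2)%R by rewrite addr_ge0.
have O := @le_integralD _ _ (leb2 R) _ _ _ _ mo12 mo34 o12_0 o34_0 o12 o34.
have O_0 p : (0 <= o1 p ^+ 2 + o2 p ^+ 2 + (o3 p ^+ 2 + o4 p ^+ 2))%R by rewrite addr_ge0.
have three0 : (0 <= 3 :> R)%R by [].
have O3 := @le_integralZ _ _ (leb2 R) _ _ _ three0 mO O_0 O.
have nd (p : R * R) : (0 <= (f n p.1 - f (n + 1) p.1) ^+ 2 * (c n <= p.2 < c n + pi)%R%:R)%R.
  by apply: mulr_ge0.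
have D' : \int[leb2 R]_p ((f n p.1 - f (n + 1)%R p.1) ^+ 2 * (c n <= p.2 < c n + pi)%R%:R)%:E <=
  pi%:E * L2_norm2 (fun x => f n x - f (n + 1) x)%R by rewrite D.
have d3 := @le_integralZ _ _ (leb2 R) _ _ _ p30 md nd D'.
have m3O : measurable_fun setT (fun p =>
    3 * (o1 p ^+ 2 + o2 p ^+ 2 + (o3 p ^+ 2 + o4 p ^+ 2)))%R by mfun.
have mD : measurable_fun setT (fun p : R * R => 3 / pi ^+ 2 *
    ((f n p.1 - f (n + 1) p.1) ^+ 2 * (c n <= p.2 < c n + pi)%R%:R))%R by mfun.
have h := @le_integralD _ _ (leb2 R) _ _ _ _ m3O mD (fun p => mulr_ge0 three0 (O_0 p))
  (fun p => mulr_ge0 p30 (nd p)) O3 d3.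
apply: (le_trans h) => {h O3 d3 O o12 o34 i1 i2 i3 i4 D D'}.
have [P P0 PE] : exists2 P : R, (1 <= P)%R & P = (181 * pi)%R.
  apply: (ex_intro2 _ _ (181 * pi)%R _ (erefl _)).
  by apply: (@le_trans _ _ (1 * 2)%R); [rewrite mul1r ler1n|apply: ler_pM => //; rewrite ler1n].
have pp : (3 / pi ^+ 2 * pi <= 2 :> R)%R.
  have -> : (3 / (pi : R) ^+ 2 * pi = 3 / pi)%R.
    by move: (pi : R) pi0 => q q0; field; rewrite gt_eqF.
  by rewrite ler_pdivrMr//; lra.
rewrite gagliardoE -PE muleA DE JE -?(EFinM, EFinD) lee_fin.
move: (fine (gagliardo (f n))) (fine (L2_norm2 _)) j0 d0 => J E j0 d0.
have : (3 / pi ^+ 2 * pi * E <= 2 * E)%R by rewrite ler_wpM2r.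
have : (0 <= P * J)%R by rewrite mulr_ge0// (le_trans _ P0).
have : (E <= P * E)%R by rewrite ler_peMl.
have -> : (12 * P * (2 * J + E) = 24 * (P * J) + 12 * (P * E))%R by ring.
move: (3 / pi ^+ 2 * pi)%R => q; move: (P * J)%R (P * E)%R (q * E)%R => *; lra.
Qed.

Lemma strip_supported_energy : strip_supported (strip_energy f).
Proof.
move=> n p h; have pi0 := @pi_gt0 R.
have k := averaging_kernel_kernel_x R; have kt := averaging_kernel_kernel_t R.
have s1 : (1 : R)%R = 1%R \/ (1 : R)%R = (- 1)%R by left.
have s2 : (- 1 : R)%R = 1%R \/ (- 1 : R)%R = (- 1)%R by right.
have out (e : R) : e = 1%R \/ e = (- 1)%R -> ~~ (0 < e * (p.2 - c n) < pi)%R.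
  move=> e1; apply/negP => /andP[h1 h2]; move: h; rewrite leNgt => /negP; apply.
  by rewrite ltr_norml; case: e1 h1 h2 => ->; rewrite ?mul1r ?mulN1r => h1 h2;
    apply/andP; split; rewrite -/c; lra.
have o1 K e : e = 1%R \/ e = (- 1)%R -> averaging_kernel K -> strip_osc f K n e p = 0%R.
  by move=> e1 aK; apply: oscillation_out => //; exact: out.
rewrite /strip_energy !o1// expr0n/= !addr0 mulr0 add0r.
rewrite (_ : (_ <= _ < _)%R = false) ?mulr0 ?mulr0//.
apply/negP => /andP[h1 h2]; move: h; rewrite leNgt => /negP; apply.
by rewrite ltr_norml; apply/andP; split; lra.
Qed.

Lemma integral_glued_energy_le :
  \int[leb2 R]_p (strip_glue (fun n => line_ext_x (f n) (c n)) p ^+ 2 +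
    strip_glue (fun n => line_ext_y (f n) (c n)) p ^+ 2)%:E <=
  (12 * (181 * pi))%:E * family_norm2 f.
Proof.
have [_ sx sy] := strip_supported_ext f; have pi0 := @pi_gt0 R.
have lx n := locally_integrable2_line_ext (c n) (lf n) (gagliardo_lty n).
have mx : measurable_fun setT (strip_glue (fun n => line_ext_x (f n) (c n))).
  by apply: measurable_strip_glue => // n; have [_ [] ] := lx n.
have my : measurable_fun setT (strip_glue (fun n => line_ext_y (f n) (c n))).
  by apply: measurable_strip_glue => // n; have [_ _ [] ] := lx n.
pose g p := (strip_glue (fun n => line_ext_x (f n) (c n)) p ^+ 2 +
    strip_glue (fun n => line_ext_y (f n) (c n)) p ^+ 2)%R.
have g0 p : (0 <= g p)%R by rewrite /g addr_ge0 ?sqr_ge0.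
have gE p : (g p <= strip_glue (strip_energy f) p)%R := glued_energy_le lf p.
have mE := measurable_strip_energy lf.
apply: (@fatou_ae_le _ _ _ (leb2 R) (fun p => (g p)%:E)
  (fun N p => (\sum_(i < N.*2.+1) strip_energy f (i%:Z - N%:Z) p)%:E)) => //.
- by rewrite /g; mfun.
- by move=> N; apply/measurable_EFinP; apply: measurable_sum => i; exact: mE.
- by move=> N p; rewrite lee_fin sumr_ge0// => i _; exact: strip_energy_ge0.
- move=> N; under eq_integral do rewrite -sumEFin.
  rewrite ge0_integral_sum//; last 2 first.
  + by move=> i; apply/measurable_EFinP; exact: mE.
  + by move=> i p _; rewrite lee_fin strip_energy_ge0.
  apply: (@le_trans _ _ (\sum_(i < N.*2.+1) ((12 * (181 * pi))%:E * (Hhalf_norm2 (f (i%:Z - N%:Z)) +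
      L2_norm2 (fun x => f (i%:Z - N%:Z) x - f (i%:Z - N%:Z + 1) x)%R)))).
    by apply: lee_sum => i _; exact: integral_strip_energy_le.
  rewrite -ge0_sume_distrr; last first.
    move=> i _; apply: adde_ge0; last exact: L2_norm2_ge0.
    by rewrite gagliardoE mule_ge0 ?gagliardo_ge0.
  apply: lee_wpmul2l; first by rewrite lee_fin; do 2 (apply: mulr_ge0 => //); exact: ltW.
  rewrite big_split/= /family_norm2; apply: leeD.
    have := @sum_le_esum (fun n => Hhalf_norm2 (f n)) N%:Z (iota 0 N.*2.+1) (iota_uniq _ _).
    by rewrite -[iota _ _]/(index_iota 0 N.*2.+1) big_mkord.
  have := @sum_le_esum (fun n => L2_norm2 (fun x => f n x - f (n + 1) x)%R) N%:Z
    (iota 0 N.*2.+1) (iota_uniq _ _).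
  by rewrite -[iota _ _]/(index_iota 0 N.*2.+1) big_mkord.
- apply: aeW => p.
  (* At each p the partial sums equal the glued energy from some N on; until then 0 is a minorant,
     as the energies are nonnegative. *)
  exists (fun N => if (\sum_(i < N.*2.+1) strip_energy f (i%:Z - N%:Z) p ==
    strip_glue (strip_energy f) p)%R then (g p)%:E else 0).
    apply: cvg_near_cst; apply: filterS (strip_glue_sum_near p strip_supported_energy) => N ->.
    by rewrite eqxx.
  move=> N; case: ifPn => [/eqP ->|_]; first by rewrite lee_fin.
  by rewrite lee_fin sumr_ge0// => i _; exact: strip_energy_ge0.
Qed.

End energy_bound.

(** * Traces of the glued extension *)

Section oscillation_slices.
Local Open Scope ereal_scope.
Context (R : realType).
Implicit Types (f : R -> R).

(** Cauchy-Schwarz uses the mass 1 - u of the kernel, with u = t / pi. On 0 < s <= u the kernel is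
    at most 2 u (1 - u) / u^2 <= 2 u (1 - u) / s^2, so that a factor u is gained over [gagliardo].
    The bound tends to 0 both at t = 0 and at t = pi, as needed for the line itself and for its
    neighbour. *)
Lemma oscillation_ext_kernel_le f (x t : R) : L2loc f -> (0 < t < pi)%R ->
  (oscillation f (@ext_kernel R) x t ^+ 2)%:E <= (2 * (t / pi) * (1 - t / pi) ^+ 2)%:E *
  \int[leb R]_s ((0 < s <= 1)%R%:R / s ^+ 2 * (f (x + s)%R - f x) ^+ 2)%:E.
Proof.
move=> lf ht; have [mf _] := lf; have /andP[] := ratio_bounds ht.
have ak := averaging_kernel_kernel R; have mk := measurable_kernel_section t ak.
have Ik := Rintegral_kernel ht; have ik := integrable_kernel t ak.
have kb s : (0 <= ext_kernel t s <= 2 / (t / pi) * (1 - t / pi) * (0 <= s <= t / pi)%R%:R)%R.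
  by have := kernel_le t s; rewrite ht.
have k0 s : (0 <= ext_kernel t s)%R by have /andP[] := kb s.
move: (t / pi)%R Ik kb => u Ik kb u0 u1.
have mg : measurable_fun setT (fun s => f (x + s) - f x)%R by mfun.
have v0 : (`|oscillation f (@ext_kernel R) x t|)%:E <=
    \int[leb R]_s (`|f (x + s) - f x| * ext_kernel t s)%:E.
  have [C C0 KC] := averaging_kernel_bound t ak.
  have i1 := integrable_average x lf mk C0 KC.
  have i2 := integrable_average x (L2loc_cst (f x)) mk C0 KC.
  have i3 : (leb R).-integrable setT (fun s => ((f (x + s) - f x) * ext_kernel t s)%:E).
    have := integrableB measurableT i1 i2; apply: eq_integrable => // s _.
    by rewrite /= mulrBl EFinB.
  rewrite /oscillation EFin_normr_Rintegral//.
  apply: le_trans (le_abse_integral _ _ _) _ => //; first by mfun.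
  apply: nn_le_integral => s _; first exact: abse_ge0.
  by rewrite abse_EFin lee_fin normrM (ger0_norm (k0 s)).
have kY : \int[leb R]_s (ext_kernel t s / 1)%:E <= (1 - u)%:E.
  under eq_integral do rewrite divr1.
  rewrite -Ik /Rintegral fineK//; exact: integrable_fin_num.
have Y0 : (0 < 1 - u)%R by rewrite subr_gt0.
have m1 : measurable_fun setT (fun _ : R => 1%R : R) by mfun.
have := @weighted_cauchy_schwarz _ _ _ (leb R) _ (fun=> 1%R) _ _ _ mg m1 mk (fun=> ltr01) k0 Y0 v0 kY.
move=> /le_trans; apply.
have -> : (2 * u * (1 - u) ^+ 2 = (1 - u) * (2 * u * (1 - u)))%R by ring.
rewrite EFinM -muleA; apply: lee_wpmul2l; first by rewrite lee_fin ltW.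
have c0 : (0 <= 2 * u * (1 - u))%R by rewrite mulr_ge0 ?(ltW Y0)// mulr_ge0// ltW.
rewrite -ge0_integralZl_EFin; last 4 first.
- exact: measurableT.
- by move=> s _; rewrite lee_fin mulr_ge0 ?sqr_ge0// divr_ge0// sqr_ge0.
- by mfun.
- exact: c0.
apply: nn_le_integral => s _; first by rewrite lee_fin mulr1 mulr_ge0// sqr_ge0.
rewrite -EFinM lee_fin mulr1.
have [->|s0] := eqVneq s 0%R; first by rewrite addr0 subrr expr0n/= !(mul0r, mulr0).
have := sqr_ge0 (f (x + s) - f x)%R; move: ((f (x + s) - f x) ^+ 2)%R => D D0.
have /andP[_ ks] := kb s.
rewrite mulrC [leRHS]mulrA ler_wpM2r//; apply: (le_trans ks).
case: (boolP (0 <= s <= u)%R) => [/andP[s1 s2]|_]; last first.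
  by rewrite mulr0 mulr_ge0// divr_ge0// sqr_ge0.
have s3 : (0 < s)%R by rewrite lt_neqAle eq_sym s0.
rewrite s3 (le_trans s2 (ltW u1)) /= !mulr1 mul1r.
have -> : (2 / u * (1 - u) = 2 * u * (1 - u) / u ^+ 2)%R by field; rewrite gt_eqF.
rewrite ler_wpM2l// lef_pV2 ?posrE ?exprn_gt0//.
by rewrite ler_sqr ?nnegrE// ltW.
Qed.

Lemma oscillation_slice_le f (t : R) : L2loc f -> (0 < t < pi)%R ->
  \int[leb R]_x (oscillation f (@ext_kernel R) x t ^+ 2)%:E <=
  (2 * (t / pi) * (1 - t / pi) ^+ 2)%:E * gagliardo f.
Proof.
move=> lf ht; have [mf _] := lf; have /andP[u0 u1] := ratio_bounds ht.
rewrite /gagliardo leb2_tonelli1; last 2 first.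
- by mfun.
- by move=> p; rewrite lee_fin mulr_ge0 ?sqr_ge0// divr_ge0// sqr_ge0.
rewrite -ge0_integralZl_EFin; last 4 first.
- exact: measurableT.
- by move=> x _; apply: integral_ge0 => s _; rewrite lee_fin mulr_ge0 ?sqr_ge0// divr_ge0// sqr_ge0.
- apply: (@measurable_parametric_integral _ _ _ _ _ (leb R) (fun q : R * R =>
    (0 < q.2 <= 1)%R%:R / q.2 ^+ 2 * (f (q.1 + q.2) - f q.1) ^+ 2)%R).
  by mfun.
- by rewrite mulr_ge0 ?sqr_ge0// mulr_ge0// ltW.
apply: nn_le_integral => x _; first by rewrite lee_fin sqr_ge0.
exact: oscillation_ext_kernel_le.
Qed.

End oscillation_slices.

Section glued_extension.
Local Open Scope ereal_scope.
Context (R : realType).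
Variable f : int -> R -> R.
Hypothesis hf : forall n, Hhalf (f n).
Hypothesis df : forall n : int, L2 (fun x => f n x - f (n + 1) x)%R.

Let lf n : L2loc (f n). Proof. by have [] := hf n. Qed.
Let c := line_height R.
Let F := strip_glue (fun n => line_ext (f n) (c n)).
Let G1 := strip_glue (fun n => line_ext_x (f n) (c n)).
Let G2 := strip_glue (fun n => line_ext_y (f n) (c n)).

Lemma H1_norm2_glued_le : H1_norm2 G1 G2 <= (12 * (181 * pi))%:E * family_norm2 f.
Proof. exact: integral_glued_energy_le. Qed.

Lemma H1_grad_glued : family_norm2 f < +oo -> H1_grad F G1 G2.
Proof.
move=> ff; have pi0 := @pi_ge0 R; have [s0 s1 s2] := strip_supported_ext f.
have lx n := locally_integrable2_line_ext (c n) (lf n) (gagliardo_lty hf n).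
have lF : locally_integrable2 F.
  by apply: locally_integrable2_strip_glue => // n; have [] := lx n.
have lG1 : locally_integrable2 G1.
  by apply: locally_integrable2_strip_glue => // n; have [] := lx n.
have lG2 : locally_integrable2 G2.
  by apply: locally_integrable2_strip_glue => // n; have [] := lx n.
have [mF iF] := lF; have [mG1 _] := lG1; have [mG2 _] := lG2.
have Hlty : H1_norm2 G1 G2 < +oo.
  apply: le_lt_trans H1_norm2_glued_le _; apply: lte_mul_pinfty => //.
  by rewrite lee_fin; do 2 (apply: mulr_ge0 => //).
split=> //; split=> //; split; [|split].
- split=> //; apply: integrable_normP; first by mfun.
  apply: le_lt_trans Hlty; apply: nn_le_integral => p _; first by rewrite lee_fin.
  by rewrite lee_fin ger0_norm ?sqr_ge0// lerDl sqr_ge0.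
- split=> //; apply: integrable_normP; first by mfun.
  apply: le_lt_trans Hlty; apply: nn_le_integral => p _; first by rewrite lee_fin.
  by rewrite lee_fin ger0_norm ?sqr_ge0// lerDr sqr_ge0.
- move=> phi tf; have [dphi [cf [c1 [c2 _]]]] := tf.
  have [L [M [L0 b0 b1 b2]]] := test_fun_bounded tf.
  have m0 := continuous_plane_measurable cf.
  have m1 := continuous_plane_measurable c1; have m2 := continuous_plane_measurable c2.
  split.
    apply: (@strip_glue_weak R _ _ _ _ L M) => // n; try by have [] := lx n.
    by apply: line_ext_weak_x => //; exact: gagliardo_lty.
  apply: (@strip_glue_weak R _ _ _ _ L M) => // n; try by have [] := lx n.
  by apply: line_ext_weak_y => //; exact: gagliardo_lty.
Qed.

Lemma strip_index_eq (n : int) (y : R) : (c n <= y < c n + pi)%R -> strip_index y = n.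
Proof.
have pi0 := @pi_gt0 R; move=> /andP[h1 h2]; have /andP[g1 g2] := strip_indexP y.
move: (strip_index y) g1 g2 => m g1 g2.
have a1 : (m < n + 1)%R.
  rewrite -(ltr_int R) -(ltr_pM2l pi0) -[X in (_ < X)%R]/(line_height R (n + 1)) line_heightS.
  exact: le_lt_trans g1 h2.
have a2 : (n < m + 1)%R.
  rewrite -(ltr_int R) -(ltr_pM2l pi0) -[X in (_ < X)%R]/(line_height R (m + 1)) line_heightS.
  exact: le_lt_trans h1 g2.
lia.
Qed.

(** The means of the two kernels, 1 - t / pi and t / pi, add up to 1, so the non-oscillating part
    interpolates linearly between f_n and f_(n+1). *)
Lemma glued_sub_trace (n : int) (x t : R) : (0 < t < pi)%R ->
  (F (x, c n + t) - f n x)%R =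
  (oscillation (f n) (@ext_kernel R) x t + oscillation (f (n + 1)) (@ext_kernel R) x (pi - t) +
   t / pi * (f (n + 1) x - f n x))%R.
Proof.
move=> /andP[t0 t1]; have pi0 := @pi_gt0 R.
have ak := averaging_kernel_kernel R.
rewrite /F /strip_glue /= (@strip_index_eq n); last by apply/andP; split; lra.
have cS : c (n + 1) = (c n + pi)%R by exact: line_heightS.
rewrite /line_ext /one_sided /= cS.
have -> : (1 * (c n + t - c n) = t)%R by ring.
have -> : (-1 * (c n + t - c n) = - t)%R by ring.
have -> : (1 * (c n + t - (c n + pi)) = t - pi)%R by ring.
have -> : (-1 * (c n + t - (c n + pi)) = pi - t)%R by ring.
rewrite (average_out _ _ ak (t := (- t)%R)); last by apply/negP => /andP[]; lra.
rewrite (average_out _ _ ak (t := (t - pi)%R)); last by apply/negP => /andP[]; lra.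
rewrite !average_ext_kernel//; [|by apply/andP; split; lra|by apply/andP; split].
have -> : (1 - (pi - t) / pi = t / pi :> R)%R.
  by move: (pi : R) pi0 => q q0; field; rewrite gt_eqF.
ring.
Qed.

(** With u = t / pi the three terms of [glued_sub_trace] have squared norms at most 2 u (1 - u)^2, 2
    u^2 (1 - u) and u^2 times finite quantities. Each is O(u), and u <= t; the factor 3 for the
    square of the sum gives the coefficients 6, 6 and 3. *)
Lemma glued_slice_le (n : int) : exists2 E : R, (0 <= E)%R &
  forall t : R, (0 < t < pi)%R ->
  \int[leb R]_x ((F (x, c n + t) - f n x) ^+ 2)%R%:E <= (t * E)%:E.
Proof.
have pi0 := @pi_gt0 R; have pi2 := @pi_ge2 R; have ak := averaging_kernel_kernel R.
pose D := L2_norm2 (fun x => f n x - f (n + 1) x)%R.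
have [_ /integrableP[_ D2]] := df n.
have D0 : 0 <= D by exact: L2_norm2_ge0.
have DE : D = (fine D)%:E.
  rewrite fineK// ge0_fin_numE//; apply: le_lt_trans D2; apply: nn_le_integral => x _.
    by rewrite lee_fin sqr_ge0.
  by rewrite abse_EFin lee_fin ler_norm.
have JE k : gagliardo (f k) = (fine (gagliardo (f k)))%:E.
  by rewrite fineK// ge0_fin_numE ?gagliardo_ge0// gagliardo_lty.
have j0 k : (0 <= fine (gagliardo (f k)))%R by rewrite fine_ge0// gagliardo_ge0.
have d0 : (0 <= fine D)%R by rewrite fine_ge0.
exists (6 * fine (gagliardo (f n)) + 6 * fine (gagliardo (f (n + 1)%R)) + 3 * fine D)%R.
  by apply: addr_ge0; [apply: addr_ge0|]; apply: mulr_ge0.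
move=> t ht; have ht' : (0 < pi - t < pi)%R by move: ht => /andP[? ?]; apply/andP; split; lra.
have o1 := oscillation_slice_le (lf n) ht; have o2 := oscillation_slice_le (lf (n + 1)%R) ht'.
have [mf _] := lf n; have [mf1 _] := lf (n + 1)%R.
have slice (g : R -> R) (s : R) : measurable_fun setT g ->
    measurable_fun setT (fun x => oscillation g (@ext_kernel R) x s).
  move=> mg; have mo := measurable_oscillation mg ak.
  exact: (measurableT_comp mo (@pair2_measurable _ _ _ _ s)).
have m1 := slice _ t mf; have m2 := slice _ (pi - t)%R mf1.
pose a x := (oscillation (f n) (@ext_kernel R) x t ^+ 2)%R.
pose b x := (oscillation (f (n + 1)%R) (@ext_kernel R) x (pi - t) ^+ 2)%R.
pose d x := ((f n x - f (n + 1) x) ^+ 2)%R.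
have ma : measurable_fun setT a by rewrite /a; mfun.
have mb : measurable_fun setT b by rewrite /b; mfun.
have md : measurable_fun setT d by rewrite /d; mfun.
have a0 x : (0 <= a x)%R by exact: sqr_ge0.
have b0 x : (0 <= b x)%R by exact: sqr_ge0.
have dd0 x : (0 <= d x)%R by exact: sqr_ge0.
have dD : \int[leb R]_x (d x)%:E <= D by [].
have ab := @le_integralD R _ _ (leb R) a b _ _ ma mb a0 b0 o1 o2.
have mab : measurable_fun setT (fun x => a x + b x)%R by mfun.
have ab0 x : (0 <= a x + b x)%R by rewrite addr_ge0.
have tp2 : (0 <= (t / pi) ^+ 2)%R by exact: sqr_ge0.
have d3 := @le_integralZ R _ _ (leb R) _ _ _ tp2 md dd0 dD.
have mtd : measurable_fun setT (fun x => (t / pi) ^+ 2 * d x)%R by mfun.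
have td0 x : (0 <= (t / pi) ^+ 2 * d x)%R by rewrite mulr_ge0.
have abd := @le_integralD R _ _ (leb R) _ _ _ _ mab mtd ab0 td0 ab d3.
have mabd : measurable_fun setT (fun x => a x + b x + (t / pi) ^+ 2 * d x)%R by mfun.
have abd0 x : (0 <= a x + b x + (t / pi) ^+ 2 * d x)%R by rewrite addr_ge0.
have three0 : (0 <= 3 :> R)%R by [].
have key := @le_integralZ R _ _ (leb R) _ _ _ three0 mabd abd0 abd.
apply: (@le_trans _ _ (\int[leb R]_x (3 * (a x + b x + (t / pi) ^+ 2 * d x))%:E)).
  apply: nn_le_integral => x _; first by rewrite lee_fin sqr_ge0.
  rewrite lee_fin (glued_sub_trace n x ht) /a /b /d.
  move: (oscillation _ _ _ _) (oscillation _ _ _ _) => p q.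
  have -> : ((t / pi) ^+ 2 * (f n x - f (n + 1) x) ^+ 2 =
    (t / pi * (f (n + 1) x - f n x)) ^+ 2)%R by ring.
  move: (t / pi * _)%R => z.
  have := sqr_ge0 (p - q); have := sqr_ge0 (p - z); have := sqr_ge0 (q - z); nra.
apply: (le_trans key); rewrite (JE n) (JE (n + 1)%R) DE -?(EFinM, EFinD) lee_fin.
have /andP[u0 u1] := ratio_bounds ht.
have -> : ((pi - t) / pi = 1 - t / pi :> R)%R.
  by move: (pi : R) pi0 => q q0; field; rewrite gt_eqF.
have ut : (t / pi <= t)%R.
  by have /andP[t0 _] := ht; rewrite ler_pdivrMr// ler_peMr ?(ltW t0)//; lra.
move: (fine (gagliardo (f n))) (fine (gagliardo (f (n + 1)%R))) (fine D) (j0 n) (j0 (n + 1)%R) d0.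
move=> J J' E j0' j1' e0; move: (t / pi)%R u0 u1 ut => u u0 u1 ut.
apply: (@le_trans _ _ (u * (6 * J + 6 * J' + 3 * E))%R); last first.
  by rewrite ler_wpM2r//; apply: addr_ge0; [apply: addr_ge0|]; apply: mulr_ge0.
have h1 : (u * (1 - u) ^+ 2 * J <= u * J)%R.
  rewrite ler_wpM2r// ler_piMr ?(ltW u0)// expr_le1//; lra.
have h2 : ((1 - u) * u ^+ 2 * J' <= u * J')%R.
  rewrite ler_wpM2r// expr2 mulrA mulrAC ler_piMl ?(ltW u0)//; nra.
have h3 : (u ^+ 2 * E <= u * E)%R by rewrite ler_wpM2r//; nra.
have -> : (1 - (1 - u) = u)%R by ring.
nra.
Qed.

(** Slices at height t differ from f_n by O(t) in squared norm, so the integral over 0 < t < e is at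
    most e^2 E and its average at most e E. *)
Lemma is_trace_glued (n : int) : is_trace F (c n) (f n).
Proof.
split=> // a b; have pi0 := @pi_gt0 R; have [mf _] := lf n.
have [E E0 hE] := glued_slice_le n.
have [s0 _ _] := strip_supported_ext f.
have mF : measurable_fun setT F.
  apply: measurable_strip_glue => // k.
  by have [[]] := locally_integrable2_line_ext (c k) (lf k) (gagliardo_lty hf k).
apply: (@squeeze_cvge _ _ _ _ (fun=> 0) _ (fun e : R => (e * E)%:E)); last 2 first.
- exact: cvg_cst.
- apply: cvg_EFin; first by near=> e.
  have h : (fun e : R => (e * E)%R) @ 0%R^'+ --> (0 * E)%R.
    by apply: cvg_at_right_filter; apply: cvgM; [exact: cvg_id|exact: cvg_cst].
  by rewrite mul0r in h.
near=> e; have e0 : (0 < e)%R by near: e; exact: nbhs_right_gt.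
have ep : (e < pi)%R by near: e; exact: nbhs_right_lt.
apply/andP; split.
  apply: mule_ge0; first by rewrite lee_fin invr_ge0 ltW.
  by apply: integral_ge0 => p _; rewrite lee_fin sqr_ge0.
suff h : \int[leb2 R]_(p in `[a, b] `*` `[c n, (c n + e)%R]) ((F p - f n p.1) ^+ 2)%R%:E <=
    (e * (e * E))%:E.
  apply: (@le_trans _ _ ((e^-1)%:E * (e * (e * E))%:E)).
    by apply: lee_wpmul2l => //; rewrite lee_fin invr_ge0 ltW.
  by rewrite -EFinM mulKf// gt_eqF.
pose g (p : R * R) := ((c n <= p.2 <= c n + e)%R%:R * (F p - f n p.1) ^+ 2)%R.
have mg : measurable_fun setT g by rewrite /g; mfun.
have g0 p : (0 <= g p)%R by rewrite /g mulr_ge0// sqr_ge0.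
apply: (@le_trans _ _ (\int[leb2 R]_p (g p)%:E)).
  apply: nn_integral_setT_le => [p _|p|p [_ /=]]; rewrite ?lee_fin ?sqr_ge0//.
  by rewrite in_itv/= /g => ->; rewrite mul1r.
rewrite leb2_tonelli2; last 2 first.
- by mfun.
- by move=> p; rewrite lee_fin.
apply: (@le_trans _ _ (\int[leb R]_y ((e * E)%:E * ((c n <= y <= c n + e)%R%:R)%:E))).
  apply: ae_ge0_le_integral => //.
  - by move=> y _; apply: integral_ge0 => x _; rewrite lee_fin.
  - have mg' : measurable_fun setT (fun p : R * R => g (p.2, p.1)).
      have ms : measurable_fun setT (fun p : R * R => (p.2, p.1)) by mfun.
      exact: (measurableT_comp mg ms).
    exact: (@measurable_parametric_integral _ _ _ _ _ (leb R) (fun p : R * R => g (p.2, p.1))).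
  - by move=> y _; rewrite -EFinM lee_fin mulr_ge0// mulr_ge0// ltW.
  - by apply: emeasurable_funM; mfun.
  (* The slice on the line itself, where the glued function does not take the value f_n in general,
     is discarded as a null set: [glued_slice_le] requires t > 0. *)
  - exists [set c n]; split; first exact: measurable_set1.
      exact: lebesgue_measure_set1.
    move=> y /= hy; apply: contrapT => yc; apply: hy => _.
    have [/andP[y1 y2]|hy] := boolP (c n <= y <= c n + e)%R; last first.
      by rewrite mule0 integral0_eq// => x _; rewrite /g/= (negbTE hy) mul0r.
    have yt : (0 < y - c n < pi)%R.
      apply/andP; split; last lra.
      by rewrite subr_gt0 lt_neqAle y1 andbT eq_sym; apply/eqP.
    rewrite mule1; apply: (@le_trans _ _ ((y - c n) * E)%:E); last first.
      by rewrite lee_fin ler_wpM2r//; lra.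
    apply: le_trans (hE _ yt); rewrite addrC subrK.
    by apply: nn_le_integral => x _; rewrite /g/= ?y1 ?y2 ?mul1r ?lee_fin ?sqr_ge0.
rewrite ge0_integralZl_EFin; last 4 first.
- exact: measurableT.
- by move=> y _; rewrite lee_fin.
- by mfun.
- by rewrite mulr_ge0// ltW.
rewrite integral_indic_itv; last by rewrite lerDl ltW.
by rewrite addrAC subrr add0r -EFinM mulrC.
Unshelve. all: by end_near.
Qed.

End glued_extension.

Theorem theorem3p4 (R : realType) :
  exists C1 C2 : R, 0 < C1 /\ 0 < C2 /\
  (* trace direction: f_n = T_n F with F in H^1 *)
  (forall (F G1 G2 : R * R -> R) (f : int -> R -> R),
     H1_grad F G1 G2 ->
     (forall n : int, is_trace F (line_height R n) (f n)) ->
     (forall n : int, Hhalf (f n)) /\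
     (forall n : int, L2 (fun x => f n x - f (n + 1)%R x)) /\
     (family_norm2 f <= C1%:E * H1_norm2 G1 G2)%E) /\
  (* extension direction *)
  (forall f : int -> R -> R,
     (forall n : int, Hhalf (f n)) ->
     (forall n : int, L2 (fun x => f n x - f (n + 1)%R x)) ->
     (family_norm2 f < +oo)%E ->
     exists F G1 G2 : R * R -> R,
       H1_grad F G1 G2 /\
       (forall n : int, is_trace F (line_height R n) (f n)) /\
       (H1_norm2 G1 G2 <= C2%:E * family_norm2 f)%E).
Proof.
have pi0 := @pi_gt0 R.
(* The first constant is 3 * 216 + 3 * 4 (pi + 1), with 3 the overlap of the strips; the second is
   that of [integral_strip_energy_le], which summation over the lines does not increase. *)
exists (648 + 12 * (pi + 1)), (12 * (181 * pi)); split; [|split; [|split]].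
- apply: addr_gt0; first by rewrite ltr0n.
  by apply: mulr_gt0; [rewrite ltr0n|apply: addr_gt0].
- by do 2 (apply: mulr_gt0; first by rewrite ltr0n).
- by move=> F G1 G2 f FG tf; have [h1 h2 h3] := trace_theorem FG tf.
- move=> f hf df ff.
  exists (strip_glue (fun n => line_ext (f n) (line_height R n))).
  exists (strip_glue (fun n => line_ext_x (f n) (line_height R n))).
  exists (strip_glue (fun n => line_ext_y (f n) (line_height R n))).
  split; first exact: H1_grad_glued.
  by split; [exact: is_trace_glued|exact: H1_norm2_glued_le].
Qed.
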